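(* Let $(X,\mathbb{P})$ be a recurrent one-dimensional Lévy process with characteristic exponent $\Psi$ such that $\int_0^\infty \left|\frac{1}{q+\Psi(\lambda)}\right| d\lambda<\infty$ for each $q>0$. For $q>0$ and $x\in\mathbb{R}$ let $h_q(x)=r_q(0)-r_q(-x)$, where $r_q$ is the bounded continuous $q$-resolvent density of $X$, and let $m^2=\mathbb{P}[X_1^2]\in(0,\infty]$. Then: (i) For every $x\in\mathbb{R}$ the limit $h(x):=\lim_{q\to0+}h_q(x)$ exists and is finite. If $m^2<\infty$, then $$h(x)=\frac1\pi\int_0^\infty \operatorname{Re}\left(\frac{1-e^{\mathrm{i}\lambda x}}{\Psi(\lambda)}\right)d\lambda .$$ (ii) The convergence $h_q\to h$ as $q\to0+$ is uniform on compact subsets of $\mathbb{R}$, and consequently $h$ is continuous. (iii) $h$ is subadditive on $\mathbb{R}$: $h(x+y)\le h(x)+h(y)$ for all $x,y\in\mathbb{R}$.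
   Context: $(X=(X_t)_{t\ge0},\mathbb{P}_x)$ is the canonical representation of a one-dimensional Lévy process started from $x$, and $\mathbb{P}=\mathbb{P}_0$; $\mathbb{P}[\cdot]$ also denotes expectation. The characteristic exponent $\Psi$ is defined by $\mathbb{P}[e^{\mathrm{i}\lambda X_t}]=e^{-t\Psi(\lambda)}$. Recurrent means: $\mathbb{P}\left[\int_0^\infty 1_{\{|X_t-a|<\varepsilon\}}dt\right]=\infty$ for all $a\in\mathbb{R}$, $\varepsilon>0$. Under the integrability assumption on $\Psi$, for each $q>0$ there is a bounded continuous $q$-resolvent density $r_q$, i.e. $\int_{\mathbb{R}}f(x)r_q(x)\,dx=\mathbb{P}\left[\int_0^\infty e^{-qt}f(X_t)\,dt\right]$ for all non-negative measurable $f$; it satisfies $r_q(x)=\frac1\pi\int_0^\infty\operatorname{Re}\left(\frac{e^{-\mathrm{i}\lambda x}}{q+\Psi(\lambda)}\right)d\lambda$, so that $h_q(x)=\frac1\pi\int_0^\infty\operatorname{Re}\left(\frac{1-e^{\mathrm{i}\lambda x}}{q+\Psi(\lambda)}\right)d\lambda$. *)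

(* Defs.v *)
From HB Require Import structures.
From mathcomp Require Import all_boot all_order all_algebra.
From mathcomp Require Import complex.
From mathcomp Require Import all_classical all_reals all_analysis.

Set Implicit Arguments.
Unset Strict Implicit.
Unset Printing Implicit Defensive.

Import Order.TTheory GRing.Theory Num.Theory.
Import numFieldNormedType.Exports.

Local Open Scope classical_set_scope.
Local Open Scope ring_scope.
Local Open Scope complex_scope.

Definition expC (R : realType) (z : R[i]) : R[i] :=
  (expR (complex.Re z))%:C * (cos (complex.Im z) +i* sin (complex.Im z)).

Definition modC (R : realType) (z : R[i]) : R := ComplexField.Normc.normc z.

(* Complex-valued expectation; only used on bounded random variables. *)
Definition expectationC (R : realType) (d : measure_display)
    (T : measurableType d) (P : probability T R) (Z : T -> R[i]) : R[i] :=
  (\int[P]_w complex.Re (Z w)) +i* (\int[P]_w complex.Im (Z w)).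

(* As the events B i range over all Borel sets, including setT, the product
   rule over the whole index set contains the one over every subfamily. *)
Definition mutually_independent (R : realType) (d : measure_display)
    (T : measurableType d) (P : probability T R) (n : nat)
    (Y : 'I_n -> T -> R) : Prop :=
  forall B : 'I_n -> set R, (forall i, measurable (B i)) ->
    P (\bigcap_(i in [set: 'I_n]) (Y i @^-1` B i)) =
    (\prod_(i < n) fine (P (Y i @^-1` B i)))%:E.

(* Processes are indexed by all of R so that they can be integrated in time,
   but only the values X t with 0 <= t are constrained or used.  As in the
   canonical (path space) representation, every path is càdlàg. *)
Record levy_process (R : realType) (d : measure_display)
    (T : measurableType d) (P : probability T R) (X : R -> T -> R) : Prop := {
  levy_measurable : forall t, 0 <= t -> measurable_fun setT (X t) ;
  levy_start0 : P [set w | X 0 w = 0] = 1%E ;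
  levy_right_continuous :
    forall w t, 0 <= t -> X s w @[s --> t^'+] --> X t w ;
  levy_left_limits : forall w t, 0 < t -> cvg (X s w @[s --> t^'-]) ;
  levy_stationary_increments : forall s t (B : set R),
    0 <= s -> 0 <= t -> measurable B ->
    P [set w | B (X (s + t) w - X s w)] = P [set w | B (X t w)] ;
  levy_independent_increments : forall (n : nat) (t : nat -> R),
    0 <= t 0%N -> {homo t : i j / (i <= j)%N >-> i <= j} ->
    mutually_independent P
      (fun (i : 'I_n) (w : T) => X (t i.+1) w - X (t i) w)
}.

(* Quantifying over every t >= 0 makes Psi unique (a single t would leave it
   undetermined up to 2 pi i / t). *)
Definition characteristic_exponent (R : realType) (d : measure_display)
    (T : measurableType d) (P : probability T R) (X : R -> T -> R)
    (Psi : R -> R[i]) : Prop :=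
  forall t l : R, 0 <= t ->
    expectationC P (fun w => expC (0 +i* (l * X t w))) =
    expC (- (t%:C * Psi l)).

Definition recurrent (R : realType) (d : measure_display)
    (T : measurableType d) (P : probability T R) (X : R -> T -> R) : Prop :=
  forall a e : R, 0 < e ->
    (\int[P]_w \int[lebesgue_measure]_(t in `[0%R, +oo[)
       (\1_[set s | `|X s w - a| < e] t)%:E = +oo)%E.

Definition resolvent_density (R : realType) (d : measure_display)
    (T : measurableType d) (P : probability T R) (X : R -> T -> R)
    (q : R) (rq : R -> R) : Prop :=
  forall f : R -> R, measurable_fun setT f -> (forall x, 0 <= f x) ->
    (\int[lebesgue_measure]_x (f x * rq x)%:E =
     \int[P]_w \int[lebesgue_measure]_(t in `[0%R, +oo[)
       (expR (- (q * t)) * f (X t w))%:E)%E.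

Definition h_ (R : realType) (r : R -> R -> R) (q x : R) : R :=
  r q 0 - r q (- x).

(* Main.v *)
Require Import Defs.
From HB Require Import structures.
From mathcomp Require Import all_boot all_order all_algebra.
From mathcomp Require Import complex ring lra.
From mathcomp Require Import all_classical all_reals all_analysis.
From mathcomp Require Import measurable_realfun.

Set Implicit Arguments.
Unset Strict Implicit.
Unset Printing Implicit Defensive.

Import Order.TTheory GRing.Theory Num.Theory.
Import numFieldNormedType.Exports.

Local Open Scope classical_set_scope.
Local Open Scope ring_scope.
Local Open Scope complex_scope.

(** Write [psi = a + i b] for the exponent and [F q = 1 / (q + psi)].

The densities are recovered from their characteristic function [F q] by Fourier
inversion on the half-line ([resolvent_density_fourier]), so that [h_q x] is
[1 / pi] times the integral over frequencies [l >= 0] of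
[(1 - cos (l x)) Re (F q l) + sin (l x) Im (F q l)].
The only difficulty as [q -> 0+] is at [l = 0].  The difference [1 - Re (F 1 l)]
is the mean of [1 - cos (l z)] under a continuous probability density, hence at
least a multiple of [min 1 (l^2)] ([one_sub_reF1_ge]); therefore
[min 1 (l^2) |F q l|] is at most a constant times the integrable [|F 1 l|], for
all [q >= 0] at once ([absF_dominated]).  The weight [1 - cos (l x)] is
quadratic at [0] and harmless, whereas [sin (l x)] is only linear.  Subtracting
[x sin l] from it gives
[h_q x = drift_free q x + x drift q] ([hq_decomposition]), where the first term
converges by domination, locally uniformly in [x], and where
[drift q], which is [1 / pi] times the integral of [sin l Im (F q l)], is a
single number.  All of (i) and (ii) is reduced to the convergence of [drift q],
which is obtained differently in two cases.

- Infinite variance: [|psi l| / l^2] tends to infinity at [0].  Since [r q] is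
  maximal at [0], [0 <= h_q x <= h_q x + h_q (- x)], and in the last sum the
  sines cancel; it is [o(x)] as [x -> oo], uniformly in [q].  So
  [x |drift q - drift q'|] is at most [o(x)] plus a quantity vanishing with
  [q] and [q'], and [drift] is Cauchy ([drift_cvg_infinite_variance]).
- Finite variance: if the mean were not [0], then [|psi l| >= c l] near [0],
  which keeps [r q 0] bounded as [q -> 0+] ([rho0_bounded]) and makes the
  expected occupation time of [(-1, 1)] finite, against recurrence
  ([recurrent_unbounded]).  With mean [0], [|Im psi l|] is at most [l^3] times
  an integrable function of [l], plus [3 |psi l|^2]; this dominates
  [sin l Im (F q l)] by an integrable function ([drift_cvg_finite_variance]),
  the limit of the drift is its value at [q = 0], and the two terms recombine
  to the integral formula for [h] ([potential_kernel_drift0]).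

Both the maximality of [r q] at [0] and the subadditivity of [h_q] express that
[x |-> r q (- x) / r q 0] is the Laplace transform of the hitting time of [0]
from [x].  Hitting times are avoided here: [x |-> r q (- x)] is the [q]-potential
of the unit mass at [0], and a combination [u] of it and of its translate with
[u x = c r q (- x) - d r q (- (x + y))], [c, d >= 0], satisfies
[u <= max (u 0) 0], because it is the potential of a charge whose positive
part sits at [0] ([maximum_principle]).  The choices [c = 1], [d = 0] and [c = r q (- y)],
[d = r q 0] give the two facts. *)

(** * Elementary inequalities for sine and cosine *)

Section trig.
Context {R : realType}.
Implicit Types x t l : R.

(** The bounds below compare two functions that agree at 0 through the sign of
the derivative of their difference on the half-line. *)
Lemma nondecreasing_of_is_derive (f df : R -> R) :
  (forall t, is_derive t 1 f (df t)) -> (forall t, 0 <= t -> 0 <= df t) ->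
  forall x t, 0 <= x -> x <= t -> f x <= f t.
Proof.
move=> fdf df0 x t x0; rewrite le_eqVlt => /predU1P[->//|xt].
have [|c xc] := @MVT R f df x t xt.
- apply: derivable_within_continuous => z _.
  exact: (@ex_derive _ _ _ _ _ _ _ (fdf z)).
- by move/eqP; rewrite subr_eq addrC => /eqP ->;
  rewrite lerDl mulr_ge0 ?subr_ge0 ?(ltW xt)// df0// (le_trans x0)// (itvP xc).
Qed.

Lemma sin_le_id t : 0 <= t -> sin t <= t.
Proof.
move=> t0; have := @nondecreasing_of_is_derive (fun s => s - sin s)
  (fun s => 1 - cos s) _ _ 0 t (lexx 0) t0.
rewrite sin0 subrr subr_ge0 => h; apply: h => s _.
by rewrite subr_ge0 cos_le1.
Qed.

Lemma norm_sin_le t : `|sin t| <= `|t|.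
Proof.
wlog t0 : t / 0 <= t => [h|].
  have [/h//|/ltW t0] := leP 0 t.
  by have := h (- t); rewrite sinN !normrN oppr_ge0; apply.
rewrite (ger0_norm t0) ler_norml sin_le_id// andbT.
have := @nondecreasing_of_is_derive (fun s => s + sin s)
  (fun s => 1 + cos s) _ _ 0 t (lexx 0) t0.
rewrite sin0 addr0 => h; rewrite lerNl -subr_ge0 opprK; apply: h => s _.
by rewrite -lerBlDl sub0r cos_geN1.
Qed.

Lemma one_sub_cosE t : 1 - cos t = 2 * sin (t / 2) ^+ 2.
Proof.
have {1}-> : t = (t / 2) *+ 2 by rewrite mulr2n -splitr.
rewrite cos_mulr2n; have := cos2Dsin2 (t / 2); lra.
Qed.

Lemma one_sub_cos_ge0 t : 0 <= 1 - cos t.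
Proof. by rewrite subr_ge0 cos_le1. Qed.

Lemma one_sub_cos_le2 t : 1 - cos t <= 2.
Proof. by have := cos_geN1 t; lra. Qed.

Lemma one_sub_cos_le t : 1 - cos t <= t ^+ 2 / 2.
Proof.
have : sin (t / 2) ^+ 2 <= (t / 2) ^+ 2.
  by rewrite -[leLHS]real_normK ?num_real// -[leRHS]real_normK ?num_real//
    ler_sqr ?nnegrE// norm_sin_le.
rewrite one_sub_cosE; lra.
Qed.

Lemma id_sub_sin_le t : 0 <= t -> t - sin t <= t ^+ 3.
Proof.
move=> t0; have := @nondecreasing_of_is_derive (fun s => s ^+ 3 - (s - sin s))
  (fun s => 3 * s ^+ 2 - (1 - cos s)) _ _ 0 t (lexx 0) t0.
rewrite sin0 expr0n/= !subrr subr_ge0; apply.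
  move=> s; apply: is_derive_eq; rewrite /GRing.scale/=; lra.
by move=> s s0; have := one_sub_cos_le s; have := sqr_ge0 s; lra.
Qed.

Lemma norm_sin_sub_id t : `|sin t - t| = `|t| - sin `|t|.
Proof.
wlog t0 : t / 0 <= t => [h|].
  have [/h//|/ltW t0] := leP 0 t.
  by have := h (- t); rewrite sinN -opprD !normrN oppr_ge0; apply.
by rewrite distrC (ger0_norm t0) ger0_norm// subr_ge0 sin_le_id.
Qed.

Lemma norm_sin_sub_id_le_sqr t : `|sin t - t| <= 2 * t ^+ 2.
Proof.
rewrite norm_sin_sub_id -(real_normK (num_real t)).
have : 0 <= `|t| by [].
move: `|t| => {t} t t0; have [t1|t1] := leP t 1.
  have := id_sub_sin_le t0; have : t ^+ 3 <= t ^+ 2 by nra.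
  have := sqr_ge0 t; lra.
have := sin_geN1 t; nra.
Qed.

(** The bound is cubic at 0 and linear at infinity, as is the left-hand side.
Compared with a minimum of the two powers, this form has an elementary integral
over [l >= 0] when [t = l * y]; see [cauchy_cubicE]. *)
Lemma norm_sin_sub_id_le t : `|sin t - t| <= 4 * (`|t| ^+ 3 / (1 + t ^+ 2)).
Proof.
rewrite norm_sin_sub_id -(real_normK (num_real t)).
have : 0 <= `|t| by [].
move: `|t| => {t} t t0.
have p : 0 < 1 + t ^+ 2 by have := sqr_ge0 t; lra.
rewrite mulrA ler_pdivlMr//; have [t1|t1] := leP t 1.
  have h := id_sub_sin_le t0.
  have : (t - sin t) * (1 + t ^+ 2) <= t ^+ 3 * (1 + t ^+ 2) by rewrite ler_pM2r.
  have : t ^+ 3 * (1 + t ^+ 2) <= t ^+ 3 * 4.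
    by apply: ler_wpM2l; [exact: exprn_ge0|nra].
  lra.
have h : t - sin t <= 2 * t by have := sin_geN1 t; lra.
have : (t - sin t) * (1 + t ^+ 2) <= 2 * t * (1 + t ^+ 2) by rewrite ler_pM2r.
have : 0 <= t * (t ^+ 2 - 1) by nra.
nra.
Qed.

Lemma one_sub_cos_ge t : `|t| <= 1 -> t ^+ 2 / 8 <= 1 - cos t.
Proof.
wlog t0 : t / 0 <= t => [h|].
  have [/h//|/ltW t0] := leP 0 t.
  by have := h (- t); rewrite sqrrN cosN normrN oppr_ge0; apply.
rewrite (ger0_norm t0) => t1.
have h0 : 0 <= t / 2 by lra.
have := id_sub_sin_le h0.
rewrite one_sub_cosE => h.
have : t / 4 <= sin (t / 2).
  have : (t / 2) ^+ 3 <= t / 8 by nra.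
  lra.
by move: (sin _) => s; nra.
Qed.

(** When [1 - cos (l z)] is integrated over an interval of length [w], the part
that depends on the position of the interval is at most [2 |sin t| / l] with
[t = l w / 2]; the present gap is what is left of [w] whatever the position. *)
Lemma id_sub_norm_sin_ge t : 0 <= t ->
  t * Num.min 1 (t ^+ 2) / 48 <= t - `|sin t|.
Proof.
move=> t0; have tm : t * Num.min 1 (t ^+ 2) <= t.
  by rewrite ler_piMr// ge_min lexx.
have tm3 : t * Num.min 1 (t ^+ 2) <= t ^+ 3.
  by rewrite [leRHS]exprS ler_wpM2l// ge_min lexx orbT.
(* Above 2, [|sin t| <= 1 <= t / 2]; below, [sin t >= 0] and the cubic bound
   applies to [t], or to 1 since [t - sin t] is nondecreasing. *)
have [t2|t2] := leP 2 t.
  have : `|sin t| <= 1 by rewrite ler_norml sin_geN1 sin_le1.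
  lra.
have -> : `|sin t| = sin t.
  rewrite ger0_norm// sin_ge0_pi// t0/=.
  by rewrite (le_trans (ltW t2))// pi_ge2.
have mono x s : 0 <= x -> x <= s -> x - sin x - x ^+ 3 / 48 <= s - sin s - x ^+ 3 / 48.
  move=> x0 xs; rewrite lerD2r.
  exact: (@nondecreasing_of_is_derive (fun s => s - sin s)
    (fun s => 1 - cos s) _ (fun u _ => one_sub_cos_ge0 u)).
have key x : 0 <= x <= 1 -> x ^+ 3 / 24 <= x - sin x.
  move=> /andP[x0 x1].
  pose f (s : R) := s - sin s - s ^+ 3 / 24.
  have [||c xc] := @MVT_segment R f (fun s => 1 - cos s - s ^+ 2 / 8) 0 x x0.
  - by move=> z _; apply: is_derive_eq; rewrite /GRing.scale/=; lra.
  - apply: derivable_within_continuous => z _; rewrite /f.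
    by apply: ex_derive.
  - rewrite /f sin0 expr0n/= mul0r !subr0 => h.
    have : 0 <= 1 - cos c - c ^+ 2 / 8.
      by rewrite subr_ge0 one_sub_cos_ge// ger0_norm ?(itvP xc)// (le_trans _ x1)// (itvP xc).
    move=> /mulr_ge0/(_ x0); rewrite -h; lra.
have [t1|t1] := leP t 1.
  have := key t; rewrite t0 t1 => /(_ isT); have := exprn_ge0 3 t0; lra.
have := key 1; rewrite ler01 lexx => /(_ isT).
have := mono 1 t ler01 (ltW t1).
rewrite expr1n; lra.
Qed.

End trig.

(** * The complex exponential near the origin *)

Section complex_exponential_bounds.
Context {R : realType}.
Implicit Types a b : R.

Lemma expRN_le a : 0 <= a -> expR (- a) <= 1 - a + a ^+ 2.
Proof.
move=> a0; have a1 : 0 < 1 + a by lra.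
rewrite expRN; apply: (@le_trans _ _ (1 + a)^-1).
  by rewrite lef_pV2 ?posrE ?expR_gt0// expR_ge1Dx.
rewrite -[leLHS]mul1r ler_pdivrMr//.
have : 0 <= a ^+ 3 by exact: exprn_ge0.
nra.
Qed.

Lemma one_sub_expRN_ge0 a : 0 <= a -> 0 <= 1 - expR (- a).
Proof. by move=> a0; rewrite subr_ge0 expR_le1 oppr_le0. Qed.

Lemma one_sub_expRN_le a : 1 - expR (- a) <= a.
Proof. by have := expR_ge1Dx (- a); lra. Qed.

(** For [psi = a + i b], the number [exp (- psi)] has real part
[expR (- a) * cos b] and imaginary part [- expR (- a) * sin b].  The bound is
[|1 - exp (- psi)| <= |psi|] on [Re psi >= 0]. *)
Lemma sqr_one_sub_Re_expN_le a b : 0 <= a ->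
  (1 - expR (- a) * cos b) ^+ 2 <= a ^+ 2 + b ^+ 2.
Proof.
move=> a0.
have h1 := one_sub_expRN_ge0 a0.
have h2 := one_sub_expRN_le a.
have e0 := expR_gt0 (- a).
have c1 := one_sub_cos_ge0 b.
have c2 := one_sub_cos_le b.
have cs := cos2Dsin2 b.
(* The intermediate value is [|1 - exp (- psi)|^2]. *)
apply: (@le_trans _ _ ((1 - expR (- a)) ^+ 2 + expR (- a) * (2 * (1 - cos b)))).
  rewrite -subr_ge0; move: (expR _) h1 {h2} e0 => e h1 e0.
  have -> : (1 - e) ^+ 2 + e * (2 * (1 - cos b)) - (1 - e * cos b) ^+ 2 =
    (e * sin b) ^+ 2.
    have -> : (e * sin b) ^+ 2 = e ^+ 2 * (1 - cos b ^+ 2).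
      by rewrite -cs; ring.
    ring.
  exact: sqr_ge0.
apply: lerD; first by rewrite ler_sqr ?nnegrE.
have : expR (- a) * (2 * (1 - cos b)) <= 1 * (2 * (1 - cos b)).
  by apply: ler_wpM2r; [rewrite mulr_ge0|lra].
lra.
Qed.

Lemma norm_Im_expN_le a b : 0 <= a -> `|expR (- a) * sin b| <= `|b|.
Proof.
move=> a0; rewrite normrM (ger0_norm (expR_ge0 _)).
apply: le_trans (norm_sin_le b).
by rewrite ler_piMl// expR_le1 oppr_le0.
Qed.

(** The moments of a random variable control [exp (- psi)]; this and the next
bounds carry the control over to [psi], up to an error quadratic in [psi]. *)
Lemma norm_Im_sub_le a b : 0 <= a ->
  `|b| <= `|expR (- a) * sin b| + 3 * (a ^+ 2 + b ^+ 2).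
Proof.
move=> a0.
have h1 := one_sub_expRN_ge0 a0.
have h2 := one_sub_expRN_le a.
have -> : b = expR (- a) * sin b + ((1 - expR (- a)) * sin b - (sin b - b)) by ring.
apply: (le_trans (ler_normD _ _)).
have -> : expR (- a) * sin b + ((1 - expR (- a)) * sin b - (sin b - b)) = b by ring.
rewrite lerD2l; apply: (le_trans (ler_normB _ _)).
have := norm_sin_sub_id_le_sqr b.
have : `|(1 - expR (- a)) * sin b| <= a * `|b|.
  by rewrite normrM (ger0_norm h1); apply: ler_pM => //; exact: norm_sin_le.
have : a * `|b| <= a ^+ 2 + b ^+ 2.
  rewrite -(real_normK (num_real b)); have := normr_ge0 b; nra.
have := sqr_ge0 a; have := sqr_ge0 b; lra.
Qed.

Lemma Re_le_one_sub_Re_expN a b : 0 <= a ->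
  a <= 1 - expR (- a) * cos b + a ^+ 2.
Proof.
move=> a0; have h := expRN_le a0.
have : expR (- a) * cos b <= expR (- a) by rewrite ler_piMr ?expR_ge0 ?cos_le1.
lra.
Qed.

End complex_exponential_bounds.

(** * Dominated convergence and iterated integrals *)

Section integration.
Context {R : realType}.
Notation mu := (@lebesgue_measure R).

Lemma Rintegral_dominated_cvg d (T : measurableType d)
    (m : {measure set T -> \bar R}) (D : set T) (f_ : nat -> T -> R)
    (f g : T -> R) : measurable D ->
  (forall n, measurable_fun D (f_ n)) ->
  (forall x, D x -> f_ n x @[n --> \oo] --> f x) ->
  m.-integrable D (EFin \o g) ->
  (forall n x, D x -> `|f_ n x| <= g x) ->
  m.-integrable D (EFin \o f) /\
  \int[m]_(x in D) f_ n x @[n --> \oo] --> \int[m]_(x in D) f x.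
Proof.
move=> mD mf ff ig fg.
have mef n : measurable_fun D (EFin \o f_ n) by exact/measurable_EFinP.
have cvgf x : D x -> (EFin \o f_ n) x @[n --> \oo] --> (f x)%:E.
  by move=> Dx; apply: cvg_EFin; [exact: nearW|exact: ff].
have mf' : measurable_fun D (EFin \o f) by exact: (emeasurable_fun_cvg _ _ mef cvgf).
have fgae : {ae m, forall x n, D x -> (`|(EFin \o f_ n) x| <= (EFin \o g) x)%E}.
  by apply: aeW => x n Dx; rewrite lee_fin; exact: fg.
have [intf _ cvgint] := dominated_convergence mD mef mf' (aeW _ cvgf) ig fgae.
split => //.
by apply: fine_cvg; rewrite /Rintegral fineK ?integrable_fin_num//.
Qed.

(** Convergence along [0^'+] can be tested on sequences, so the sequential
theorem is enough. *)
Lemma Rintegral_dominated_cvg_at_right d (T : measurableType d)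
    (m : {measure set T -> \bar R}) (D : set T) (f_ : R -> T -> R)
    (f g : T -> R) : measurable D ->
  (forall q, 0 < q -> measurable_fun D (f_ q)) ->
  (forall x, D x -> f_ q x @[q --> 0^'+] --> f x) ->
  m.-integrable D (EFin \o g) ->
  (forall q x, 0 < q -> D x -> `|f_ q x| <= g x) ->
  m.-integrable D (EFin \o f) /\
  \int[m]_(x in D) f_ q x @[q --> 0^'+] --> \int[m]_(x in D) f x.
Proof.
move=> mD mf ff ig fg.
have key u : (forall n, u n > 0) /\ (u n @[n --> \oo] --> (0 : R)) ->
    m.-integrable D (EFin \o f) /\
    \int[m]_(x in D) f_ (u n) x @[n --> \oo] --> \int[m]_(x in D) f x.
  move=> [u0 ucvg]; apply: (Rintegral_dominated_cvg mD _ _ ig) => [n|x Dx|n x Dx].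
  - exact: mf.
  - by have /cvg_at_rightP := ff x Dx; apply.
  - exact: fg.
split; last by apply/cvg_at_rightP => u /key[].
apply: (proj1 (key (fun n => n.+1%:R^-1) _)); split => [n//|].
exact: cvg_harmonic.
Qed.

Lemma measurable_inv d (T : measurableType d) (f : T -> R) :
  measurable_fun [set: T] f -> (forall x, 0 < f x) ->
  measurable_fun [set: T] (fun x => (f x)^-1).
Proof.
move=> mf f0; rewrite (_ : (fun x => _) = (fun x => expR (- ln (f x)))).
  apply: measurableT_comp => //; apply: measurableT_comp => //.
  exact: (measurableT_comp (@measurable_ln R) mf).
by apply/funext => x; rewrite expRN lnK// posrE.
Qed.

Lemma integrable_mull d (T : measurableType d)
    (m : {measure set T -> \bar R}) (D : set T) (f : T -> R) (k : R) :
  measurable D -> m.-integrable D (EFin \o f) ->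
  m.-integrable D (EFin \o (fun x => k * f x)).
Proof.
move=> mD intf.
rewrite (_ : _ \o _ = (fun x => k%:E * (EFin \o f) x)%E); first exact: integrableZl.
by apply/funext => x /=; rewrite EFinM.
Qed.

Lemma integrableB_EFin d (T : measurableType d)
    (m : {measure set T -> \bar R}) (D : set T) (f g : T -> R) :
  measurable D -> m.-integrable D (EFin \o f) -> m.-integrable D (EFin \o g) ->
  m.-integrable D (EFin \o (fun x => f x - g x)).
Proof. by move=> mD ig jg; exact: (integrableB _ ig jg). Qed.

Lemma integrableD_EFin d (T : measurableType d)
    (m : {measure set T -> \bar R}) (D : set T) (f g : T -> R) :
  measurable D -> m.-integrable D (EFin \o f) -> m.-integrable D (EFin \o g) ->
  m.-integrable D (EFin \o (fun x => f x + g x)).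
Proof. by move=> mD ig jg; exact: (integrableD _ ig jg). Qed.

Lemma integrable_scale_le d (T : measurableType d)
    (m : {measure set T -> \bar R}) (D : set T) (f g : T -> R) (c : R) :
  measurable D -> measurable_fun D f -> m.-integrable D (EFin \o g) ->
  (forall x, D x -> `|f x| <= c * `|g x|) -> m.-integrable D (EFin \o f).
Proof.
move=> mD mf ig fg.
apply: (@le_integrable _ _ _ m D mD _ (EFin \o (fun x => c * `|g x|))).
- exact/measurable_EFinP.
- move=> x Dx /=; rewrite lee_fin; apply: (le_trans (fg x Dx)).
  exact: ler_norm.
- by apply: integrable_mull => //; exact: (integrable_norm ig).
Qed.

Lemma Rintegral_le_scale d (T : measurableType d)
    (m : {measure set T -> \bar R}) (D : set T) (f g : T -> R) (c : R) :
  measurable D -> measurable_fun D f -> m.-integrable D (EFin \o g) ->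
  (forall x, D x -> `|f x| <= c * `|g x|) ->
  `|\int[m]_(x in D) f x| <= c * \int[m]_(x in D) `|g x|.
Proof.
move=> mD mf ig fg; have iF := integrable_scale_le mD mf ig fg.
apply: (le_trans (le_normr_Rintegral mD iF)).
rewrite -RintegralZl//; last exact: integrable_norm.
apply: le_Rintegral => //; first exact: integrable_norm.
by apply: integrable_mull => //; exact: (integrable_norm ig).
Qed.

Section dominated_by_product.
Context d1 d2 (T1 : measurableType d1) (T2 : measurableType d2)
  (m1 : {sigma_finite_measure set T1 -> \bar R})
  (m2 : {sigma_finite_measure set T2 -> \bar R})
  (f : T1 * T2 -> R) (g1 : T1 -> R) (g2 : T2 -> R).
Hypothesis mf : measurable_fun setT f.
Hypothesis ig1 : m1.-integrable setT (EFin \o g1).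
Hypothesis ig2 : m2.-integrable setT (EFin \o g2).
Hypothesis fg : forall x y, `|f (x, y)| <= g1 x * g2 y.

Let mf1 x : measurable_fun setT (fun y => f (x, y)).
Proof. exact: (measurableT_comp mf (pair1_measurable x)). Qed.

Let mf2 y : measurable_fun setT (fun x => f (x, y)).
Proof. exact: (measurableT_comp mf (pair2_measurable y)). Qed.

Let fg1 x y : setT y -> `|f (x, y)| <= `|g1 x| * `|g2 y|.
Proof. by move=> _; rewrite -normrM (le_trans (fg x y))// ler_norm. Qed.

Let fg2 y x : setT x -> `|f (x, y)| <= `|g2 y| * `|g1 x|.
Proof. by move=> _; rewrite mulrC -normrM (le_trans (fg x y))// ler_norm. Qed.

Let i1 x : m2.-integrable setT (fun y => (f (x, y))%:E).
Proof. exact: (integrable_scale_le measurableT (mf1 x) ig2 (fg1 x)). Qed.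

Let i2 y : m1.-integrable setT (fun x => (f (x, y))%:E).
Proof. exact: (integrable_scale_le measurableT (mf2 y) ig1 (fg2 y)). Qed.

Let imf : (m1 \x m2)%E.-integrable setT (EFin \o f).
Proof.
apply/integrable12ltyP; first exact/measurable_EFinP.
apply: (@le_lt_trans _ _ (\int[m1]_x (`|g1 x| * \int[m2]_y `|g2 y|)%:E)%E).
  apply: ge0_le_integral => //=.
  - by move=> x _; exact: integral_ge0.
  - apply: (measurable_fun_fubini_tonelli_F (fun z => `|(f z)%:E|%E)) => //.
    by apply: measurableT_comp => //; exact/measurable_EFinP.
  - apply/measurable_EFinP; apply: measurable_funM => //.
    apply: measurableT_comp => //.
    by apply/measurable_EFinP; exact: (measurable_int m1 ig1).
  - move=> x _; rewrite EFinM /Rintegral fineK; last first.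
      by apply: integrable_fin_num => //; exact: (integrable_norm ig2).
    rewrite -integralZl//; last exact: (integrable_norm ig2).
    apply: ge0_le_integral => //=.
    + by apply/measurable_EFinP; apply: measurableT_comp => //; exact: mf1.
    + apply: measurable_funeM; exact: (measurable_int m2 (integrable_norm ig2)).
    + by move=> y _; rewrite lee_fin fg1.
apply: integrable_lty => //.
rewrite (_ : (fun x => _) = (fun x => (\int[m2]_y `|g2 y|)%:E *
    (EFin \o (Num.norm \o g1)) x)%E).
  by apply: integrableZl => //; exact: integrable_norm.
by apply/funext => x /=; rewrite -EFinM mulrC.
Qed.

Lemma Rintegral_fubini :
  \int[m1]_x \int[m2]_y f (x, y) = \int[m2]_y \int[m1]_x f (x, y).
Proof.
rewrite /Rintegral.
under eq_integral do rewrite fineK ?integrable_fin_num//.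
under [in RHS]eq_integral do rewrite fineK ?integrable_fin_num//.
by congr fine; have := Fubini imf.
Qed.

Lemma integrable_Rintegral1 :
  m1.-integrable setT (EFin \o (fun x => \int[m2]_y f (x, y))).
Proof.
apply: eq_integrable (integrable_fubini_F imf) => // x _.
by rewrite /fubini_F /= fineK// integrable_fin_num.
Qed.

End dominated_by_product.

End integration.

(** * Laplace transforms of trigonometric functions and the Cauchy kernel *)

Section kernels.
Context {R : realType}.
Notation mu := (@lebesgue_measure R).

(** The phase [o] covers the cosine ([o = 0]) and the negative of the sine
([o = pi / 2]) at once.  The summand 1 makes the integrand nonnegative, so that
a primitive and its limit at infinity suffice, and so that the formula can be
used in iterated integrals of nonnegative functions. *)
Lemma integral_expR_cos (q a b o : R) : 0 < q -> 0 <= a ->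
  (\int[mu]_(t in `[0%R, +oo[)
     (expR (- (q * t)) * (1 + expR (- (a * t)) * cos (b * t + o)))%:E =
   (q^-1 + ((q + a) * cos o - b * sin o) / ((q + a) ^+ 2 + b ^+ 2))%:E)%E.
Proof.
move=> q0 a0; pose c := q + a.
have c0 : 0 < c by rewrite /c; lra.
have N0 : 0 < c ^+ 2 + b ^+ 2 by rewrite ltr_pwDl ?exprn_gt0 ?sqr_ge0.
rewrite -/c; set N := c ^+ 2 + b ^+ 2 in N0 *.
pose F (t : R) : R := - q^-1 * expR (- q * t) +
   N^-1 * (expR (- c * t) * (b * sin (b * t + o) - c * cos (b * t + o))).
pose f (t : R) : R := expR (- (q * t)) * (1 + expR (- (a * t)) * cos (b * t + o)).
have dF (t : R) : is_derive t 1 F (f t).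
  apply: is_derive_eq; rewrite /GRing.scale/= /f.
  have -> : expR (- c * t) = expR (- (q * t)) * expR (- (a * t)).
    by rewrite -expRD; congr expR; rewrite /c; ring.
  have -> : expR (- q * t) = expR (- (q * t)) by rewrite mulNr.
  set e1 := expR (- (q * t)); set e2 := expR (- (a * t)).
  rewrite /N; field.
  by rewrite /= -/N (gt_eqF q0) (gt_eqF N0).
have F0 : F 0 = - (q^-1 + (c * cos o - b * sin o) / N).
  by rewrite /F !mulr0 add0r expR0; ring.
rewrite (@ge0_continuous_FTC2y R f F 0 0).
- by rewrite F0 -EFinB; congr EFin; ring.
- move=> t t0; rewrite /f mulr_ge0 ?expR_ge0//.
  have : `|expR (- (a * t)) * cos (b * t + o)| <= 1.
    rewrite normrM -[leRHS]mulr1; apply: ler_pM => //.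
      by rewrite ger0_norm ?expR_ge0// expR_le1 oppr_le0 mulr_ge0.
    by rewrite ler_norml cos_geN1 cos_le1.
  by rewrite ler_norml => /andP[+ _]; lra.
- apply: derivable_within_continuous => t _; rewrite /f.
  by apply: ex_derive.
- apply/cvgr0Pnorm_le => e e0.
  have K0 : 0 <= q^-1 + N^-1 * (`|b| + c).
    have qi : 0 < q^-1 by rewrite invr_gt0.
    have Ni : 0 < N^-1 by rewrite invr_gt0.
    have bc : 0 <= `|b| + c by rewrite addr_ge0// ltW.
    by have := mulr_ge0 (ltW Ni) bc; lra.
  have K1 : 0 < 1 + (q^-1 + N^-1 * (`|b| + c)) by lra.
  have := @cvgr_expR R.
  move=> /cvgr0Pnorm_le /(_ (e / (1 + (q^-1 + N^-1 * (`|b| + c)))) (divr_gt0 e0 K1)).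
  move=> [M [_ HM]].
  near=> t.
  have t0 : 0 <= t by near: t; exact: nbhs_pinfty_ge.
  have qt : M < q * t.
    rewrite mulrC -ltr_pdivrMr//; near: t; apply: nbhs_pinfty_gt.
    by rewrite num_real.
  have := HM _ qt; rewrite ger0_norm ?expR_ge0// ler_pdivlMr// => h.
  apply: le_trans h.
  have ec : expR (- c * t) <= expR (- (q * t)).
    by rewrite ler_expR mulNr lerN2 ler_wpM2r// /c lerDl.
  apply: (@le_trans _ _ (expR (- (q * t)) * (q^-1 + N^-1 * (`|b| + c)))); last first.
    by rewrite ler_wpM2l ?expR_ge0// lerDr.
  apply: (le_trans (ler_normD _ _)); rewrite [leRHS]mulrDr; apply: lerD.
    rewrite normrM normrN (gtr0_norm (expR_gt0 _)) gtr0_norm ?invr_gt0//.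
    by rewrite mulrC mulNr.
  rewrite !normrM (gtr0_norm (expR_gt0 _)) gtr0_norm ?invr_gt0//.
  rewrite mulrCA; apply: ler_pM; rewrite ?expR_ge0//.
  - by rewrite mulr_ge0// invr_ge0 ltW.
  - apply: ler_wpM2l; first by rewrite invr_ge0 ltW.
    apply: (le_trans (ler_normB _ _)); rewrite !normrM (gtr0_norm c0).
    apply: lerD; rewrite ler_piMr// ?(ltW c0)// ler_norml.
      by rewrite sin_geN1 sin_le1.
    by rewrite cos_geN1 cos_le1.
- by move=> t _; apply: ex_derive.
- apply: cvg_at_right_filter; apply: differentiable_continuous.
  by apply/derivable1_diffP; apply: ex_derive.
- by move=> t _; rewrite derive1E; apply: derive_val.
Unshelve. all: by end_near. Qed.

Lemma integrable_expRN (q : R) : 0 < q ->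
  mu.-integrable `[0%R, +oo[ (EFin \o (fun t => expR (- (q * t)))).
Proof.
move=> q0; apply/integrableP; split.
  apply/measurable_EFinP; apply: measurable_funTS; apply: continuous_measurable_fun => t.
  by apply: differentiable_continuous; apply/derivable1_diffP; apply: ex_derive.
have := integral_expR_cos 0 (pi / 2) q0 (lexx 0).
under eq_integral do rewrite mul0r oppr0 expR0 mul1r add0r cos_pihalf addr0 mulr1.
move=> h; under eq_integral do rewrite /= ger0_norm ?expR_ge0//.
by rewrite h ltry.
Qed.

Lemma Rintegral_expRN (q : R) : 0 < q ->
  \int[mu]_(t in `[0%R, +oo[) expR (- (q * t)) = q^-1.
Proof.
move=> q0; have := integral_expR_cos 0 (pi / 2) q0 (lexx 0).
under eq_integral do rewrite mul0r oppr0 expR0 mul1r add0r cos_pihalf addr0 mulr1.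
by rewrite /Rintegral => ->/=; rewrite cos_pihalf mulr0 mul0r subr0 mul0r addr0.
Qed.

Lemma Rintegral_expRN_cos (q b : R) : 0 < q ->
  \int[mu]_(t in `[0%R, +oo[) (expR (- (q * t)) * cos (t * b)) =
  q / (q ^+ 2 + b ^+ 2).
Proof.
move=> q0; have h := integral_expR_cos b 0 q0 (lexx 0).
have -> : \int[mu]_(t in `[0%R, +oo[) (expR (- (q * t)) * cos (t * b)) =
  \int[mu]_(t in `[0%R, +oo[) (expR (- (q * t)) * (1 + expR (- (0 * t)) * cos (b * t + 0)) -
    expR (- (q * t))).
  apply: eq_Rintegral => t _; rewrite mul0r oppr0 expR0 addr0 mulrC (mulrC t).
  ring.
rewrite RintegralB//; last 2 first.
- apply/integrableP; split.
    apply/measurable_EFinP; apply: measurable_funTS; apply: continuous_measurable_fun => t.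
    by apply: differentiable_continuous; apply/derivable1_diffP; apply: ex_derive.
  have nn (t : R) : 0 <= expR (- (q * t)) * (1 + expR (- (0 * t)) * cos (b * t + 0)).
    apply: mulr_ge0; first exact: expR_ge0.
    by rewrite mul0r oppr0 expR0 mul1r; have := cos_geN1 (b * t + 0); lra.
  under eq_integral do rewrite /= ger0_norm ?nn//.
  by rewrite h ltry.
- exact: integrable_expRN.
rewrite Rintegral_expRN// /Rintegral h/= cos0 sin0 mulr0 subr0 mulr1 addr0.
by rewrite addrC addKr.
Qed.

Lemma integral_cauchy_halfline (e : R) : 0 < e ->
  (\int[mu]_(x in `[0%R, +oo[) (e / (e ^+ 2 + x ^+ 2))%:E = (pi / 2)%:E)%E.
Proof.
move=> e0.
have N0 (x : R) : 0 < e ^+ 2 + x ^+ 2 by rewrite ltr_pwDl ?exprn_gt0 ?sqr_ge0.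
have cf : continuous (fun x : R => e / (e ^+ 2 + x ^+ 2)).
  move=> x; apply: cvgM; first exact: cvg_cst.
  apply: cvgV; first by rewrite gt_eqF.
  by apply: cvgD; [exact: cvg_cst|apply: exprn_continuous].
have datan (x : R) : is_derive x 1 (fun x => atan (e^-1 * x)) (e / (e ^+ 2 + x ^+ 2)).
  apply: is_derive_eq; rewrite /GRing.scale/= mulr1; field.
  by rewrite !gt_eqF// ?exprn_gt0// ltr_pwDl.
rewrite (@ge0_continuous_FTC2y R _ (fun x => atan (e^-1 * x)) 0 (pi / 2)).
- by rewrite mulr0 atan0 sube0.
- by move=> x _; rewrite divr_ge0 ?ltW.
- exact/continuous_subspaceT.
- apply: (cvg_comp (fun x => e^-1 * x) atan); last exact: cvgy_atan.
  by apply/cvgryPge => A; near=> x; rewrite mulrC ler_pdivlMr//; near: x;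
    apply: nbhs_pinfty_ge; rewrite num_real.
- by move=> t _; apply: ex_derive.
- apply: cvg_at_right_filter; apply: differentiable_continuous.
  by apply/derivable1_diffP; apply: ex_derive.
- by move=> t _; rewrite derive1E; apply: derive_val.
Unshelve. all: by end_near. Qed.

Lemma integral_cauchy_line (e y : R) : 0 < e ->
  (\int[mu]_x (e / (e ^+ 2 + (y + x) ^+ 2))%:E = pi%:E)%E.
Proof.
move=> e0.
have cf : continuous (fun x : R => e / (e ^+ 2 + x ^+ 2)).
  move=> x; apply: cvgM; first exact: cvg_cst.
  apply: cvgV; first by rewrite gt_eqF// ltr_pwDl ?exprn_gt0 ?sqr_ge0.
  by apply: cvgD; [exact: cvg_cst|apply: exprn_continuous].
have f0 (x : R) : 0 <= e / (e ^+ 2 + x ^+ 2).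
  by rewrite divr_ge0 ?ltW// ltr_pwDl ?exprn_gt0 ?sqr_ge0.
have d1 : derive1 (fun x : R => y + x) = cst 1.
  by apply/funext => x; rewrite derive1E derive_val add0r mulr1.
have := @increasing_ge0_integration_by_substitutionT R (fun x => y + x)
  (fun x => e / (e ^+ 2 + x ^+ 2)).
rewrite d1 => h.
transitivity (\int[mu]_x (e / (e ^+ 2 + x ^+ 2))%:E)%E.
  rewrite h//.
  - by apply: eq_integral => x _; rewrite /= mulr1.
  - by move=> a b; rewrite ltrD2l.
  - exact: cst_continuous.
  - exact: is_cvg_cst.
  - exact: is_cvg_cst.
  - apply/cvgrNyPle => A; near=> x; rewrite -lerBrDl; near: x.
    by apply: nbhs_ninfty_le; rewrite num_real.
  - apply/cvgryPge => A; near=> x; rewrite -lerBlDl; near: x.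
    by apply: nbhs_pinfty_ge; rewrite num_real.
rewrite ge0_symfun_integralT//; last by move=> x /=; rewrite sqrrN.
rewrite -set_itvcy integral_cauchy_halfline// -EFinM; congr EFin; lra.
Unshelve. all: by end_near. Qed.

End kernels.

(** * Fourier integrals over the half-line *)

Section fourier.
Context {R : realType}.
Notation mu := (@lebesgue_measure R).
Notation D := (`[0%R, +oo[%classic : set R).

(** [1 / pi] times the real part of the integral of
[(al l + i be l) exp (i l x)] over [l >= 0]. *)
Definition fourier (al be : R -> R) (x : R) : R :=
  pi^-1 * \int[mu]_(l in `[0%R, +oo[) (al l * cos (l * x) - be l * sin (l * x)).

Lemma measurable_fun_cosM (x : R) (E : set R) : measurable_fun E (fun l => cos (l * x)).
Proof.
apply: measurable_funTS; apply: continuous_measurable_fun => l.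
by apply: differentiable_continuous; apply/derivable1_diffP; apply: ex_derive.
Qed.

Lemma measurable_fun_sinM (x : R) (E : set R) : measurable_fun E (fun l => sin (l * x)).
Proof.
apply: measurable_funTS; apply: continuous_measurable_fun => l.
by apply: differentiable_continuous; apply/derivable1_diffP; apply: ex_derive.
Qed.

Lemma norm_cos_le1 (x : R) : `|cos x| <= 1.
Proof. by rewrite ler_norml cos_geN1 cos_le1. Qed.

Lemma norm_sin_le1 (x : R) : `|sin x| <= 1.
Proof. by rewrite ler_norml sin_geN1 sin_le1. Qed.

Lemma norm_fourier_integrand_le (u v x : R) :
  `|u * cos x - v * sin x| <= `|u| + `|v|.
Proof.
apply: (le_trans (ler_normB _ _)); rewrite !normrM.
by apply: lerD; rewrite ler_piMr// ?norm_cos_le1 ?norm_sin_le1.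
Qed.

Section integrable_symbol.
Variables al be : R -> R.
Hypothesis ial : mu.-integrable D (EFin \o al).
Hypothesis ibe : mu.-integrable D (EFin \o be).

Let mal : measurable_fun D al.
Proof. by apply/measurable_EFinP; exact: (measurable_int mu ial). Qed.

Let mbe : measurable_fun D be.
Proof. by apply/measurable_EFinP; exact: (measurable_int mu ibe). Qed.

Lemma integrable_norm_symbol :
  mu.-integrable D (EFin \o (fun l => `|al l| + `|be l|)).
Proof.
apply: (@integrableD _ _ _ mu D _ (EFin \o (Num.norm \o al)) (EFin \o (Num.norm \o be))) => //.
- exact: integrable_norm.
- exact: integrable_norm.
Qed.

Lemma measurable_fourier_integrand x :
  measurable_fun D (fun l => al l * cos (l * x) - be l * sin (l * x)).
Proof.
apply: measurable_funB; apply: measurable_funM => //.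
- exact: measurable_fun_cosM.
- exact: measurable_fun_sinM.
Qed.

Lemma integrable_fourier_integrand x :
  mu.-integrable D (EFin \o (fun l => al l * cos (l * x) - be l * sin (l * x))).
Proof.
have := @integrable_scale_le R _ _ mu D _ _ 1 _ (measurable_fourier_integrand x) integrable_norm_symbol.
move=> h; apply: h => //. 
move=> l _; rewrite mul1r (le_trans (norm_fourier_integrand_le _ _ _))//.
exact: ler_norm.
Qed.

Lemma norm_fourier_le x :
  `|fourier al be x| <= pi^-1 * \int[mu]_(l in D) (`|al l| + `|be l|).
Proof.
have pi0 : 0 < pi^-1 :> R by rewrite invr_gt0 pi_gt0.
rewrite /fourier normrM (gtr0_norm pi0) ler_wpM2l ?(ltW pi0)//.
apply: (le_trans (le_normr_Rintegral _ (integrable_fourier_integrand x))) => //.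
apply: le_Rintegral => //.
- exact: (integrable_norm (integrable_fourier_integrand x)).
- exact: integrable_norm_symbol.
- by move=> l _; exact: norm_fourier_integrand_le.
Qed.

Lemma continuous_fourier : continuous (fourier al be).
Proof.
move=> x; apply: cvgM; first exact: cvg_cst.
have := @continuity_under_integral R _ _ mu
  (fun x l => al l * cos (l * x) - be l * sin (l * x)) D (measurable_itv _)
  (x - 1) (x + 1) (fun y _ => integrable_fourier_integrand y) _
  (fun l => `|al l| + `|be l|) integrable_norm_symbol.
have xI : x \in (`]x - 1, x + 1[%classic : set R).
  by rewrite inE/= in_itv/=; apply/andP; split; lra.
apply => //.
- apply: aeW => l _ y _; apply: differentiable_continuous.
  by apply/derivable1_diffP; apply: ex_derive.
- by move=> y _; apply: aeW => l _; exact: norm_fourier_integrand_le.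
Qed.

End integrable_symbol.

Lemma fourierB al be al' be' x :
  mu.-integrable D (EFin \o al) -> mu.-integrable D (EFin \o be) ->
  mu.-integrable D (EFin \o al') -> mu.-integrable D (EFin \o be') ->
  fourier al be x - fourier al' be' x =
  fourier (fun l => al l - al' l) (fun l => be l - be' l) x.
Proof.
move=> ia ib ia' ib'; rewrite /fourier -mulrBr; congr (_ * _).
rewrite -RintegralB//.
- by apply: eq_Rintegral => l _; ring.
- exact: (integrable_fourier_integrand ia ib x).
- exact: (integrable_fourier_integrand ia' ib' x).
Qed.

Lemma fourierZ k al be x :
  mu.-integrable D (EFin \o al) -> mu.-integrable D (EFin \o be) ->
  fourier (fun l => k * al l) (fun l => k * be l) x = k * fourier al be x.
Proof.
move=> ia ib; rewrite /fourier mulrCA; congr (_ * _).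
rewrite -RintegralZl//; last exact: (integrable_fourier_integrand ia ib x).
by apply: eq_Rintegral => l _; ring.
Qed.

(** The Abel factor [exp (- e l)] is the symbol of the Cauchy kernel of width
[e]. *)
Lemma fourier_abel (e x : R) : 0 < e ->
  fourier (fun l => expR (- (e * l))) (cst 0) x = pi^-1 * (e / (e ^+ 2 + x ^+ 2)).
Proof.
move=> e0; rewrite /fourier -Rintegral_expRN_cos//; congr (_ * _).
by apply: eq_Rintegral => l _; rewrite mul0r subr0.
Qed.

(** Averaging translates against [rho] multiplies the symbol [al + i be] by
[C + i S], the characteristic function of [rho]. *)
Lemma Rintegral_fourier_shift (al be rho : R -> R) (x : R) :
  mu.-integrable D (EFin \o al) -> mu.-integrable D (EFin \o be) ->
  mu.-integrable setT (EFin \o rho) ->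
  let C l := \int[mu]_z (rho z * cos (l * z)) in
  let S l := \int[mu]_z (rho z * sin (l * z)) in
  \int[mu]_z (rho z * fourier al be (x + z)) =
  fourier (fun l => al l * C l - be l * S l) (fun l => al l * S l + be l * C l) x.
Proof.
move=> ia ib ir C S.
have mr : measurable_fun setT rho by apply/measurable_EFinP; exact: (measurable_int mu ir).
pose al' := al \_ D; pose be' := be \_ D.
have ial' : mu.-integrable setT (EFin \o al').
  by rewrite -restrict_EFin; apply/(integrable_mkcond _ _).1.
have ibe' : mu.-integrable setT (EFin \o be').
  by rewrite -restrict_EFin; apply/(integrable_mkcond _ _).1.
have mal' : measurable_fun setT al' by apply/measurable_EFinP; exact: (measurable_int mu ial').
have mbe' : measurable_fun setT be' by apply/measurable_EFinP; exact: (measurable_int mu ibe').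
have mcos : measurable_fun setT (@cos R) by apply: continuous_measurable_fun; exact: continuous_cos.
have msin : measurable_fun setT (@sin R) by apply: continuous_measurable_fun; exact: continuous_sin.
have iC l : mu.-integrable setT (EFin \o (fun z => rho z * cos (l * z))).
  apply: (integrable_scale_le _ _ ir (c := 1)) => //.
    by apply: measurable_funM => //; apply: measurableT_comp.
  by move=> z _; rewrite mul1r normrM ler_piMr// norm_cos_le1.
have iS l : mu.-integrable setT (EFin \o (fun z => rho z * sin (l * z))).
  apply: (integrable_scale_le _ _ ir (c := 1)) => //.
    by apply: measurable_funM => //; apply: measurableT_comp.
  by move=> z _; rewrite mul1r normrM ler_piMr// norm_sin_le1.
pose f (w : measurableTypeR R * measurableTypeR R) : R := rho w.1 * (al' w.2 * cos (w.2 * (x + w.1)) - be' w.2 * sin (w.2 * (x + w.1))).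
have mf : measurable_fun setT f.
  have marg : measurable_fun setT
      (fun w : measurableTypeR R * measurableTypeR R => (w.2 : R) * (x + w.1)).
    by apply: measurable_funM => //; apply: measurable_funD.
  apply: measurable_funM; first exact: (measurableT_comp mr measurable_fst).
  apply: measurable_funB; apply: measurable_funM.
  - exact: (measurableT_comp mal' measurable_snd).
  - exact: measurableT_comp.
  - exact: (measurableT_comp mbe' measurable_snd).
  - exact: measurableT_comp.
have ig1 : mu.-integrable setT (EFin \o (fun z => `|rho z|)) by exact: (integrable_norm ir).
have ig2 : mu.-integrable setT (EFin \o (fun l => `|al' l| + `|be' l|)).
  apply: (@integrableD _ _ _ mu setT _ (EFin \o (Num.norm \o al')) (EFin \o (Num.norm \o be'))) => //;
  exact: integrable_norm.
have fg z l : `|f (z, l)| <= `|rho z| * (`|al' l| + `|be' l|).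
  by rewrite /f normrM /= ler_wpM2l// norm_fourier_integrand_le.
have h := Rintegral_fubini mf ig1 ig2 fg.
transitivity (pi^-1 * \int[mu]_z \int[mu]_l f (z, l)).
  rewrite -RintegralZl//; last exact: (integrable_Rintegral1 mf ig1 ig2 fg).
  apply: eq_Rintegral => z _; rewrite /fourier mulrCA; congr (_ * _).
  rewrite -RintegralZl//; last exact: integrable_fourier_integrand.
  rewrite Rintegral_mkcond; apply: eq_Rintegral => l _.
  rewrite /f /= /al' /be' !patchE; case: ifPn => // _.
  by rewrite !mul0r subr0 mulr0.
rewrite h /fourier; congr (_ * _); rewrite [RHS]Rintegral_mkcond.
apply: eq_Rintegral => l _.
transitivity ((al' l * C l - be' l * S l) * cos (l * x) - (al' l * S l + be' l * C l) * sin (l * x)).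
  transitivity (\int[mu]_z ((al' l * cos (l * x) - be' l * sin (l * x)) * (rho z * cos (l * z))
     - (al' l * sin (l * x) + be' l * cos (l * x)) * (rho z * sin (l * z)))).
    apply: eq_Rintegral => z _; rewrite /f /= (mulrDr l x z) cosD sinD; ring.
  rewrite RintegralB//; last 2 first.
  - exact: (integrable_mull _ _ (iC l)).
  - exact: (integrable_mull _ _ (iS l)).
  by rewrite !RintegralZl// -/(C l) -/(S l); ring.
rewrite /al' /be' !patchE; case: ifPn => // _.
by rewrite !mul0r subr0 addr0 !mul0r subr0.
Qed.

(** After the substitution [z = - x + e s] the kernel no longer depends on [e],
and dominated convergence applies. *)
Lemma cauchy_kernel_approximation (rho : R -> R) (M x : R) :
  continuous rho -> (forall z, 0 <= rho z <= M) ->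
  \int[mu]_z (rho z * (pi^-1 * (e / (e ^+ 2 + (x + z) ^+ 2)))) @[e --> 0^'+] --> rho (- x).
Proof.
move=> crho rM.
have pi0 : 0 < pi :> R := pi_gt0 R.
have kern1 (s : R) : 0 < 1 + s ^+ 2 by rewrite ltr_pwDl ?sqr_ge0.
have kern0 (s : R) : 0 <= (1 + s ^+ 2)^-1 by rewrite invr_ge0 ltW.
have ckern : continuous (fun s : R => (1 + s ^+ 2)^-1).
  move=> s; apply: cvgV; first by rewrite gt_eqF.
  by apply: cvgD; [exact: cvg_cst|apply: exprn_continuous].
have hk : (\int[mu]_s ((1 + s ^+ 2)^-1)%:E = pi%:E)%E.
  rewrite -(@integral_cauchy_line R 1 0 ltr01).
  by apply: eq_integral => s _; rewrite add0r expr1n mul1r.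
have ikern : mu.-integrable [set: R] (EFin \o (fun s : R => (1 + s ^+ 2)^-1)).
  apply/integrableP; split.
    by apply/measurable_EFinP; apply: continuous_measurable_fun.
  under eq_integral do rewrite /= ger0_norm//.
  by rewrite hk ltry.
have vkern : \int[mu]_s (1 + s ^+ 2)^-1 = pi by rewrite /Rintegral hk.
have sub e : 0 < e -> \int[mu]_z (rho z * (pi^-1 * (e / (e ^+ 2 + (x + z) ^+ 2)))) =
    \int[mu]_s (pi^-1 * (rho (- x + e * s) * (1 + s ^+ 2)^-1)).
  move=> e0; congr fine.
  have N0 (s : R) : 0 < e ^+ 2 + s ^+ 2 by rewrite ltr_pwDl ?exprn_gt0 ?sqr_ge0.
  have d1 : derive1 (fun s : R => - x + e * s) = cst e.
    by apply/funext => s; rewrite derive1E derive_val /= /GRing.scale/=; ring.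
  rewrite (@increasing_ge0_integration_by_substitutionT R (fun s => - x + e * s)
    (fun z => rho z * (pi^-1 * (e / (e ^+ 2 + (x + z) ^+ 2))))) ?d1//.
  - apply: eq_integral => s _; congr EFin.
    change (rho (- x + e * s) * (pi^-1 * (e / (e ^+ 2 + (x + (- x + e * s)) ^+ 2))) * e =
      pi^-1 * (rho (- x + e * s) * (1 + s ^+ 2)^-1)).
    rewrite addrA subrr add0r; move: (pi^-1) => ip; field.
    by rewrite !gt_eqF.
  - by move=> s t st; rewrite ltrD2l ltr_pM2l.
  - exact: cst_continuous.
  - exact: is_cvg_cst.
  - exact: is_cvg_cst.
  - apply/cvgrNyPle => A; near=> s; rewrite -lerBrDl mulrC -ler_pdivlMr//; near: s.
  - apply/cvgryPge => A; near=> s; rewrite -lerBlDl mulrC -ler_pdivrMr//; near: s.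
  - move=> z; apply: cvgM; first exact: crho.
    apply: cvgM; first exact: cvg_cst.
    apply: cvgM; first exact: cvg_cst.
    apply: cvgV; first by rewrite gt_eqF.
    apply: cvgD; first exact: cvg_cst.
    by apply: (cvg_comp (fun z => x + z) (fun z => z ^+ 2)); [apply: cvgD; [exact: cvg_cst|exact: cvg_id]|apply: exprn_continuous].
  - move=> z; have /andP[rz _] := rM z.
    by apply: mulr_ge0 => //; apply: mulr_ge0; [rewrite invr_ge0 ltW|rewrite divr_ge0// ltW].
have mrho (e : R) : measurable_fun [set: R] (fun s => rho (- x + e * s)).
  apply: continuous_measurable_fun => s.
  apply: (cvg_comp (fun s => - x + e * s) rho); last exact: crho.
  by apply: cvgD; [exact: cvg_cst|apply: cvgM; [exact: cvg_cst|exact: cvg_id]].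
have -> : rho (- x) = \int[mu]_s (pi^-1 * (rho (- x) * (1 + s ^+ 2)^-1)).
  rewrite RintegralZl//; last exact: integrable_mull.
  by rewrite RintegralZl// vkern mulrCA mulVf ?mulr1// gt_eqF.
have h := @Rintegral_dominated_cvg_at_right R _ _ mu [set: R]
  (fun e s => pi^-1 * (rho (- x + e * s) * (1 + s ^+ 2)^-1))
  (fun s => pi^-1 * (rho (- x) * (1 + s ^+ 2)^-1))
  (fun s => pi^-1 * (M * (1 + s ^+ 2)^-1)) measurableT.
apply: cvg_trans (proj2 (h _ _ _ _)).
- apply: near_eq_cvg; near=> e; rewrite -sub//; near: e; exact: nbhs_right_gt.
- move=> e _. do 2 apply: measurable_funM => //.
    exact: mrho.
  exact: continuous_measurable_fun.
- move=> s _; apply: cvgM; first exact: cvg_cst.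
  apply: cvgM; last exact: cvg_cst.
  apply: cvg_at_right_filter.
  rewrite -[X in _ --> rho X]addr0 -[X in _ --> rho (- x + X)](mul0r s).
  apply: (cvg_comp (fun e => - x + e * s) rho); last exact: crho.
  by apply: cvgD; [exact: cvg_cst|apply: cvgM; [exact: cvg_id|exact: cvg_cst]].
- by apply: integrable_mull => //; exact: integrable_mull.
- move=> e s _ _; have /andP[r0 rm] := rM (- x + e * s).
  rewrite ger0_norm; last by apply: mulr_ge0; [rewrite invr_ge0 ltW|exact: mulr_ge0].
  by apply: ler_wpM2l; [rewrite invr_ge0 ltW|exact: ler_wpM2r].
Unshelve. all: by end_near. Qed.

End fourier.

(** * Fourier inversion for resolvent families *)

Section resolvent.
Context {R : realType}.
Notation mu := (@lebesgue_measure R).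
Notation D := (`[0%R, +oo[%classic : set R).
Implicit Types (a b : R -> R) (p q l x y z : R).

(** For [F = 1 / (q + a + i b)], the next four are [1 / |F|^2], [Re F], [Im F]
and [|F|].  At [q = 0] they describe [1 / psi], with the convention that the
inverse of 0 is 0. *)
Definition sqmod a b q l : R := (q + a l) ^+ 2 + b l ^+ 2.
Definition reF a b q l : R := (q + a l) / sqmod a b q l.
Definition imF a b q l : R := - b l / sqmod a b q l.
Definition absF a b q l : R := (Num.sqrt (sqmod a b q l))^-1.

(** What is used of the resolvent of a process: the [q]-th density has mass
[1 / q] and characteristic function [1 / (q + a + i b)], whose modulus is
integrable. *)
Record resolvent_family a b (rho : R -> R -> R) : Prop := {
  rf_measurable_re : measurable_fun [set: R] a ;
  rf_measurable_im : measurable_fun [set: R] b ;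
  rf_re_ge0 : forall l, 0 <= a l ;
  rf_ge0 : forall q z, 0 < q -> 0 <= rho q z ;
  rf_bounded : forall q, 0 < q -> exists M, forall z, rho q z <= M ;
  rf_continuous : forall q, 0 < q -> continuous (rho q) ;
  rf_integrable : forall q, 0 < q -> mu.-integrable [set: R] (EFin \o rho q) ;
  rf_mass : forall q, 0 < q -> \int[mu]_z rho q z = q^-1 ;
  rf_cos : forall q l, 0 < q -> \int[mu]_z (rho q z * cos (l * z)) = reF a b q l ;
  rf_sin : forall q l, 0 < q -> \int[mu]_z (rho q z * sin (l * z)) = imF a b q l ;
  rf_absF : forall q, 0 < q -> mu.-integrable D (EFin \o absF a b q) }.

Section theory.
Variables (a b : R -> R) (rho : R -> R -> R).
Hypothesis H : resolvent_family a b rho.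

Local Notation reF := (reF a b).
Local Notation imF := (imF a b).
Local Notation absF := (absF a b).
Local Notation sqmod := (sqmod a b).

Lemma sqmod_gt0 q l : 0 < q -> 0 < sqmod q l.
Proof.
move=> q0; rewrite /sqmod ltr_pwDl ?sqr_ge0// exprn_gt0//.
by rewrite ltr_pwDl// (rf_re_ge0 H).
Qed.

Lemma sqmod_ge q l : 0 < q -> q ^+ 2 <= sqmod q l.
Proof.
move=> q0; have := rf_re_ge0 H l; rewrite /sqmod; have := sqr_ge0 (b l); nra.
Qed.

Lemma absF_ge0 q l : 0 <= absF q l.
Proof. by rewrite invr_ge0 sqrtr_ge0. Qed.

Lemma sqr_absF q l : 0 < q -> absF q l ^+ 2 = (sqmod q l)^-1.
Proof. by move=> q0; rewrite exprVn sqr_sqrtr// ltW// sqmod_gt0. Qed.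

Lemma sqr_reF_imF q l : 0 < q -> reF q l ^+ 2 + imF q l ^+ 2 = absF q l ^+ 2.
Proof.
move=> q0; rewrite sqr_absF//; have := sqmod_gt0 l q0.
by rewrite /reF /imF /sqmod => N0; field; rewrite gt_eqF.
Qed.

Lemma norm_reF_le q l : 0 < q -> `|reF q l| <= absF q l.
Proof.
move=> q0; rewrite -ler_sqr ?nnegrE ?absF_ge0// real_normK ?num_real//.
by rewrite -sqr_reF_imF// lerDl sqr_ge0.
Qed.

Lemma norm_imF_le q l : 0 < q -> `|imF q l| <= absF q l.
Proof.
move=> q0; rewrite -ler_sqr ?nnegrE ?absF_ge0// real_normK ?num_real//.
by rewrite -sqr_reF_imF// lerDr sqr_ge0.
Qed.

(** Real part of the resolvent equation [(p - q) F q F p = F q - F p] for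
[F q = 1 / (q + psi)]. *)
Lemma resolvent_reF p q l : 0 < p -> 0 < q ->
  (p - q) * (reF q l * reF p l - imF q l * imF p l) = reF q l - reF p l.
Proof.
move=> p0 q0; have := sqmod_gt0 l q0; have := sqmod_gt0 l p0.
by rewrite /reF /imF /sqmod => Np Nq; field; rewrite !gt_eqF.
Qed.

(** Imaginary part of the resolvent equation. *)
Lemma resolvent_imF p q l : 0 < p -> 0 < q ->
  (p - q) * (reF q l * imF p l + imF q l * reF p l) = imF q l - imF p l.
Proof.
move=> p0 q0; have := sqmod_gt0 l q0; have := sqmod_gt0 l p0.
by rewrite /reF /imF /sqmod => Np Nq; field; rewrite !gt_eqF.
Qed.

Lemma measurable_sqmod q : measurable_fun [set: R] (sqmod q).
Proof.
apply: measurable_funD; apply: measurable_funX.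
  by apply: measurable_funD => //; exact: rf_measurable_re H.
exact: rf_measurable_im H.
Qed.

Lemma measurable_reF q : 0 < q -> measurable_fun [set: R] (reF q).
Proof.
move=> q0; apply: measurable_funM; last first.
  by apply: measurable_inv; [exact: measurable_sqmod|move=> l; exact: sqmod_gt0].
by apply: measurable_funD => //; exact: rf_measurable_re H.
Qed.

Lemma measurable_imF q : 0 < q -> measurable_fun [set: R] (imF q).
Proof.
move=> q0; apply: measurable_funM; last first.
  by apply: measurable_inv; [exact: measurable_sqmod|move=> l; exact: sqmod_gt0].
apply: measurableT_comp => //; exact: rf_measurable_im H.
Qed.

Lemma integrable_reF q : 0 < q -> mu.-integrable D (EFin \o reF q).
Proof.
move=> q0; apply: (@integrable_scale_le R _ _ mu D _ (absF q) 1) => //.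
- apply: measurable_funTS; exact: measurable_reF.
- exact: (rf_absF H).
- by move=> l _; rewrite mul1r (le_trans (norm_reF_le l q0))// ler_norm.
Qed.

Lemma integrable_imF q : 0 < q -> mu.-integrable D (EFin \o imF q).
Proof.
move=> q0; apply: (@integrable_scale_le R _ _ mu D _ (absF q) 1) => //.
- apply: measurable_funTS; exact: measurable_imF.
- exact: (rf_absF H).
- by move=> l _; rewrite mul1r (le_trans (norm_imF_le l q0))// ler_norm.
Qed.

Lemma measurable_damp (e : R) : measurable_fun [set: R] (fun l => expR (- (e * l))).
Proof.
apply: continuous_measurable_fun => t.
by apply: differentiable_continuous; apply/derivable1_diffP; apply: ex_derive.
Qed.

Lemma damp_le1 (e l : R) : 0 <= e -> D l -> expR (- (e * l)) <= 1.
Proof.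
move=> e0; rewrite /= in_itv/= andbT => l0.
by rewrite expR_le1 oppr_le0 mulr_ge0.
Qed.

Lemma integrable_damp (e : R) (f : R -> R) : 0 <= e ->
  mu.-integrable D (EFin \o f) ->
  mu.-integrable D (EFin \o (fun l => expR (- (e * l)) * f l)).
Proof.
move=> e0 intf; apply: (@integrable_scale_le R _ _ mu D _ f 1) => //.
- apply: measurable_funM; first by apply: measurable_funTS; exact: measurable_damp.
  by apply/measurable_EFinP; exact: (measurable_int mu intf).
- move=> l Dl; rewrite mul1r normrM ger0_norm ?expR_ge0//.
  by rewrite ler_piMl// damp_le1.
Qed.

(** The inversion integral with an Abel factor [exp (- e l)].  By [dampedE] it is
the mean of [rho q] under a Cauchy kernel of width [e], which shows that it is
nonnegative. *)
Definition damped q e x : R :=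
  fourier (fun l => expR (- (e * l)) * reF q l) (fun l => expR (- (e * l)) * imF q l) x.

Lemma dampedE q e x : 0 < q -> 0 < e ->
  \int[mu]_z (rho q z * (pi^-1 * (e / (e ^+ 2 + (x + z) ^+ 2)))) = damped q e x.
Proof.
move=> q0 e0.
have i0 : mu.-integrable D (EFin \o (cst 0 : R -> R)) by exact: integrable0.
have := Rintegral_fourier_shift x (integrable_expRN e0) i0 (rf_integrable H q0).
under eq_Rintegral do rewrite fourier_abel//.
move=> ->; rewrite /damped /fourier; congr (_ * _); apply: eq_Rintegral => l _.
by rewrite (rf_cos H)// (rf_sin H)// !mul0r subr0 addr0.
Qed.

Lemma damped_ge0 q e x : 0 < q -> 0 < e -> 0 <= damped q e x.
Proof.
move=> q0 e0; rewrite -dampedE//; apply: Rintegral_ge0 => z _.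
apply: mulr_ge0; first exact: (rf_ge0 H).
rewrite mulr_ge0 ?invr_ge0 ?pi_ge0// divr_ge0 ?(ltW e0)//.
by rewrite addr_ge0 ?sqr_ge0.
Qed.

(** Integrating the modulus of the difference of symbols bounds the effect of
the damping uniformly in space. *)
Definition damping_error q e : R := pi^-1 *
  \int[mu]_(l in `[0%R, +oo[) (`|expR (- (e * l)) * reF q l - reF q l| +
     `|expR (- (e * l)) * imF q l - imF q l|).

Lemma damped_error q e x : 0 < q -> 0 < e ->
  `|damped q e x - fourier (reF q) (imF q) x| <= damping_error q e.
Proof.
move=> q0 e0.
have iR := integrable_reF q0; have iI := integrable_imF q0.
have jR := integrable_damp (ltW e0) iR; have jI := integrable_damp (ltW e0) iI.
rewrite /damped fourierB//.
by apply: norm_fourier_le; exact: integrableB_EFin.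
Qed.

Lemma damping_error_cvg0 q : 0 < q -> damping_error q e @[e --> 0^'+] --> 0.
Proof.
move=> q0.
have h := @Rintegral_dominated_cvg_at_right R _ _ mu D
  (fun e l => `|expR (- (e * l)) * reF q l - reF q l| +
     `|expR (- (e * l)) * imF q l - imF q l|) (cst 0)
  (fun l => 2 * absF q l) (measurable_itv _).
rewrite -[X in _ --> X](mulr0 pi^-1); apply: cvgM; first exact: cvg_cst.
rewrite [X in _ --> X](_ : 0 = \int[mu]_(l in D) (cst 0 l : R)); last by rewrite Rintegral_cst// mul0r.
apply: (proj2 (h _ _ _ _)).
- move=> e _; apply: measurable_funTS; apply: measurable_funD;
  apply: measurableT_comp => //; apply: measurable_funB.
  + by apply: measurable_funM; [exact: measurable_damp|exact: measurable_reF].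
  + exact: measurable_reF.
  + by apply: measurable_funM; [exact: measurable_damp|exact: measurable_imF].
  + exact: measurable_imF.
- move=> l _.
  have hc (k : R) : `|expR (- (e * l)) * k - k| @[e --> 0^'+] --> 0.
    apply/norm_cvg0P; rewrite -[X in _ --> X](subrr k).
    apply: cvgB; last exact: cvg_cst.
    rewrite -[X in _ --> X]mul1r; apply: cvgM; last exact: cvg_cst.
    apply: cvg_at_right_filter.
    have : {for 0, continuous (fun e : R => expR (- (e * l)))}.
      by apply: differentiable_continuous; apply/derivable1_diffP; apply: ex_derive.
    by rewrite /prop_for /continuous_at mul0r oppr0 expR0.
  by rewrite -[X in _ --> X](addr0 0); apply: cvgD; exact: hc.
- by apply: integrable_mull => //; exact: (rf_absF H).
- move=> e l e0 Dl; rewrite ger0_norm; last exact: addr_ge0.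
  have hb (k : R) : `|k| <= absF q l -> `|expR (- (e * l)) * k - k| <= absF q l.
    move=> kF; have -> : expR (- (e * l)) * k - k = - ((1 - expR (- (e * l))) * k) by ring.
    rewrite normrN normrM ger0_norm; last first.
      by rewrite subr_ge0 damp_le1// ltW.
    by apply: le_trans kF; rewrite ler_piMl// gerBl expR_ge0.
  by rewrite mulr2n mulrDl !mul1r; apply: lerD; apply: hb; [exact: norm_reF_le|exact: norm_imF_le].
Qed.

(** The damped integral tends to [rho q (- x)], as a mean under a narrow Cauchy
kernel, and to the undamped integral, as [1 / (q + psi)] is integrable. *)
Theorem resolvent_density_fourier q x : 0 < q ->
  rho q (- x) = fourier (reF q) (imF q) x.
Proof.
move=> q0; have [M rM] := rf_bounded H q0.
have h1 : damped q e x @[e --> 0^'+] --> rho q (- x).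
  have := @cauchy_kernel_approximation R (rho q) M x (rf_continuous H q0).
  have rM' z : 0 <= rho q z <= M by rewrite (rf_ge0 H)// rM.
  move=> /(_ rM'); apply: cvg_trans; apply: near_eq_cvg.
  by near=> e; rewrite dampedE.
have h2 : damped q e x @[e --> 0^'+] --> fourier (reF q) (imF q) x.
  apply/cvgrPdist_le => d d0.
  have := damping_error_cvg0 q0 => /cvgr0Pnorm_le/(_ _ d0) hd.
  near=> e; rewrite distrC (le_trans (damped_error x q0 _))//.
  by rewrite (le_trans (ler_norm _))//; near: e.
exact: (cvg_unique _ h1 h2).
Unshelve. all: by end_near. Qed.

End theory.
End resolvent.

(** * The resolvent equation and the maximum principle *)

Section damped_resolvents.
Context {R : realType}.
Notation mu := (@lebesgue_measure R).
Notation D := (`[0%R, +oo[%classic : set R).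
Variables (a b : R -> R) (rho : R -> R -> R).
Hypothesis H : resolvent_family a b rho.

Local Notation reF := (reF a b).
Local Notation imF := (imF a b).
Local Notation absF := (absF a b).
Local Notation sqmod := (sqmod a b).
Local Notation damped := (damped a b).
Local Notation damping_error := (damping_error a b).

(** The resolvent equation in space: the [q]-potential of a narrow Cauchy law is
its [p]-potential plus [p - q] times the [p]-resolvent of the [q]-potential. *)
Lemma damped_resolvent (p q e x : R) : 0 < p -> 0 < q -> 0 < e ->
  damped q e x = (p - q) * \int[mu]_z (rho p z * damped q e (x + z)) + damped p e x.
Proof.
move=> p0 q0 e0.
have iq := integrable_damp (ltW e0) (integrable_reF H q0).
have jq := integrable_damp (ltW e0) (integrable_imF H q0).
have ip := integrable_damp (ltW e0) (integrable_reF H p0).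
have jp := integrable_damp (ltW e0) (integrable_imF H p0).
have [->|pq] := eqVneq p q; first by rewrite subrr mul0r add0r.
have pq0 : p - q != 0 by rewrite subr_eq0.
have := Rintegral_fourier_shift x iq jq (rf_integrable H p0).
rewrite -/(damped q e _) => /= ->.
rewrite [fourier _ _ x](_ : _ = fourier
    (fun l => (p - q)^-1 * (expR (- (e * l)) * reF q l - expR (- (e * l)) * reF p l))
    (fun l => (p - q)^-1 * (expR (- (e * l)) * imF q l - expR (- (e * l)) * imF p l)) x).
  rewrite fourierZ; [|exact: integrableB_EFin|exact: integrableB_EFin].
  by rewrite -fourierB// mulVKf// subrK.
rewrite /fourier; congr (_ * _); apply: eq_Rintegral => l _.
rewrite (rf_cos H)// (rf_sin H)//; set E := expR _.
have -> : E * reF q l - E * reF p l =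
    E * ((p - q) * (reF q l * reF p l - imF q l * imF p l)).
  by rewrite (resolvent_reF H)//; ring.
have -> : E * imF q l - E * imF p l =
    E * ((p - q) * (reF q l * imF p l + imF q l * reF p l)).
  by rewrite (resolvent_imF H)//; ring.
by field.
Qed.

(** As [p] grows, [p] times the [p]-resolvent of a Cauchy law returns that law;
this is a bound, uniform in space, of the distance between the two. *)
Definition approx_error (p e : R) : R := pi^-1 *
  \int[mu]_(l in `[0%R, +oo[) (`|p * (expR (- (e * l)) * reF p l) - expR (- (e * l))| +
     `|p * (expR (- (e * l)) * imF p l)|).

Lemma damped_approx_error (p e x : R) : 0 < p -> 0 < e ->
  p * damped p e x <= pi^-1 * (e / (e ^+ 2 + x ^+ 2)) + approx_error p e.
Proof.
move=> p0 e0.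
have ip := integrable_damp (ltW e0) (integrable_reF H p0).
have jp := integrable_damp (ltW e0) (integrable_imF H p0).
have i0 : mu.-integrable D (EFin \o (cst 0 : R -> R)) by exact: integrable0.
have ie := integrable_expRN e0.
rewrite -lerBlDl -fourier_abel// -fourierZ// fourierB//; last 2 first.
- exact: integrable_mull.
- exact: integrable_mull.
apply: (le_trans (ler_norm _)).
apply: (le_trans (norm_fourier_le _ _ _)).
- apply: integrableB_EFin => //; exact: integrable_mull.
- apply: integrableB_EFin => //; exact: integrable_mull.
rewrite /approx_error ler_wpM2l ?invr_ge0 ?pi_ge0//.
by under eq_Rintegral do rewrite subr0.
Qed.

(** Both bounds come from [p F - 1 = - (a + i b) F] and [|F| <= 1 / p] for
[F = 1 / (p + a + i b)]. *)
Lemma norm_scaled_transform_le (p l : R) : 0 < p ->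
  `|p * reF p l - 1| <= (a l + `|b l|) / p /\ `|p * imF p l| <= (a l + `|b l|) / p.
Proof.
move=> p0; have al := rf_re_ge0 H l.
have N0 := sqmod_gt0 H l p0; have Np := sqmod_ge H l p0.
have K0 : 0 <= (a l + `|b l|) / p by rewrite divr_ge0 ?addr_ge0// ltW.
have key : (p * reF p l - 1) ^+ 2 + (p * imF p l) ^+ 2 <= ((a l + `|b l|) / p) ^+ 2.
  have -> : (p * reF p l - 1) ^+ 2 + (p * imF p l) ^+ 2 = (a l ^+ 2 + b l ^+ 2) / sqmod p l.
    rewrite /reF /imF /sqmod.
    by move: N0; rewrite /sqmod => N0; field; rewrite gt_eqF.
  rewrite expr_div_n; apply: ler_pM.
  - by rewrite addr_ge0 ?sqr_ge0.
  - by rewrite invr_ge0 ltW.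
  - rewrite -(real_normK (num_real (b l))); have := normr_ge0 (b l); nra.
  - by rewrite lef_pV2 ?posrE// exprn_gt0.
split; rewrite -ler_sqr ?nnegrE// real_normK ?num_real// (le_trans _ key)//.
  by rewrite lerDl sqr_ge0.
by rewrite lerDr sqr_ge0.
Qed.

(** At each frequency the error is of order [1 / p], and [p |F| <= 1] dominates
it by a multiple of the Abel factor. *)
Lemma approx_error_cvg0 (e : R) : 0 < e -> approx_error n.+1%:R e @[n --> \oo] --> 0.
Proof.
move=> e0.
have h := @Rintegral_dominated_cvg R _ _ mu D
  (fun n l => `|n.+1%:R * (expR (- (e * l)) * reF n.+1%:R l) - expR (- (e * l))| +
     `|n.+1%:R * (expR (- (e * l)) * imF n.+1%:R l)|) (cst 0)
  (fun l => 3 * expR (- (e * l))) (measurable_itv _).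
rewrite -[X in _ --> X](mulr0 pi^-1); apply: cvgM; first exact: cvg_cst.
rewrite [X in _ --> X](_ : 0 = \int[mu]_(l in D) (cst 0 l : R)); last by rewrite Rintegral_cst// mul0r.
have fact (n : nat) (l : R) :
  `|n.+1%:R * (expR (- (e * l)) * reF n.+1%:R l) - expR (- (e * l))| +
     `|n.+1%:R * (expR (- (e * l)) * imF n.+1%:R l)| =
  expR (- (e * l)) * (`|n.+1%:R * reF n.+1%:R l - 1| + `|n.+1%:R * imF n.+1%:R l|).
  have -> : n.+1%:R * (expR (- (e * l)) * reF n.+1%:R l) - expR (- (e * l)) =
    expR (- (e * l)) * (n.+1%:R * reF n.+1%:R l - 1) by ring.
  have -> : n.+1%:R * (expR (- (e * l)) * imF n.+1%:R l) =
    expR (- (e * l)) * (n.+1%:R * imF n.+1%:R l) by ring.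
  by rewrite !normrM (ger0_norm (expR_ge0 _)) mulrDr.
apply: (proj2 (h _ _ _ _)).
- move=> n; apply: measurable_funTS; apply: measurable_funD;
  apply: measurableT_comp => //.
  + apply: measurable_funB; last exact: measurable_damp.
    apply: measurable_funM => //; apply: measurable_funM; first exact: measurable_damp.
    exact: (measurable_reF H).
  + apply: measurable_funM => //; apply: measurable_funM; first exact: measurable_damp.
    exact: (measurable_imF H).
- move=> l _.
  apply: (@squeeze_cvgr _ _ _ _ (cst 0) (fun n => expR (- (e * l)) * (2 * (a l + `|b l|) * n.+1%:R^-1))).
  + near=> n; rewrite addr_ge0//= fact ler_wpM2l ?expR_ge0//.
    have [h1 h2] := norm_scaled_transform_le l (ltr0Sn R n).
    by rewrite mulr2n 2!mulrDl !mul1r; exact: lerD.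
  + exact: cvg_cst.
  + rewrite -[X in _ --> X](mulr0 (expR (- (e * l)))); apply: cvgM; first exact: cvg_cst.
    rewrite -[X in _ --> X](mulr0 (2 * (a l + `|b l|))); apply: cvgM; first exact: cvg_cst.
    exact: cvg_harmonic.
- apply: integrable_mull => //; exact: integrable_expRN.
- move=> n l _; rewrite ger0_norm ?addr_ge0// fact mulrC ler_wpM2r ?expR_ge0//.
  have n0 : 0 < n.+1%:R :> R by [].
  have hF : n.+1%:R * absF n.+1%:R l <= 1.
    rewrite ler_pdivrMr ?mul1r ?sqrtr_gt0 ?(sqmod_gt0 H)//.
    rewrite -(ler_sqr) ?nnegrE ?sqrtr_ge0// sqr_sqrtr ?(ltW (sqmod_gt0 H _ _))//.
    exact: (sqmod_ge H).
  have h1 : `|n.+1%:R * reF n.+1%:R l| <= 1.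
    rewrite normrM (gtr0_norm n0) (le_trans _ hF)// ler_pM2l//; exact: (norm_reF_le H).
  have h2 : `|n.+1%:R * imF n.+1%:R l| <= 1.
    rewrite normrM (gtr0_norm n0) (le_trans _ hF)// ler_pM2l//; exact: (norm_imF_le H).
  have := ler_normB (n.+1%:R * reF n.+1%:R l) 1; rewrite normr1; lra.
Unshelve. all: by end_near. Qed.

End damped_resolvents.

Section maximum_principle_section.
Context {R : realType}.
Notation mu := (@lebesgue_measure R).
Notation D := (`[0%R, +oo[%classic : set R).
Variables (a b : R -> R) (rho : R -> R -> R).
Hypothesis H : resolvent_family a b rho.

Local Notation damped := (damped a b).
Local Notation damping_error := (damping_error a b).
Local Notation approx_error := (approx_error a b).

Lemma measurable_rho (p : R) : 0 < p -> measurable_fun [set: R] (rho p).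
Proof. by move=> p0; apply: continuous_measurable_fun; exact: (rf_continuous H). Qed.

Lemma damped_bounded (q e : R) : 0 < q -> 0 < e ->
  exists K, forall x, `|damped q e x| <= K.
Proof.
move=> q0 e0; eexists => x; apply: norm_fourier_le.
  exact: (integrable_damp (ltW e0) (integrable_reF H q0)).
exact: (integrable_damp (ltW e0) (integrable_imF H q0)).
Qed.

Lemma damped_near (q e x : R) : 0 < q -> 0 < e ->
  `|damped q e x - rho q (- x)| <= damping_error q e.
Proof.
by move=> q0 e0; rewrite (resolvent_density_fourier H)//; exact: (damped_error H).
Qed.

Lemma measurable_damped_shift (q e x : R) : 0 < q -> 0 < e ->
  measurable_fun [set: R] (fun z => damped q e (x + z)).
Proof.
move=> q0 e0; apply: continuous_measurable_fun => z.
apply: (cvg_comp (fun z => x + z) (damped q e)); last first.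
  apply: continuous_fourier.
    exact: (integrable_damp (ltW e0) (integrable_reF H q0)).
  exact: (integrable_damp (ltW e0) (integrable_imF H q0)).
by apply: cvgD; [exact: cvg_cst|exact: cvg_id].
Qed.

(** The [p]-resolvent is a positive operator of mass [1 / p], so it preserves
upper bounds. *)
Lemma potential_le (p q e c d M x : R) : 0 < p -> 0 < q -> 0 < e ->
  (forall y, c * damped q e y - d * damped q e (y + x) <= M) ->
  forall y, c * \int[mu]_z (rho p z * damped q e (y + z)) -
            d * \int[mu]_z (rho p z * damped q e (y + x + z)) <= M / p.
Proof.
move=> p0 q0 e0 uM y.
have [K hK] := damped_bounded q0 e0.
have ir y' : mu.-integrable [set: R] (EFin \o (fun z => rho p z * damped q e (y' + z))).
  apply: (@integrable_scale_le R _ _ mu [set: R] _ (rho p) K) => //.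
  - apply: measurable_funM; first exact: measurable_rho.
    exact: measurable_damped_shift.
  - exact: (rf_integrable H).
  - by move=> z _; rewrite normrM mulrC ler_wpM2r.
rewrite -RintegralZl// -RintegralZl// -RintegralB//; last 2 first.
- exact: integrable_mull.
- exact: integrable_mull.
rewrite -(rf_mass H p0) -RintegralZl//; last exact: (rf_integrable H).
apply: le_Rintegral => //.
- apply: integrableB_EFin => //.
    exact: (integrable_mull c measurableT (ir y)).
  exact: (integrable_mull d measurableT (ir (y + x))).
- exact: (integrable_mull M measurableT (rf_integrable H p0)).
- move=> z _.
  have -> : c * (rho p z * damped q e (y + z)) - d * (rho p z * damped q e (y + x + z)) =
    rho p z * (c * damped q e (y + z) - d * damped q e (y + z + x)).
    by rewrite (addrAC y x z); ring.
  by rewrite mulrC ler_wpM2r// (rf_ge0 H).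
Qed.

(** Let [u x] be the left-hand side and [p > q].  By the resolvent equation,
[p u <= (p - q) sup u + c p r_p (- x)], where the term of coefficient [d] is
dropped.  For large [p] the last summand concentrates at [x = 0]; away from [0]
it gives [p u <= (p - q) sup u + small], which keeps [u] away from a positive
supremum.  So a positive supremum is approached only near [0], where [u] is
close to [u 0].  The Cauchy regularization turns the concentration of
[p r_p] at [0], which holds for measures, into a pointwise estimate. *)
Theorem maximum_principle (q c d y : R) : 0 < q -> 0 <= c -> 0 <= d ->
  forall x, c * rho q (- x) - d * rho q (- (x + y)) <=
    Num.max (c * rho q 0 - d * rho q (- y)) 0.
Proof.
move=> q0 c0 d0 x1; rewrite leNgt; apply/negP.
pose u x := c * rho q (- x) - d * rho q (- (x + y)).
have u0E : c * rho q 0 - d * rho q (- y) = u 0 by rewrite /u oppr0 add0r.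
rewrite u0E -/(u x1) => lt1.
set m := Num.max (u 0) 0 in lt1.
pose k := u x1 - m.
have k0 : 0 < k by rewrite subr_gt0.
have m0 : 0 <= m by rewrite le_max lexx orbT.
have um : u 0 <= m by rewrite le_max lexx.
have cu : continuous u.
  have crho := rf_continuous H q0.
  move=> x; apply: cvgB; apply: cvgM; [exact: cvg_cst| |exact: cvg_cst| ].
    by apply: (cvg_comp (fun x => - x) (rho q)); [apply: cvgN; exact: cvg_id|exact: crho].
  apply: (cvg_comp (fun x => - (x + y)) (rho q)); last exact: crho.
  by apply: cvgN; apply: cvgD; [exact: cvg_id|exact: cvg_cst].
have [r r0 ur] : exists2 r : R, 0 < r & forall x, `|x| < r -> u x <= u 0 + k / 4.
  have k4 : 0 < k / 4 by lra.
  have /cvgrPdist_le/(_ _ k4)/nbhs_ballP[r /= r0 hr] := cu 0.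
  exists r => // x xr; have := hr x; rewrite /ball/= sub0r normrN => /(_ xr).
  by rewrite ler_norml => /andP[h _]; lra.
pose ue e x := c * damped q e x - d * damped q e (x + y).
have ueu e x : 0 < e -> `|ue e x - u x| <= (c + d) * damping_error q e.
  move=> e0.
  have -> : ue e x - u x = c * (damped q e x - rho q (- x)) -
     d * (damped q e (x + y) - rho q (- (x + y))) by rewrite /ue /u; ring.
  apply: (le_trans (ler_normB _ _)); rewrite !normrM (ger0_norm c0) (ger0_norm d0) mulrDl.
  by apply: lerD; apply: ler_wpM2l => //; exact: damped_near.
(* The width [e] makes [ue] uniformly close to [u], and the Cauchy kernel small
   outside the neighbourhood of radius [r] of 0. *)
have [e [e0 he1 he2]] : exists e, [/\ 0 < e, (c + d) * damping_error q e <= k / 8 &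
    c * (pi^-1 * (e / r ^+ 2)) <= q * k / 8].
  have k8 : 0 < k / 8 by lra.
  have qk8 : 0 < q * k / 8 by rewrite divr_gt0// mulr_gt0.
  have h1 : (c + d) * damping_error q e @[e --> 0^'+] --> 0.
    rewrite -[X in _ --> X](mulr0 (c + d)); apply: cvgM; first exact: cvg_cst.
    exact: (damping_error_cvg0 H).
  have h2 : c * (pi^-1 * (e / r ^+ 2)) @[e --> 0^'+] --> 0.
    rewrite -[X in _ --> X](mulr0 c); apply: cvgM; first exact: cvg_cst.
    rewrite -[X in _ --> X](mulr0 pi^-1); apply: cvgM; first exact: cvg_cst.
    rewrite -[X in _ --> X](mul0r (r ^+ 2)^-1); apply: cvgM; last exact: cvg_cst.
    by apply: cvg_at_right_filter; exact: cvg_id.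
  move/cvgr0Pnorm_le : h1 => /(_ _ k8) h1.
  move/cvgr0Pnorm_le : h2 => /(_ _ qk8) h2.
  near (0:R)^'+ => e; exists e; split => //.
  - by apply: (le_trans (ler_norm _)); near: e.
  - by apply: (le_trans (ler_norm _)); near: e.
have [K hK] := damped_bounded q0 e0.
have ub : has_ubound (range (ue e)).
  exists ((c + d) * K) => _ [x _ <-]; rewrite /ue.
  apply: (le_trans (ler_norm _)); apply: (le_trans (ler_normB _ _)).
  rewrite (normrM c) (normrM d) (ger0_norm c0) (ger0_norm d0) mulrDl.
  by apply: lerD; apply: ler_wpM2l => //; exact: hK.
pose M := sup (range (ue e)).
have hs : has_sup (range (ue e)) by split => //; exists (ue e 0); exists 0.
have leM x : ue e x <= M by apply: sup_upper_bound => //; exists x.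
(* The supremum of the regularized [ue] keeps most of the excess [k] of
   [u x1] over [max (u 0) 0]. *)
have h1M : u x1 - k / 8 <= M.
  apply: le_trans (leM x1); have := ueu e x1 e0.
  by rewrite ler_norml => /andP[+ _]; lra.
have kM : k / 2 <= M by rewrite /k in h1M *; lra.
have [n [np hn]] : exists n : nat, q < n.+1%:R /\ c * approx_error n.+1%:R e <= q * k / 8.
  have qk8 : 0 < q * k / 8 by rewrite divr_gt0// mulr_gt0.
  have h : c * approx_error n.+1%:R e @[n --> \oo] --> 0.
    rewrite -[X in _ --> X](mulr0 c); apply: cvgM; first exact: cvg_cst.
    exact: (approx_error_cvg0 H).
  move/cvgr0Pnorm_le : h => /(_ _ qk8) h.
  near \oo => n; exists n; split.
    rewrite -natr1 (@lt_le_trans _ _ n%:R) ?lerDl//; near: n.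
    exact: nbhs_infty_gtr.
  by apply: (le_trans (ler_norm _)); near: n.
set p : R := n.+1%:R in np hn.
have p0 : 0 < p by rewrite (lt_trans q0).
have key x : p * ue e x <= (p - q) * M + c * (pi^-1 * (e / (e ^+ 2 + x ^+ 2))) + q * k / 8.
  have hpot := potential_le p0 q0 e0 leM x.
  have dg := damped_ge0 H (x + y) p0 e0.
  have happ := damped_approx_error H x p0 e0.
  rewrite {1}/ue (damped_resolvent H x p0 q0 e0) (damped_resolvent H (x + y) p0 q0 e0).
  move: hpot; set I1 := Rintegral _ _ _; set I2 := Rintegral _ _ _ => hpot.
  have : (p - q) * (p * (c * I1 - d * I2)) <= (p - q) * M.
    apply: ler_wpM2l; first by rewrite subr_ge0 ltW.
    by rewrite mulrC -ler_pdivlMr.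
  have : c * (p * damped p e x) <= c * (pi^-1 * (e / (e ^+ 2 + x ^+ 2)) + approx_error p e).
    exact: ler_wpM2l.
  have : 0 <= p * (d * damped p e (x + y)).
    exact: (mulr_ge0 (ltW p0) (mulr_ge0 d0 dg)).
  move: happ hn; move: (damped p e (x + y)) (damped p e x) (approx_error _ _) => v1 v2 v3.
  move: (pi^-1 * _) => v4.
  lra.
(* Near 0 the gap comes from the continuity of [u], elsewhere from the resolvent
   estimate [key], whose loss [q * M] exceeds its error terms. *)
pose gap := Num.min (k / 2) (q * k / (4 * p)).
have gap0 : 0 < gap by rewrite lt_min !divr_gt0 ?mulr_gt0.
have far x : ue e x <= M - gap.
  have [xr|rx] := ltP `|x| r.
    have h1 := ur x xr; have := ueu e x e0.
    rewrite ler_norml => /andP[_ h2].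
    have : gap <= k / 2 by rewrite ge_min lexx.
    by rewrite /k in h1 h2 he1 h1M *; lra.
  have hx : c * (pi^-1 * (e / (e ^+ 2 + x ^+ 2))) <= q * k / 8.
    apply: le_trans he2; rewrite ler_wpM2l// ler_wpM2l ?invr_ge0 ?pi_ge0//.
    rewrite ler_pM2l// lef_pV2 ?posrE ?exprn_gt0//; last first.
      by rewrite ltr_pwDl ?exprn_gt0 ?sqr_ge0.
    rewrite -(real_normK (num_real x)).
    by rewrite -[leLHS]add0r lerD ?sqr_ge0// lerXn2r ?nnegrE// ltW.
  have g2 : gap * p <= q * k / 4.
    have : gap <= q * k / (4 * p) by rewrite ge_min lexx orbT.
    by rewrite invfM mulrA ler_pdivlMr.
  have := key x; have : q * (k / 2) <= q * M by rewrite ler_pM2l.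
  move=> h3 h4; rewrite -(ler_pM2l p0) (mulrBr p M).
  by move: hx h4; move: (c * _) => v hx h4; lra.
have : M <= M - gap by apply: sup_le_ub; [exact: hs.1|move=> _ [x _ <-]].
by rewrite leNgt ltrBlDr ltrDl gap0.
Unshelve. all: by end_near. Qed.

Corollary rho_max_at0 (q z : R) : 0 < q -> rho q z <= rho q 0.
Proof.
move=> q0; have := maximum_principle 0 q0 ler01 (lexx 0) (- z).
by rewrite opprK !mul1r !mul0r !subr0 max_l// (rf_ge0 H).
Qed.

(** With [c = rho q (- y)] and [d = rho q 0] the maximum principle gives
[rho q (- x) * rho q (- y) <= rho q 0 * rho q (- (x + y))], the inequality that
the strong Markov property yields for hitting times.  Combined with
[rho q <= rho q 0], which makes [(rho q 0 - rho q (- x)) (rho q 0 - rho q (- y))]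
nonnegative, it gives the claim. *)
Corollary rho_subadditive (q x y : R) : 0 < q ->
  rho q 0 - rho q (- (x + y)) <= (rho q 0 - rho q (- x)) + (rho q 0 - rho q (- y)).
Proof.
move=> q0.
have r0 := rf_ge0 H 0 q0; have rx := rf_ge0 H (- x) q0; have ry := rf_ge0 H (- y) q0.
have rxy := rf_ge0 H (- (x + y)) q0.
have hx := rho_max_at0 (- x) q0; have hy := rho_max_at0 (- y) q0.
have := maximum_principle y q0 ry r0 x.
rewrite (mulrC (rho q 0) (rho q (- y))) subrr maxxx subr_le0 => hm.
move: r0; rewrite le_eqVlt => /predU1P[z0|r0].
  by rewrite -z0 in hx hy *; lra.
rewrite -(ler_pM2l r0); nra.
Qed.

End maximum_principle_section.

(** * Domination of the transforms near frequency zero *)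

Section domination.
Context {R : realType}.
Notation mu := (@lebesgue_measure R).
Notation D := (`[0%R, +oo[%classic : set R).
Variables (a b : R -> R) (rho : R -> R -> R).
Hypothesis H : resolvent_family a b rho.

Local Notation reF := (reF a b).
Local Notation imF := (imF a b).
Local Notation absF := (absF a b).
Local Notation sqmod := (sqmod a b).

(** The order of magnitude of [1 - cos l]: weights bounded by a multiple of it
remain integrable when multiplied by [1 / psi]. *)
Definition trunc_sqr (l : R) : R := Num.min 1 (l ^+ 2).

Lemma trunc_sqr_ge0 l : 0 <= trunc_sqr l.
Proof. by rewrite le_min ler01 sqr_ge0. Qed.

Lemma trunc_sqr_gt0 l : 0 < l -> 0 < trunc_sqr l.
Proof. by move=> l0; rewrite lt_min ltr01 exprn_gt0. Qed.

Lemma trunc_sqr_le l l' : 0 <= l -> l <= l' -> trunc_sqr l <= trunc_sqr l'.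
Proof.
move=> l0 ll'; rewrite le_min !ge_min lexx/=; apply/orP; right.
by rewrite lerXn2r ?nnegrE// (le_trans l0).
Qed.

Lemma trunc_sqrM (k l : R) : trunc_sqr k * trunc_sqr l <= trunc_sqr (k * l).
Proof.
have k1 : trunc_sqr k <= 1 by rewrite ge_min lexx.
have l1 : trunc_sqr l <= 1 by rewrite ge_min lexx.
have k2 : trunc_sqr k <= k ^+ 2 by rewrite ge_min lexx orbT.
have l2 : trunc_sqr l <= l ^+ 2 by rewrite ge_min lexx orbT.
rewrite le_min exprMn; apply/andP; split.
  by rewrite -[leRHS]mulr1 ler_pM ?trunc_sqr_ge0.
by rewrite ler_pM ?trunc_sqr_ge0.
Qed.

(** The explicit integral is [w] minus a product of a cosine, which carries the
position of the interval, and of [2 sin (l w / 2) / l]. *)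
Lemma integral_one_sub_cos_ge (x w l : R) : 0 < w -> 0 < l ->
  w * trunc_sqr (l * w / 2) / 48 <= \int[mu]_(z in `[x, x + w]) (1 - cos (l * z)).
Proof.
move=> w0 l0.
have xw : x < x + w by rewrite ltrDl.
have -> : \int[mu]_(z in `[x, x + w]) (1 - cos (l * z)) =
    w - (sin (l * (x + w)) - sin (l * x)) / l.
  rewrite /Rintegral (@continuous_FTC2 R _ (fun z => z - l^-1 * sin (l * z)) _ _ xw).
  - by rewrite -EFinB /=; ring.
  - apply: derivable_within_continuous => z _; exact: ex_derive.
  - have dF (z : R) : derivable (fun z => z - l^-1 * sin (l * z)) z 1 by exact: ex_derive.
    have cF (z : R) : {for z, continuous (fun z => z - l^-1 * sin (l * z))}.
      by apply: differentiable_continuous; apply/derivable1_diffP.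
    split => //.
    + by apply: cvg_at_right_filter; exact: cF.
    + by apply: cvg_at_left_filter; exact: cF.
  - move=> z _; rewrite derive1E derive_val /GRing.scale/=.
    by field; rewrite gt_eqF.
have t0 : 0 <= l * w / 2 by rewrite divr_ge0// mulr_ge0// ltW.
have := id_sub_norm_sin_ge t0; rewrite -/(trunc_sqr _).
set t := l * w / 2.
have -> : sin (l * (x + w)) - sin (l * x) = 2 * (cos (l * x + t) * sin t).
  have -> : l * (x + w) = (l * x + t) + t by rewrite /t; field.
  have -> : sin (l * x) = sin (l * x + t - t) by rewrite addrK.
  by rewrite sinD sinB; ring.
have : cos (l * x + t) * sin t <= `|sin t|.
  by apply: (le_trans (ler_norm _)); rewrite normrM ler_piMl// norm_cos_le1.
move=> h1 h2.
have -> : w = 2 * t / l by rewrite /t; field; rewrite gt_eqF.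
have -> : 2 * t / l * trunc_sqr t / 48 = 2 * (t * trunc_sqr t / 48) / l by ring.
rewrite -mulrBl ler_pM2r ?invr_gt0//.
lra.
Qed.

(** The right-hand side is the mean of [1 - cos (l z)] under the density
[rho 1]; being continuous of mass 1, this density is bounded below by a positive
constant on some interval, and the mean of [1 - cos (l z)] over an interval is
quadratic in [l] at 0. *)
Lemma one_sub_reF1_ge : exists2 c : R, 0 < c &
  forall l, 0 <= l -> c * trunc_sqr l <= 1 - reF 1 l.
Proof.
have r0 z := rf_ge0 H z ltr01.
have ir := rf_integrable H ltr01.
have cr := rf_continuous H ltr01.
have [x0 rx0] : exists x0, 0 < rho 1 x0.
  apply: contrapT => /forallNP hn.
  have := rf_mass H ltr01.
  rewrite (_ : rho 1 = cst 0) ?Rintegral_cst// ?mul0r ?invr1.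
    by move/eqP; rewrite eq_sym oner_eq0.
  apply/funext => z; apply/eqP; rewrite eq_le r0 andbT leNgt.
  by apply/negP; exact: hn.
have k2 : 0 < rho 1 x0 / 2 by rewrite divr_gt0.
have /cvgrPdist_le/(_ _ k2)/nbhs_ballP[e /= e0 he] := cr x0.
pose w := e / 2; have w0 : 0 < w by rewrite divr_gt0.
have rk z : x0 <= z <= x0 + w -> rho 1 x0 / 2 <= rho 1 z.
  move=> /andP[z1 z2]; have := he z; rewrite /ball/=.
  have -> : `|x0 - z| < e by rewrite ltr_norml /w in z2 *; apply/andP; split; lra.
  move=> /(_ isT); rewrite ler_norml => /andP[_]; lra.
exists (rho 1 x0 / 2 * (w * trunc_sqr (w / 2) / 48)).
  by rewrite mulr_gt0// divr_gt0// mulr_gt0// trunc_sqr_gt0// divr_gt0.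
move=> l; rewrite le_eqVlt => /predU1P[<-|l0].
  have -> : trunc_sqr 0 = 0 by rewrite /trunc_sqr expr0n/= min_r.
  rewrite mulr0 subr_ge0.
  rewrite -(rf_cos H _ ltr01); under eq_Rintegral do rewrite mul0r cos0 mulr1.
  by rewrite (rf_mass H)// invr1.
have mc : measurable_fun [set: R] (fun z => cos (l * z)).
  by under eq_fun do rewrite mulrC; exact: measurable_fun_cosM.
have irc : mu.-integrable [set: R] (EFin \o (fun z => rho 1 z * cos (l * z))).
  apply: (@integrable_scale_le R _ _ mu [set: R] _ (rho 1) 1) => //.
    by apply: measurable_funM => //; exact: (measurable_rho H).
  by move=> z _; rewrite mul1r normrM ler_piMr// norm_cos_le1.
have -> : 1 - reF 1 l = \int[mu]_z (rho 1 z * (1 - cos (l * z))).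
  rewrite -(rf_cos H _ ltr01) -{1}invr1 -(rf_mass H ltr01) -RintegralB//.
  by apply: eq_Rintegral => z _; ring.
have irB : mu.-integrable [set: R] (EFin \o (fun z => rho 1 z * (1 - cos (l * z)))).
  apply: (@integrable_scale_le R _ _ mu [set: R] _ (rho 1) 2) => //.
    apply: measurable_funM; first exact: (measurable_rho H).
    exact: measurable_funB.
  move=> z _; rewrite normrM mulrC ler_wpM2r// ger0_norm ?one_sub_cos_ge0//.
  exact: one_sub_cos_le2.
have iI : mu.-integrable `[x0, x0 + w] (EFin \o (fun z => 1 - cos (l * z))).
  apply: measurable_bounded_integrable => //.
  - by rewrite /= lebesgue_measure_itv/=; case: ifP => _; rewrite ?ltry// -EFinB ltry.
  - apply: measurable_funB => //; exact: measurable_funTS.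
  - exists 2; split; first exact: num_real.
    move=> M M2 z _ /=; rewrite ger0_norm ?one_sub_cos_ge0//.
    by rewrite (le_trans (one_sub_cos_le2 _))// ltW.
apply: (@le_trans _ _ (\int[mu]_(z in `[x0, x0 + w]) (rho 1 x0 / 2 * (1 - cos (l * z))))).
  rewrite RintegralZl// -mulrA ler_wpM2l ?(ltW k2)//.
  apply: (le_trans _ (integral_one_sub_cos_ge x0 w0 l0)).
  have h := trunc_sqrM (w / 2) l.
  have -> : l * w / 2 = w / 2 * l by ring.
  have : w * (trunc_sqr (w / 2) * trunc_sqr l) <= w * trunc_sqr (w / 2 * l) by rewrite ler_wpM2l// ltW.
  lra.
apply: (@le_trans _ _ (\int[mu]_(z in `[x0, x0 + w]) (rho 1 z * (1 - cos (l * z))))).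
  apply: le_Rintegral => //.
  - exact: integrable_mull.
  - exact: integrableS irB.
  - move=> z; rewrite /= in_itv/= => zI; apply: ler_wpM2r; first exact: one_sub_cos_ge0.
    exact: rk.
rewrite fine_le//.
- apply: integrable_fin_num => //; exact: integrableS irB.
- exact: integrable_fin_num.
apply: ge0_subset_integral => //.
- exact: (measurable_int mu irB).
- by move=> z _; rewrite lee_fin mulr_ge0// one_sub_cos_ge0.
Qed.

End domination.

Section zero_limit.
Context {R : realType}.
Notation mu := (@lebesgue_measure R).
Notation D := (`[0%R, +oo[%classic : set R).
Variables (a b : R -> R) (rho : R -> R -> R).
Hypothesis H : resolvent_family a b rho.
Variable c : R.
Hypothesis c0 : 0 < c.
Hypothesis reF1_ge : forall l, 0 <= l -> c * trunc_sqr l <= 1 - reF a b 1 l.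

Local Notation reF := (reF a b).
Local Notation imF := (imF a b).
Local Notation absF := (absF a b).
Local Notation sqmod := (sqmod a b).

Lemma sqmod_ge0 q l : 0 <= sqmod q l.
Proof. by rewrite addr_ge0 ?sqr_ge0. Qed.

Lemma sqmod_le q l : 0 <= q -> sqmod 0 l <= sqmod q l.
Proof. by move=> q0; have := rf_re_ge0 H l; rewrite /sqmod add0r; nra. Qed.

(** [1 - Re (1 / (1 + psi))] is the real part of [psi / (1 + psi)], hence at
most its modulus. *)
Lemma trunc_sqr_le_ratio l : 0 <= l ->
  c * trunc_sqr l <= Num.sqrt (sqmod 0 l) * absF 1 l.
Proof.
move=> l0; apply: (le_trans (reF1_ge l0)).
have N1 := sqmod_gt0 H l ltr01; have al := rf_re_ge0 H l.
have e0 : sqmod 0 l = a l ^+ 2 + b l ^+ 2 by rewrite /sqmod add0r.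
rewrite -ler_sqr ?nnegrE; first last.
- by rewrite mulr_ge0 ?sqrtr_ge0// absF_ge0.
- apply: le_trans (reF1_ge l0); by rewrite mulr_ge0 ?(ltW c0)// trunc_sqr_ge0.
rewrite exprMn sqr_sqrtr ?sqmod_ge0// (sqr_absF H _ ltr01).
have -> : 1 - reF 1 l = (a l + sqmod 0 l) / sqmod 1 l.
  move: N1; rewrite e0 /reF /sqmod => N1.
  by field; rewrite gt_eqF.
have -> : ((a l + sqmod 0 l) / sqmod 1 l) ^+ 2 =
  ((a l + sqmod 0 l) ^+ 2 / sqmod 1 l) / sqmod 1 l by field; rewrite gt_eqF.
rewrite ler_pM2r ?invr_gt0// ler_pdivrMr//.
rewrite e0 /sqmod; have := sqr_ge0 (b l); nra.
Qed.

Lemma absF1_le1 l : absF 1 l <= 1.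
Proof.
rewrite /absF invf_le1 ?sqrtr_gt0 ?(sqmod_gt0 H)//.
rewrite -ler_sqr ?nnegrE ?sqrtr_ge0// sqr_sqrtr ?sqmod_ge0//.
exact: (sqmod_ge H l ltr01).
Qed.

Lemma trunc_sqr_le_modulus l : 0 <= l -> c * trunc_sqr l <= Num.sqrt (sqmod 0 l).
Proof.
move=> l0; apply: (le_trans (trunc_sqr_le_ratio l0)).
by rewrite ler_piMr ?sqrtr_ge0// absF1_le1.
Qed.

Lemma sqmod0_gt0 l : 0 < l -> 0 < sqmod 0 l.
Proof.
move=> l0; rewrite -sqrtr_gt0 (lt_le_trans _ (trunc_sqr_le_modulus (ltW l0)))//.
by rewrite mulr_gt0// trunc_sqr_gt0.
Qed.

(** Since [|psi| <= |q + psi|], the previous bound of [min 1 (l^2)] by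
[|psi| / |1 + psi|] is stable under multiplication by [1 / |q + psi|].  The
right-hand side is integrable and free of [q]: every passage to the limit
[q -> 0+] under a frequency integral rests on it. *)
Lemma absF_dominated q l : 0 <= q -> 0 <= l ->
  trunc_sqr l * absF q l <= c^-1 * absF 1 l.
Proof.
move=> q0; rewrite le_eqVlt => /predU1P[<-|l0].
  have -> : trunc_sqr (0 : R) = 0 by rewrite /trunc_sqr expr0n/= min_r.
  by rewrite mul0r mulr_ge0 ?invr_ge0 ?(ltW c0)// absF_ge0.
have n0 := sqmod0_gt0 l0; have nq : 0 < sqmod q l by rewrite (lt_le_trans n0)// sqmod_le.
rewrite -(ler_pM2l c0) mulVKf ?gt_eqF// mulrA.
apply: (@le_trans _ _ (Num.sqrt (sqmod 0 l) * absF 1 l * absF q l)).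
  by rewrite ler_wpM2r ?absF_ge0// trunc_sqr_le_ratio// ltW.
rewrite mulrAC ler_piMl ?absF_ge0// ler_pdivrMr ?sqrtr_gt0// mul1r.
by apply: ler_wsqrtr; exact: sqmod_le.
Qed.

Lemma absF_le_far q l d : 0 <= q -> 0 < d -> d <= l ->
  absF q l <= (c * trunc_sqr d)^-1 * absF 1 l.
Proof.
move=> q0 d0 dl; have l0 : 0 < l by exact: lt_le_trans dl.
have := absF_dominated q0 (ltW l0).
have td := trunc_sqr_gt0 d0; have tl := trunc_sqr_le (ltW d0) dl.
move=> h; rewrite invfM mulrAC ler_pdivlMr// [leLHS]mulrC.
by apply: le_trans h; rewrite ler_wpM2r ?absF_ge0.
Qed.

Lemma absF_le0 q l : 0 <= q -> 0 < l -> absF q l <= absF 0 l.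
Proof.
move=> q0 l0; have n0 := sqmod0_gt0 l0.
have nq : 0 < sqmod q l by rewrite (lt_le_trans n0)// sqmod_le.
by rewrite lef_pV2 ?posrE ?sqrtr_gt0//; apply: ler_wsqrtr; exact: sqmod_le.
Qed.

Lemma norm_reF_le_gt0 q l : 0 <= q -> 0 < l -> `|reF q l| <= absF q l.
Proof.
move=> q0 l0; have nq : 0 < sqmod q l by rewrite (lt_le_trans (sqmod0_gt0 l0))// sqmod_le.
rewrite -ler_sqr ?nnegrE ?absF_ge0// real_normK ?num_real//.
rewrite /absF exprVn sqr_sqrtr ?sqmod_ge0// /reF expr_div_n.
rewrite ler_pdivrMr ?exprn_gt0// expr2 mulKf ?gt_eqF//.
by rewrite lerDl sqr_ge0.
Qed.

Lemma norm_imF_le_gt0 q l : 0 <= q -> 0 < l -> `|imF q l| <= absF q l.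
Proof.
move=> q0 l0; have nq : 0 < sqmod q l by rewrite (lt_le_trans (sqmod0_gt0 l0))// sqmod_le.
rewrite -ler_sqr ?nnegrE ?absF_ge0// real_normK ?num_real//.
rewrite /absF exprVn sqr_sqrtr ?sqmod_ge0// /imF expr_div_n sqrrN.
rewrite ler_pdivrMr ?exprn_gt0// expr2 mulKf ?gt_eqF//.
by rewrite lerDr sqr_ge0.
Qed.

Lemma cvg_reF0 l : 0 < l -> reF q l @[q --> 0^'+] --> reF 0 l.
Proof.
move=> l0; apply: cvg_at_right_filter; apply: cvgM.
  by apply: cvgD; [exact: cvg_id|exact: cvg_cst].
apply: cvgV; first by rewrite gt_eqF// sqmod0_gt0.
apply: cvgD; last exact: cvg_cst.
apply: (cvg_comp (fun q => q + a l) (fun x => x ^+ 2)); last exact: exprn_continuous.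
by apply: cvgD; [exact: cvg_id|exact: cvg_cst].
Qed.

Lemma cvg_imF0 l : 0 < l -> imF q l @[q --> 0^'+] --> imF 0 l.
Proof.
move=> l0; apply: cvg_at_right_filter; apply: cvgM; first exact: cvg_cst.
apply: cvgV; first by rewrite gt_eqF// sqmod0_gt0.
apply: cvgD; last exact: cvg_cst.
apply: (cvg_comp (fun q => q + a l) (fun x => x ^+ 2)); last exact: exprn_continuous.
by apply: cvgD; [exact: cvg_id|exact: cvg_cst].
Qed.

Section dominated_weights.
Variables (u v : R -> R) (K : R).
Hypothesis measurable_u : measurable_fun D u.
Hypothesis measurable_v : measurable_fun D v.
Hypothesis uK : forall l, 0 <= l -> `|u l| <= K * trunc_sqr l.
Hypothesis vK : forall l, 0 <= l -> `|v l| <= K * trunc_sqr l.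

Lemma weight0 (w : R -> R) : (forall l, 0 <= l -> `|w l| <= K * trunc_sqr l) -> w 0 = 0.
Proof.
move=> /(_ 0 (lexx 0)); have -> : trunc_sqr (0 : R) = 0 by rewrite /trunc_sqr expr0n/= min_r.
by rewrite mulr0 normr_le0 => /eqP.
Qed.

Lemma norm_weighted_le q l : 0 <= q -> 0 <= l ->
  `|u l * reF q l + v l * imF q l| <= 2 * K * c^-1 * absF 1 l.
Proof.
move=> q0; rewrite le_eqVlt => /predU1P[<-|l0].
  rewrite (weight0 uK) (weight0 vK) !mul0r addr0 normr0.
  have := uK ler01; rewrite /trunc_sqr expr1n minxx mulr1 => K0.
  by rewrite !mulr_ge0 ?invr_ge0 ?absF_ge0 ?(ltW c0) ?(le_trans _ K0).
have K0 : 0 <= K.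
  by have := uK ler01; rewrite /trunc_sqr expr1n minxx mulr1; apply: le_trans.
have hd := absF_dominated q0 (ltW l0).
apply: (le_trans (ler_normD _ _)); rewrite (normrM (u l)) (normrM (v l)).
have aux (w z : R) : `|w| <= K * trunc_sqr l -> `|z| <= absF q l ->
    `|w| * `|z| <= K * (c^-1 * absF 1 l).
  move=> wK zF; apply: (@le_trans _ _ (K * trunc_sqr l * absF q l)); first exact: ler_pM.
  by rewrite -mulrA ler_wpM2l.
have h1 := aux _ _ (uK (ltW l0)) (norm_reF_le_gt0 q0 l0).
have h2 := aux _ _ (vK (ltW l0)) (norm_imF_le_gt0 q0 l0).
by apply: (le_trans (lerD h1 h2)); rewrite -!mulrA [leRHS]mulr_natl mulr2n.
Qed.

(** Weights of the order of [1 - cos l] are integrated against [1 / (q + psi)]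
by dominated convergence. *)
Lemma weighted_cvg :
  mu.-integrable D (EFin \o (fun l => u l * reF 0 l + v l * imF 0 l)) /\
  \int[mu]_(l in D) (u l * reF q l + v l * imF q l) @[q --> 0^'+] -->
  \int[mu]_(l in D) (u l * reF 0 l + v l * imF 0 l).
Proof.
apply: (@Rintegral_dominated_cvg_at_right R _ _ mu D _ _ (fun l => 2 * K * c^-1 * absF 1 l)) => //.
- move=> q q0; apply: measurable_funD; apply: measurable_funM => //; apply: measurable_funTS.
    exact: (measurable_reF H).
  exact: (measurable_imF H).
- move=> l; rewrite /= in_itv/= andbT le_eqVlt => /predU1P[<-|l0].
    by rewrite (weight0 uK) (weight0 vK); under eq_fun do rewrite !mul0r; rewrite !mul0r; exact: cvg_cst.
  by apply: cvgD; apply: cvgM; [exact: cvg_cst|exact: cvg_reF0|exact: cvg_cst|exact: cvg_imF0].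
- by apply: integrable_mull => //; exact: (rf_absF H).
- move=> q l q0; rewrite /= in_itv/= andbT => l0.
  by apply: norm_weighted_le => //; exact: ltW.
Qed.

Lemma integrable_weighted q : 0 < q ->
  mu.-integrable D (EFin \o (fun l => u l * reF q l + v l * imF q l)).
Proof.
move=> q0; apply: (@integrable_scale_le R _ _ mu D _ (absF 1) (2 * K * c^-1)) => //.
- apply: measurable_funD; apply: measurable_funM => //; apply: measurable_funTS.
    exact: (measurable_reF H).
  exact: (measurable_imF H).
- exact: (rf_absF H).
- move=> l; rewrite /= in_itv/= andbT => l0.
  by rewrite (ger0_norm (absF_ge0 _ _ _ _)) norm_weighted_le// ltW.
Qed.

End dominated_weights.
End zero_limit.

(** * Splitting off the drift *)

Section drift.
Context {R : realType}.
Notation mu := (@lebesgue_measure R).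
Notation D := (`[0%R, +oo[%classic : set R).
Variables (a b : R -> R) (rho : R -> R -> R).
Hypothesis H : resolvent_family a b rho.
Variable c : R.
Hypothesis c0 : 0 < c.
Hypothesis reF1_ge : forall l, 0 <= l -> c * trunc_sqr l <= 1 - reF a b 1 l.

Local Notation reF := (reF a b).
Local Notation imF := (imF a b).
Local Notation absF := (absF a b).
Local Notation sqmod := (sqmod a b).

Definition weight_bound (x : R) : R := 2 + 2 * `|x| + 2 * x ^+ 2.

Lemma cos_weight_le (x l : R) : 0 <= l ->
  `|1 - cos (l * x)| <= weight_bound x * trunc_sqr l.
Proof.
move=> l0; rewrite ger0_norm ?one_sub_cos_ge0// /weight_bound.
have x0 := normr_ge0 x; have x2 := sqr_ge0 x.
rewrite /trunc_sqr; have [h|h] := leP 1 (l ^+ 2).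
  by rewrite mulr1; have := one_sub_cos_le2 (l * x); lra.
have := one_sub_cos_le (l * x); rewrite exprMn.
have := sqr_ge0 l; move: (l ^+ 2) (x ^+ 2) `|x| x0 x2 => L Z y y0 Z0 L0.
have := mulr_ge0 L0 Z0; have := mulr_ge0 y0 L0; lra.
Qed.

(** Subtracting [x sin l] removes the linear part of [sin (l x)] at [l = 0]
without spoiling boundedness at infinity, as [x l] would. *)
Lemma sin_weight_le (x l : R) : 0 <= l ->
  `|sin (l * x) - x * sin l| <= weight_bound x * trunc_sqr l.
Proof.
move=> l0; rewrite /weight_bound.
have x0 := normr_ge0 x; have x2 := sqr_ge0 x.
rewrite /trunc_sqr; have [h|h] := leP 1 (l ^+ 2).
  rewrite mulr1 (le_trans (ler_normB _ _))// normrM.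
  have : `|x| * `|sin l| <= `|x| by rewrite ler_piMr// norm_sin_le1.
  by have := norm_sin_le1 (l * x); lra.
have -> : sin (l * x) - x * sin l = (sin (l * x) - l * x) - x * (sin l - l) by ring.
rewrite (le_trans (ler_normB _ _))// normrM.
have := norm_sin_sub_id_le_sqr (l * x); rewrite exprMn.
have : `|x| * `|sin l - l| <= `|x| * (2 * l ^+ 2).
  by rewrite ler_wpM2l// norm_sin_sub_id_le_sqr.
have := sqr_ge0 l.
move: (l ^+ 2) (x ^+ 2) `|x| x0 x2 `|sin (l * x) - l * x| (_ * `|sin l - l|) => L Z y y0 Z0 A B L0.
lra.
Qed.

Lemma measurable_cos_weight (x : R) : measurable_fun D (fun l : R => 1 - cos (l * x)).
Proof. by apply: measurable_funB => //; exact: measurable_fun_cosM. Qed.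

Lemma measurable_sin1 : measurable_fun D (fun l : R => sin l).
Proof.
rewrite (_ : (fun l => sin l) = (fun l => sin (l * 1))).
  exact: measurable_fun_sinM.
by apply/funext => l; rewrite mulr1.
Qed.

Lemma measurable_sin_weight (x : R) : measurable_fun D (fun l : R => sin (l * x) - x * sin l).
Proof.
apply: measurable_funB; first exact: measurable_fun_sinM.
by apply: measurable_funM => //; exact: measurable_sin1.
Qed.

(** The part of [h_q] whose weights are quadratic at frequency 0, hence which
always has a limit as [q -> 0+]. *)
Definition drift_free (q x : R) : R := pi^-1 *
  \int[mu]_(l in `[0%R, +oo[) ((1 - cos (l * x)) * reF q l +
     (sin (l * x) - x * sin l) * imF q l).

(** The coefficient of [x] that is left once the drift-free part is taken out of
[h_q]. *)
Definition drift (q : R) : R := pi^-1 * \int[mu]_(l in `[0%R, +oo[) (sin l * imF q l).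

Local Notation hq := (h_ rho).

Lemma integrable_drift q : 0 < q -> mu.-integrable D (EFin \o (fun l => sin l * imF q l)).
Proof.
move=> q0; apply: (@integrable_scale_le R _ _ mu D _ (imF q) 1) => //.
- apply: measurable_funM; first exact: measurable_sin1.
  by apply: measurable_funTS; exact: (measurable_imF H).
- exact: (integrable_imF H).
- by move=> l _; rewrite (normrM (sin l)) ler_wpM2r// norm_sin_le1.
Qed.

Lemma hq_decomposition q x : 0 < q -> hq q x = drift_free q x + x * drift q.
Proof.
move=> q0; rewrite /h_ -[in X in X - _]oppr0 !(resolvent_density_fourier H)//.
rewrite /fourier /drift_free /drift mulrCA -mulrBr -mulrDr; congr (_ * _).
have iR := integrable_reF H q0; have iI := integrable_imF H q0.
rewrite -RintegralZl//; last exact: integrable_drift.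
rewrite -RintegralB//; [|exact: integrable_fourier_integrand..].
rewrite -RintegralD//; last 2 first.
- exact: (integrable_weighted H c0 reF1_ge (measurable_cos_weight x)
    (measurable_sin_weight x) (@cos_weight_le x) (@sin_weight_le x) q0).
- by apply: integrable_mull => //; exact: integrable_drift.
by apply: eq_Rintegral => l _; rewrite mulr0 cos0 sin0; ring.
Qed.

Lemma drift_free_cvg x :
  mu.-integrable D (EFin \o (fun l => (1 - cos (l * x)) * reF 0 l +
     (sin (l * x) - x * sin l) * imF 0 l)) /\
  drift_free q x @[q --> 0^'+] --> drift_free 0 x.
Proof.
have [h1 h2] := weighted_cvg H c0 reF1_ge (measurable_cos_weight x)
  (measurable_sin_weight x) (@cos_weight_le x) (@sin_weight_le x).
by split => //; apply: cvgM => //; exact: cvg_cst.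
Qed.

Lemma measurable_trunc_sqr : measurable_fun D trunc_sqr.
Proof. by apply: measurable_minr => //; exact: exprn_measurable. Qed.

(** A distance between [1 / (q + psi)] and [1 / psi] that bounds the error
[drift_free q x - drift_free 0 x] up to a factor depending only on [x]; it is
what makes the convergence locally uniform. *)
Definition transform_gap (q : R) : R := pi^-1 * \int[mu]_(l in `[0%R, +oo[)
  (`|trunc_sqr l * reF q l - trunc_sqr l * reF 0 l| +
   `|trunc_sqr l * imF q l - trunc_sqr l * imF 0 l|).

Lemma norm_trunc_sqr (l : R) : `|trunc_sqr l| <= 1 * trunc_sqr l.
Proof. by rewrite mul1r ger0_norm// trunc_sqr_ge0. Qed.

Lemma norm_cst0_trunc_sqr (l : R) : `|cst 0 l : R| <= 1 * trunc_sqr l.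
Proof. by rewrite normr0 mul1r trunc_sqr_ge0. Qed.

Lemma integrable_trunc_reF :
  mu.-integrable D (EFin \o (fun l => trunc_sqr l * reF 0 l)).
Proof.
have [h _] := @weighted_cvg R a b rho H c c0 reF1_ge trunc_sqr (cst 0) 1
  measurable_trunc_sqr (measurable_cst _) (fun l _ => norm_trunc_sqr l)
  (fun l _ => norm_cst0_trunc_sqr l).
by apply: eq_integrable h => // l _; rewrite /= mul0r addr0.
Qed.

Lemma integrable_trunc_imF :
  mu.-integrable D (EFin \o (fun l => trunc_sqr l * imF 0 l)).
Proof.
have [h _] := @weighted_cvg R a b rho H c c0 reF1_ge (cst 0) trunc_sqr 1
  (measurable_cst _) measurable_trunc_sqr (fun l _ => norm_cst0_trunc_sqr l)
  (fun l _ => norm_trunc_sqr l).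
by apply: eq_integrable h => // l _; rewrite /= mul0r add0r.
Qed.

Lemma measurable_transform_gap q : 0 < q -> measurable_fun D (fun l =>
  `|trunc_sqr l * reF q l - trunc_sqr l * reF 0 l| +
  `|trunc_sqr l * imF q l - trunc_sqr l * imF 0 l|).
Proof.
move=> q0; have mt := measurable_trunc_sqr.
apply: measurable_funD; apply: measurableT_comp => //; apply: measurable_funB.
- apply: measurable_funM => //; apply: measurable_funTS; exact: (measurable_reF H).
- by apply/measurable_EFinP; exact: (measurable_int mu integrable_trunc_reF).
- apply: measurable_funM => //; apply: measurable_funTS; exact: (measurable_imF H).
- by apply/measurable_EFinP; exact: (measurable_int mu integrable_trunc_imF).
Qed.

Lemma transform_gap_integrand_le q l : 0 <= q -> 0 <= l ->
  `|trunc_sqr l * reF q l - trunc_sqr l * reF 0 l| +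
  `|trunc_sqr l * imF q l - trunc_sqr l * imF 0 l| <= 4 * c^-1 * absF 1 l.
Proof.
move=> q0; rewrite le_eqVlt => /predU1P[<-|l0].
  have -> : trunc_sqr (0 : R) = 0 by rewrite /trunc_sqr expr0n/= min_r.
  by rewrite !mul0r subrr normr0 addr0 mulr_ge0 ?absF_ge0// mulr_ge0 ?invr_ge0 ?(ltW c0).
have aux q' z : 0 <= q' -> `|z| <= absF q' l -> `|trunc_sqr l * z| <= c^-1 * absF 1 l.
  move=> q'0 zF; rewrite normrM ger0_norm ?trunc_sqr_ge0//.
  apply: (le_trans _ (absF_dominated H c0 reF1_ge q'0 (ltW l0))).
  by rewrite ler_wpM2l ?trunc_sqr_ge0.
have h1 := aux _ _ q0 (norm_reF_le_gt0 H c0 reF1_ge q0 l0).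
have h2 := aux _ _ q0 (norm_imF_le_gt0 H c0 reF1_ge q0 l0).
have h3 := aux _ _ (lexx 0) (norm_reF_le_gt0 H c0 reF1_ge (lexx 0) l0).
have h4 := aux _ _ (lexx 0) (norm_imF_le_gt0 H c0 reF1_ge (lexx 0) l0).
have := ler_normB (trunc_sqr l * reF q l) (trunc_sqr l * reF 0 l).
have := ler_normB (trunc_sqr l * imF q l) (trunc_sqr l * imF 0 l).
by rewrite -mulrA; move: (c^-1 * _) h1 h2 h3 h4 => C; lra.
Qed.

Lemma integrable_transform_gap q : 0 < q -> mu.-integrable D (EFin \o (fun l =>
  `|trunc_sqr l * reF q l - trunc_sqr l * reF 0 l| +
  `|trunc_sqr l * imF q l - trunc_sqr l * imF 0 l|)).
Proof.
move=> q0; apply: (@integrable_scale_le R _ _ mu D _ (absF 1) (4 * c^-1)) => //.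
- exact: measurable_transform_gap.
- exact: (rf_absF H).
- move=> l; rewrite /= in_itv/= andbT => l0.
  by rewrite ger0_norm ?addr_ge0// (ger0_norm (absF_ge0 _ _ _ _)) transform_gap_integrand_le// ltW.
Qed.

Lemma transform_gap_cvg0 : transform_gap q @[q --> 0^'+] --> 0.
Proof.
rewrite -[X in _ --> X](mulr0 pi^-1); apply: cvgM; first exact: cvg_cst.
rewrite [X in _ --> X](_ : 0 = \int[mu]_(l in D) (cst 0 l : R)); last by rewrite Rintegral_cst// mul0r.
apply: (proj2 (@Rintegral_dominated_cvg_at_right R _ _ mu D _ _
  (fun l => 4 * c^-1 * absF 1 l) _ _ _ _ _)) => //.
- exact: measurable_transform_gap.
- move=> l; rewrite /= in_itv/= andbT le_eqVlt => /predU1P[<-|l0].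
    have -> : trunc_sqr (0 : R) = 0 by rewrite /trunc_sqr expr0n/= min_r.
    by under eq_fun do rewrite !mul0r subrr normr0 addr0; exact: cvg_cst.
  rewrite -[X in _ --> X](addr0 0).
  apply: cvgD; apply/norm_cvg0P.
    rewrite -[X in _ --> X](subrr (trunc_sqr l * reF 0 l)).
    apply: cvgB; last exact: cvg_cst.
    by apply: cvgM; [exact: cvg_cst|exact: (cvg_reF0 H c0 reF1_ge)].
  rewrite -[X in _ --> X](subrr (trunc_sqr l * imF 0 l)).
  apply: cvgB; last exact: cvg_cst.
  by apply: cvgM; [exact: cvg_cst|exact: (cvg_imF0 H c0 reF1_ge)].
- by apply: integrable_mull => //; exact: (rf_absF H).
- move=> q l q0; rewrite /= in_itv/= andbT => l0.
  by rewrite ger0_norm ?addr_ge0// transform_gap_integrand_le// ltW.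
Qed.

Lemma drift_free_gap q x : 0 < q ->
  `|drift_free q x - drift_free 0 x| <= weight_bound x * transform_gap q.
Proof.
move=> q0; rewrite /drift_free -mulrBr normrM /transform_gap mulrCA.
rewrite gtr0_norm ?invr_gt0 ?pi_gt0// ler_wpM2l ?invr_ge0 ?pi_ge0//.
have iq := integrable_weighted H c0 reF1_ge (measurable_cos_weight x)
  (measurable_sin_weight x) (@cos_weight_le x) (@sin_weight_le x) q0.
have [i0 _] := drift_free_cvg x.
rewrite -RintegralB// -RintegralZl//; last exact: integrable_transform_gap.
have iB := @integrableB_EFin R _ _ mu D _ _ (measurable_itv _) iq i0.
apply: (le_trans (le_normr_Rintegral _ iB)) => //.
apply: le_Rintegral => //.
- exact: (integrable_norm iB).
- by apply: integrable_mull => //; exact: integrable_transform_gap.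
move=> l; rewrite /= in_itv/= andbT => l0.
have -> : (1 - cos (l * x)) * reF q l + (sin (l * x) - x * sin l) * imF q l -
   ((1 - cos (l * x)) * reF 0 l + (sin (l * x) - x * sin l) * imF 0 l) =
   (1 - cos (l * x)) * (reF q l - reF 0 l) + (sin (l * x) - x * sin l) * (imF q l - imF 0 l).
  by ring.
apply: (le_trans (ler_normD _ _)); rewrite (normrM (1 - _)) (normrM (sin _ - _)).
rewrite -!(mulrBr (trunc_sqr l)) !(normrM (trunc_sqr l)) (ger0_norm (trunc_sqr_ge0 l)).
rewrite (mulrDr (weight_bound x)) !mulrA.
by apply: lerD; apply: ler_wpM2r => //; [exact: cos_weight_le|exact: sin_weight_le].
Qed.

Hypothesis rho_le : forall q z, 0 < q -> rho q z <= rho q 0.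

Lemma hq_ge0 q x : 0 < q -> 0 <= hq q x.
Proof. by move=> q0; rewrite subr_ge0 rho_le. Qed.

(** As [h_q (- x)] is nonnegative, [h_q x <= h_q x + h_q (- x)], and the sines
cancel in this sum. *)
Lemma hq_le q x : 0 < q ->
  hq q x <= 2 * (pi^-1 * \int[mu]_(l in `[0%R, +oo[) ((1 - cos (l * x)) * reF q l)).
Proof.
move=> q0; have hN := hq_ge0 (- x) q0.
suff -> : 2 * (pi^-1 * \int[mu]_(l in `[0%R, +oo[) ((1 - cos (l * x)) * reF q l)) =
    hq q x + hq q (- x) by rewrite lerDl.
rewrite !hq_decomposition// mulNr addrACA subrr addr0.
have iw y := integrable_weighted H c0 reF1_ge (measurable_cos_weight y)
  (measurable_sin_weight y) (@cos_weight_le y) (@sin_weight_le y) q0.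
rewrite /drift_free -mulrDr mulrCA; congr (_ * _).
rewrite -RintegralD// -RintegralZl//.
  by apply: eq_Rintegral => l _; rewrite mulrN cosN sinN; ring.
have := iw x; have := @integrable_weighted R a b rho H c c0 reF1_ge
  (fun l => 1 - cos (l * x)) (cst 0) (weight_bound x) (measurable_cos_weight x)
  (measurable_cst _) (@cos_weight_le x) _ q q0.
move=> h _; apply: eq_integrable (h _) => //.
  by move=> l _; rewrite /= mul0r addr0.
move=> l l0; rewrite normr0; apply: le_trans (cos_weight_le x l0) => //.
Qed.

End drift.

(** * Convergence of the drift when the variance is infinite *)

Section drift_limit.
Context {R : realType}.
Notation mu := (@lebesgue_measure R).
Notation D := (`[0%R, +oo[%classic : set R).
Variables (a b : R -> R) (rho : R -> R -> R).
Hypothesis H : resolvent_family a b rho.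
Variable c : R.
Hypothesis c0 : 0 < c.
Hypothesis reF1_ge : forall l, 0 <= l -> c * trunc_sqr l <= 1 - reF a b 1 l.

Local Notation reF := (reF a b).
Local Notation imF := (imF a b).
Local Notation absF := (absF a b).
Local Notation sqmod := (sqmod a b).
Local Notation drift := (drift a b).
Local Notation drift_free := (drift_free a b).
Local Notation transform_gap := (transform_gap a b).

Lemma integrable_cauchy (e : R) : 0 < e ->
  mu.-integrable D (EFin \o (fun l => e / (e ^+ 2 + l ^+ 2))).
Proof.
move=> e0.
have N0 (x : R) : 0 < e ^+ 2 + x ^+ 2 by rewrite ltr_pwDl ?exprn_gt0 ?sqr_ge0.
apply/integrableP; split.
  apply/measurable_EFinP; apply: measurable_funTS; apply: continuous_measurable_fun => x.
  apply: cvgM; first exact: cvg_cst.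
  apply: cvgV; first by rewrite gt_eqF.
  by apply: cvgD; [exact: cvg_cst|apply: exprn_continuous].
under eq_integral do rewrite /= ger0_norm ?divr_ge0 ?(ltW e0) ?(ltW (N0 _))//.
by rewrite integral_cauchy_halfline// ltry.
Qed.

Lemma Rintegral_cauchy (e : R) : 0 < e ->
  \int[mu]_(l in `[0%R, +oo[) (e / (e ^+ 2 + l ^+ 2)) = pi / 2.
Proof. by move=> e0; rewrite /Rintegral integral_cauchy_halfline. Qed.

(** If [|psi l| >= A l^2] on [0, d], the integrand is at most
[(1 - cos (l x)) / (A l^2)] there, and
[1 - cos t <= 5 / 2 * t^2 / (1 + t^2)] turns this into a Cauchy kernel of width
[1 / x]; beyond [d] the domination by [|F 1|] is used. *)
Lemma cos_reF_le (A d x q l : R) : 0 < A -> 0 < d -> 0 < x -> 0 < q -> 0 <= l ->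
  (forall l, 0 < l -> l <= d -> A * l ^+ 2 <= Num.sqrt (sqmod 0 l)) ->
  (1 - cos (l * x)) * reF q l <=
  5 / 2 * A^-1 * x * (x^-1 / (x^-1 ^+ 2 + l ^+ 2)) +
  2 * (c * trunc_sqr d)^-1 * absF 1 l.
Proof.
move=> A0 d0 x0 q0; have q0' := ltW q0.
have xi0 : 0 < x^-1 by rewrite invr_gt0.
have N0 (y : R) : 0 < x^-1 ^+ 2 + y ^+ 2 by rewrite ltr_pwDl ?exprn_gt0 ?sqr_ge0.
have k0 (y : R) : 0 <= 5 / 2 * A^-1 * x * (x^-1 / (x^-1 ^+ 2 + y ^+ 2)).
  by rewrite !mulr_ge0 ?invr_ge0 ?(ltW x0) ?(ltW A0) ?(ltW (N0 _)).
have k1 (y : R) : 0 <= 2 * (c * trunc_sqr d)^-1 * absF 1 y.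
  by rewrite mulr_ge0 ?absF_ge0// mulr_ge0// invr_ge0 mulr_ge0 ?trunc_sqr_ge0// ltW.
rewrite le_eqVlt => /predU1P[<- _|l0 Al].
  by rewrite mul0r cos0 subrr mul0r addr_ge0.
have hre : reF q l <= absF q l by rewrite (le_trans (ler_norm _))// (norm_reF_le H).
apply: (@le_trans _ _ ((1 - cos (l * x)) * absF q l)).
  by rewrite ler_wpM2l// one_sub_cos_ge0.
have [ld|dl] := leP l d; last first.
  rewrite -[leLHS]add0r; apply: lerD => //; rewrite -mulrA.
  apply: ler_pM; rewrite ?one_sub_cos_ge0 ?absF_ge0 ?one_sub_cos_le2//.
  exact: (absF_le_far H c0 reF1_ge q0' d0 (ltW dl)).
rewrite -[leLHS]addr0; apply: lerD => //.
have l2 : 0 < l ^+ 2 by rewrite exprn_gt0.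
have hF : absF q l <= A^-1 * (l ^+ 2)^-1.
  apply: (le_trans (absF_le0 H c0 reF1_ge q0' l0)).
  rewrite -invfM lef_pV2 ?posrE ?mulr_gt0 ?sqrtr_gt0 ?(sqmod0_gt0 H c0 reF1_ge)//.
  exact: Al.
apply: (@le_trans _ _ ((1 - cos (l * x)) * (A^-1 * (l ^+ 2)^-1))).
  by rewrite ler_wpM2l// one_sub_cos_ge0.
have -> : 5 / 2 * A^-1 * x * (x^-1 / (x^-1 ^+ 2 + l ^+ 2)) =
  (5 / 2 * ((l * x) ^+ 2 / (1 + (l * x) ^+ 2))) * (A^-1 * (l ^+ 2)^-1).
  have N1 : 0 < 1 + (l * x) ^+ 2 by rewrite ltr_pwDl ?sqr_ge0.
  have N2 : 0 < (l * x) ^+ 2 + 1 by rewrite addrC.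
  have N3 : 0 < 1 + l ^+ 2 * x ^+ 2 by rewrite -exprMn.
  field; rewrite ?(gt_eqF l0) ?(gt_eqF x0) ?(gt_eqF A0) ?(gt_eqF N1) ?(gt_eqF N3)//=.
apply: ler_wpM2r; first by rewrite mulr_ge0// invr_ge0 ltW.
have h1 := one_sub_cos_le (l * x); have h2 := one_sub_cos_le2 (l * x).
have h0 := one_sub_cos_ge0 (l * x).
have N1 : 0 < 1 + (l * x) ^+ 2 by rewrite ltr_pwDl ?sqr_ge0.
rewrite mulrA ler_pdivlMr//; have := sqr_ge0 (l * x); move: (_ ^+ 2) h1 => t h1 t0.
have : (1 - cos (l * x)) * t <= 2 * t by rewrite ler_wpM2r.
move: (cos _) h0 h1 h2 => k; lra.
Qed.

(** Linear in [x] with a slope of order [1 / A], up to a constant, and free of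
[q]: when [A] can be taken arbitrarily large, the left-hand side is [o(x)] as
[x -> oo], uniformly in [q]. *)
Lemma Rintegral_cos_reF_le (A d x q : R) : 0 < A -> 0 < d -> 0 < x -> 0 < q ->
  (forall l, 0 < l -> l <= d -> A * l ^+ 2 <= Num.sqrt (sqmod 0 l)) ->
  pi^-1 * \int[mu]_(l in `[0%R, +oo[) ((1 - cos (l * x)) * reF q l) <=
  5 / 4 * A^-1 * x +
  pi^-1 * (2 * (c * trunc_sqr d)^-1 * \int[mu]_(l in `[0%R, +oo[) absF 1 l).
Proof.
move=> A0 d0 x0 q0 hA; have xi0 : 0 < x^-1 by rewrite invr_gt0.
have -> : 5 / 4 * A^-1 * x = pi^-1 * (5 / 2 * A^-1 * x * (pi / 2)).
  have : (pi : R) != 0 by rewrite gt_eqF// pi_gt0.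
  by move: (pi : R) => p p0; field; rewrite p0 gt_eqF.
rewrite -mulrDr ler_wpM2l ?invr_ge0 ?pi_ge0//.
rewrite -(Rintegral_cauchy xi0).
have iF := rf_absF H ltr01; have ik := integrable_cauchy xi0.
rewrite -RintegralZl// -[X in _ + X]RintegralZl// -RintegralD//; last 2 first.
- exact: (integrable_mull _ _ ik).
- exact: (integrable_mull _ _ iF).
apply: le_Rintegral => //.
- apply: (@integrable_scale_le R _ _ mu D _ (reF q) 2) => //.
  + apply: measurable_funM; first exact: measurable_cos_weight.
    by apply: measurable_funTS; exact: (measurable_reF H).
  + exact: (integrable_reF H).
  + move=> l _; rewrite (normrM (1 - _)) ler_wpM2r// ger0_norm ?one_sub_cos_ge0//.
    exact: one_sub_cos_le2.
- apply: integrableD_EFin => //; [exact: (integrable_mull _ _ ik)|exact: (integrable_mull _ _ iF)].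
- move=> l; rewrite /= in_itv/= andbT => l0; exact: cos_reF_le.
Qed.

Hypothesis rho_le : forall q z, 0 < q -> rho q z <= rho q 0.

(** In [h_q x = drift_free q x + x drift q], the left-hand side lies between 0
and [o(x)], uniformly in [q].  Fix [x] so large that the [o(x)] is below
[(e / 2) x], and then let [q] be small: the first term on the right is nearly
constant, so that [drift q] varies by less than [e]. *)
Theorem drift_cvg_infinite_variance :
  (forall A : R, 0 < A -> exists2 d, 0 < d &
     forall l, 0 < l -> l <= d -> A * l ^+ 2 <= Num.sqrt (sqmod 0 l)) ->
  exists B : R, drift q @[q --> 0^'+] --> B.
Proof.
move=> hV; apply/cvg_ex; apply: cauchy_cvg; apply: cauchy_exP => e e0.
pose A := 10 / e; have A0 : 0 < A by rewrite divr_gt0.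
have [d d0 hA] := hV A A0.
pose I0 := pi^-1 * (2 * (c * trunc_sqr d)^-1 * \int[mu]_(l in `[0%R, +oo[) absF 1 l).
have I00 : 0 <= I0.
  rewrite !mulr_ge0 ?invr_ge0 ?pi_ge0 ?mulr_ge0 ?trunc_sqr_ge0 ?(ltW c0)//.
  by apply: Rintegral_ge0 => l _; exact: absF_ge0.
(* This [x] makes the constant of [Rintegral_cos_reF_le] at most [e / 8 * x], and
   [A] does the same for its linear term. *)
pose x := 1 + 8 * I0 / e.
have x0 : 0 < x.
  have : 0 <= 8 * I0 / e by apply: divr_ge0; [exact: mulr_ge0|exact: ltW].
  by rewrite /x; lra.
have Ix : I0 <= e / 8 * x.
  by rewrite /x mulrDr; have -> : e / 8 * (8 * I0 / e) = I0 by [field; rewrite gt_eqF]; rewrite lerDr; lra.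
have Ax : 5 / 4 * A^-1 * x = e / 8 * x by rewrite /A; field; rewrite gt_eqF.
have e8 : 0 < e / 16 * x by rewrite mulr_gt0// divr_gt0.
have [_ /cvgrPdist_le/(_ _ e8) near1] := drift_free_cvg H c0 reF1_ge x.
have near2 : \forall q \near (0:R)^'+, 0 < q by exact: nbhs_right_gt.
have near3 : \forall q \near (0:R)^'+, 0 < q /\ `|drift_free 0 x - drift_free q x| <= e / 16 * x.
  by near=> q; split; near: q.
have hq2 q : 0 < q -> 0 <= drift_free q x + x * drift q <= 2 * (e / 8 * x + e / 8 * x).
  move=> q0; rewrite -(hq_decomposition H c0 reF1_ge)// hq_ge0//=.
  apply: (le_trans (hq_le H c0 reF1_ge rho_le x q0)).
  rewrite ler_pM2l// (le_trans (Rintegral_cos_reF_le A0 d0 x0 q0 hA))//.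
  by rewrite Ax lerD2l.
have [q1 [q10 hq1]] := filter_ex near3.
exists (drift q1).
suff : \forall q \near (0:R)^'+, ball (drift q1) e (drift q) by [].
apply: filterS near3 => q [q0 hq].
rewrite /ball/=.
have := hq2 q q0; have := hq2 q1 q10.
move: hq1 hq; rewrite !ler_norml => /andP[h1 h2] /andP[h3 h4] /andP[h5 h6] /andP[h7 h8].
have xe : 0 < e * x by rewrite mulr_gt0.
rewrite ltr_norml; apply/andP; split.
  by rewrite -(ltr_pM2l x0) mulrBr; lra.
by rewrite -(ltr_pM2l x0) mulrBr; lra.
Unshelve. all: by end_near. Qed.

End drift_limit.

(** * The limiting kernel *)

Section conclusion.
Context {R : realType}.
Notation mu := (@lebesgue_measure R).
Notation D := (`[0%R, +oo[%classic : set R).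
Variables (a b : R -> R) (rho : R -> R -> R).
Hypothesis H : resolvent_family a b rho.
Variable c : R.
Hypothesis c0 : 0 < c.
Hypothesis reF1_ge : forall l, 0 <= l -> c * trunc_sqr l <= 1 - reF a b 1 l.
Variable B : R.
Hypothesis drift_cvg : drift a b q @[q --> 0^'+] --> B.

Local Notation drift := (drift a b).
Local Notation drift_free := (drift_free a b).
Local Notation transform_gap := (transform_gap a b).
Local Notation hq := (h_ rho).

Definition potential_kernel (x : R) : R := drift_free 0 x + x * B.

(** The two errors, [transform_gap] and [drift q - B], have coefficients bounded
on bounded sets of [x]. *)
Lemma hq_near (M e : R) : 0 < e ->
  \forall q \near 0^'+, forall x, `|x| <= M -> `|potential_kernel x - hq q x| <= e.
Proof.
move=> e0; pose K := weight_bound M; pose M' := 1 + `|M|.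
have e2 : 0 < e / 2 by rewrite divr_gt0.
have h1 : K * transform_gap q @[q --> 0^'+] --> 0.
  rewrite -[X in _ --> X](mulr0 K); apply: cvgM; first exact: cvg_cst.
  exact: (transform_gap_cvg0 H c0 reF1_ge).
have h2 : M' * (drift q - B) @[q --> 0^'+] --> 0.
  rewrite -[X in _ --> X](mulr0 M'); apply: cvgM; first exact: cvg_cst.
  by rewrite -[X in _ --> X](subrr B); apply: cvgB => //; exact: cvg_cst.
move/cvgr0Pnorm_le : h1 => /(_ _ e2) h1.
move/cvgr0Pnorm_le : h2 => /(_ _ e2) h2.
near=> q => x xM.
have q0 : 0 < q by near: q; exact: nbhs_right_gt.
have g1 : `|K * transform_gap q| <= e / 2 by near: q.
have g2 : `|M' * (drift q - B)| <= e / 2 by near: q.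
rewrite (hq_decomposition H c0 reF1_ge)// /potential_kernel distrC.
have -> : drift_free q x + x * drift q - (drift_free 0 x + x * B) =
  (drift_free q x - drift_free 0 x) + x * (drift q - B) by ring.
apply: (le_trans (ler_normD _ _)).
have xMn : `|x| <= `|M| by rewrite (le_trans xM)// ler_norm.
have hK : weight_bound x <= K.
  have : `|x| ^+ 2 <= `|M| ^+ 2 by rewrite lerXn2r ?nnegrE.
  by rewrite !real_normK ?num_real// /K /weight_bound; lra.
have tg0 : 0 <= transform_gap q.
  rewrite mulr_ge0 ?invr_ge0 ?pi_ge0//; apply: Rintegral_ge0 => l _; exact: addr_ge0.
have : `|drift_free q x - drift_free 0 x| <= K * transform_gap q.
  by apply: (le_trans (drift_free_gap H c0 reF1_ge x q0)); rewrite ler_wpM2r.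
have : `|x * (drift q - B)| <= `|M' * (drift q - B)|.
  rewrite (normrM x) (normrM M') ler_wpM2r// (le_trans xMn)//.
  by rewrite /M' ger0_norm ?addr_ge0// lerDr.
by move: g1 => /(le_trans (ler_norm _)); lra.
Unshelve. all: by end_near. Qed.

Lemma hq_cvg x : hq q x @[q --> 0^'+] --> potential_kernel x.
Proof.
apply/cvgrPdist_le => e e0; have h := hq_near `|x| e0.
by near=> q; near: q; apply: filterS h => q; apply.
Unshelve. all: by end_near. Qed.

Lemma hq_cvg_compact : {family compact, hq q @[q --> 0^'+] --> potential_kernel}.
Proof.
apply/fam_cvgP => A cA P /uniform_nbhs[E [entE EP]].
have [M [_ AM]] := compact_bounded cA.
have {}AM y : A y -> `|y| <= M + 1 by apply: AM; rewrite ltrDl.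
move: entE; rewrite -entourage_ballE => -[e /= e0 eE].
have e2 : 0 < e / 2 by rewrite divr_gt0.
have := hq_near (M + 1) e2; apply: filterS => q hqe.
apply: EP => y Ay; apply: eE => /=.
by rewrite /ball/= (le_lt_trans (hqe y (AM y Ay)))// ltr_pdivrMr// ltr_pMr// ltr1n.
Qed.

Lemma continuous_potential_kernel : continuous potential_kernel.
Proof.
move=> x; apply/cvgrPdist_le => e e0.
have e3 : 0 < e / 3 by rewrite divr_gt0.
have near1 := hq_near (`|x| + 1) e3.
have near2 : \forall q \near (0:R)^'+, 0 < q /\
    forall y, `|y| <= `|x| + 1 -> `|potential_kernel y - hq q y| <= e / 3.
  by near=> q; split; near: q => //; exact: nbhs_right_gt.
have [q [q0 hq3]] := filter_ex near2.
have chq : {for x, continuous (hq q)}.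
  apply: cvgB; first exact: cvg_cst.
  apply: (cvg_comp (fun x => - x) (rho q)); last exact: (rf_continuous H).
  by apply: cvgN; exact: cvg_id.
move/cvgrPdist_le : chq => /(_ _ e3) near3.
have near4 : \forall y \near x, `|y - x| < 1.
  by apply/nbhs_ballP; exists 1 => //= y; rewrite /ball/= distrC.
near=> y.
have hy : `|hq q x - hq q y| <= e / 3 by near: y.
have y1 : `|y - x| < 1 by near: y.
have yx : `|y| <= `|x| + 1.
  have -> : y = x + (y - x) by ring.
  by apply: (le_trans (ler_normD _ _)); rewrite lerD2l ltW.
have gy := hq3 y yx; have gx := hq3 x.
have xx : `|x| <= `|x| + 1 by rewrite lerDl.
move: gy (gx xx) hy; rewrite !ler_norml => /andP[? ?] /andP[? ?] /andP[? ?].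
by apply/andP; split; lra.
Unshelve. all: by end_near. Qed.

Hypothesis rho_sub : forall q x y, 0 < q ->
  rho q 0 - rho q (- (x + y)) <= (rho q 0 - rho q (- x)) + (rho q 0 - rho q (- y)).

Lemma potential_kernel_subadditive x y :
  potential_kernel (x + y) <= potential_kernel x + potential_kernel y.
Proof.
have h : hq q x + hq q y @[q --> 0^'+] --> potential_kernel x + potential_kernel y.
  by apply: cvgD; exact: hq_cvg.
have hxy := @hq_cvg (x + y).
apply: (ler_cvg_to hxy h).
by near=> q; apply: rho_sub; near: q; exact: nbhs_right_gt.
Unshelve. all: by end_near. Qed.

End conclusion.

(** * Moments and the exponent near frequency zero *)

Section moments.
Context {R : realType} d (T : measurableType d) (P : probability T R).
Notation mu := (@lebesgue_measure R).
Notation D := (`[0%R, +oo[%classic : set R).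
Variables (Y : T -> R) (a b : R -> R).
Hypothesis mY : measurable_fun [set: T] Y.
Hypothesis a0 : forall l, 0 <= a l.
Hypothesis phiC : forall l, \int[P]_w cos (l * Y w) = expR (- a l) * cos (b l).
Hypothesis phiS : forall l, \int[P]_w sin (l * Y w) = - (expR (- a l) * sin (b l)).

Local Notation modulus l := (Num.sqrt (a l ^+ 2 + b l ^+ 2)).

Lemma measurable_cosY l : measurable_fun [set: T] (fun w => cos (l * Y w)).
Proof.
apply: measurableT_comp; last exact: measurable_funM.
by apply: continuous_measurable_fun; exact: continuous_cos.
Qed.

Lemma measurable_sinY l : measurable_fun [set: T] (fun w => sin (l * Y w)).
Proof.
apply: measurableT_comp; last exact: measurable_funM.
by apply: continuous_measurable_fun; exact: continuous_sin.
Qed.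

Lemma integrable_bounded (f : T -> R) (M : R) : measurable_fun [set: T] f ->
  (forall w, `|f w| <= M) -> P.-integrable [set: T] (EFin \o f).
Proof.
move=> mf fM; apply: measurable_bounded_integrable => //.
  by rewrite (le_lt_trans (probability_le1 _ _))// ltry.
by exists M; split; [exact: num_real|move=> k Mk w _ /=; rewrite (le_trans (fM w))// ltW].
Qed.

Lemma integrable_cosY l : P.-integrable [set: T] (EFin \o (fun w => cos (l * Y w))).
Proof.
apply: integrable_bounded; [exact: measurable_cosY|move=> w; exact: norm_cos_le1].
Qed.

Lemma integrable_sinY l : P.-integrable [set: T] (EFin \o (fun w => sin (l * Y w))).
Proof.
apply: integrable_bounded; [exact: measurable_sinY|move=> w; exact: norm_sin_le1].
Qed.

Lemma integrable_one : P.-integrable [set: T] (EFin \o (fun=> 1)).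
Proof. by apply: (integrable_bounded (M := 1)) => // w; rewrite normr1. Qed.

Lemma Rintegral_probability_cst (k : R) : \int[P]_w k = k.
Proof. by rewrite Rintegral_cst// [X in fine X]probability_setT mulr1. Qed.

Lemma Rintegral_one_sub_cosY l :
  \int[P]_w (1 - cos (l * Y w)) = 1 - expR (- a l) * cos (b l).
Proof.
rewrite RintegralB//; [|exact: integrable_one|exact: integrable_cosY].
  by rewrite Rintegral_probability_cst phiC.
Qed.

Lemma one_sub_cosY_le_modulus l : \int[P]_w (1 - cos (l * Y w)) <= modulus l.
Proof.
rewrite Rintegral_one_sub_cosY.
have h0 : 0 <= 1 - expR (- a l) * cos (b l).
  rewrite -Rintegral_one_sub_cosY; apply: Rintegral_ge0 => w _; exact: one_sub_cos_ge0.
rewrite -ler_sqr ?nnegrE ?sqrtr_ge0// sqr_sqrtr ?addr_ge0 ?sqr_ge0//.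
exact: sqr_one_sub_Re_expN_le.
Qed.

Lemma measurable_truncY (n : nat) :
  measurable_fun [set: T] (fun w => Y w ^+ 2 * \1_[set w | `|Y w| <= n.+1%:R] w).
Proof.
apply: measurable_funM; first exact: measurable_funX.
apply: measurable_indic.
rewrite (_ : [set w | _] = (fun w => `|Y w|) @^-1` `]-oo, n.+1%:R]); last first.
  by apply/seteqP; split => w /=; rewrite in_itv.
rewrite -[X in measurable X]setTI.
by apply: (measurableT_comp _ mY).
Qed.

Lemma truncY_ge0 (n : nat) w : 0 <= Y w ^+ 2 * \1_[set w | `|Y w| <= n.+1%:R] w.
Proof. by rewrite mulr_ge0 ?sqr_ge0// indicE. Qed.

Lemma integrable_truncY (n : nat) : P.-integrable [set: T]
  (EFin \o (fun w => Y w ^+ 2 * \1_[set w | `|Y w| <= n.+1%:R] w)).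
Proof.
apply: (integrable_bounded (M := n.+1%:R ^+ 2)); first exact: measurable_truncY.
move=> w; rewrite ger0_norm ?truncY_ge0// indicE.
case: (boolP (w \in _)) => [|_]; last by rewrite mulr0 exprn_ge0.
rewrite inE/= mulr1 -(real_normK (num_real (Y w))) => h.
by rewrite lerXn2r ?nnegrE.
Qed.

Lemma one_sub_cosY_ge (n : nat) (l : R) : 0 < l -> l * n.+1%:R <= 1 ->
  l ^+ 2 / 8 * \int[P]_w (Y w ^+ 2 * \1_[set w | `|Y w| <= n.+1%:R] w) <=
  \int[P]_w (1 - cos (l * Y w)).
Proof.
move=> l0 ln1; have iT := integrable_truncY n.
rewrite -RintegralZl//; apply: le_Rintegral => //.
- exact: integrable_mull.
- by apply: integrableB_EFin => //; [exact: integrable_one|exact: integrable_cosY].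
move=> w _; rewrite indicE.
case: (boolP (w \in _)) => [|_]; last by rewrite !mulr0 one_sub_cos_ge0.
rewrite inE/= mulr1 => h.
have -> : l ^+ 2 / 8 * Y w ^+ 2 = (l * Y w) ^+ 2 / 8 by ring.
apply: one_sub_cos_ge; rewrite normrM (gtr0_norm l0).
by apply: le_trans ln1; rewrite ler_pM2l.
Qed.

(** [|psi l|] is at least the mean of [1 - cos (l Y)], hence at least [l^2 / 8]
times the second moment of [Y] truncated at [1 / l], which tends to infinity. *)
Lemma infinite_variance_modulus : (\int[P]_w (Y w ^+ 2)%:E = +oo)%E ->
  forall A : R, 0 < A -> exists2 r : R, 0 < r &
     forall l, 0 < l -> l <= r -> A * l ^+ 2 <= modulus l.
Proof.
move=> VY A A0.
pose g (n : nat) (w : T) := (Y w ^+ 2 * \1_[set w | `|Y w| <= n.+1%:R] w)%:E.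
have e : (\int[P]_w (fun w => limn (g^~ w)) w = +oo)%E.
  rewrite -VY; apply: eq_integral => w _; apply/cvg_lim => //; apply: cvg_near_cst.
  near=> n; rewrite /g indicE mem_set ?mulr1//=.
  apply: (@le_trans _ _ n%:R); last by rewrite ler_nat.
  by apply: ltW; near: n; exact: nbhs_infty_gtr.
have h : (\int[P]_w g n w)%E @[n --> \oo] --> +oo%E.
  rewrite -e; apply: cvg_monotone_convergence => //.
  - by move=> n; apply/measurable_EFinP; exact: measurable_truncY.
  - by move=> n w _; rewrite lee_fin truncY_ge0.
  - move=> w _ n m nm; rewrite lee_fin ler_wpM2l ?sqr_ge0// !indicE ler_nat.
    case: (boolP (w \in [set w | `|Y w| <= n.+1%:R])) => //; rewrite inE/= => hn.
    by rewrite mem_set//= (le_trans hn)// ler_nat.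
move/cvgeyPge : h => /(_ (8 * A)) h.
have [n hn] := filter_ex h.
exists n.+1%:R^-1; first by rewrite invr_gt0.
move=> l l0 ln; apply: le_trans (one_sub_cosY_le_modulus l).
have ln1 : l * n.+1%:R <= 1 by rewrite -ler_pdivlMr// mul1r.
apply: le_trans (one_sub_cosY_ge l0 ln1).
have : 8 * A <= \int[P]_w (Y w ^+ 2 * \1_[set w | `|Y w| <= n.+1%:R] w).
  rewrite -lee_fin (le_trans hn)// /Rintegral fineK//.
  by apply: integrable_fin_num => //; exact: integrable_truncY.
have : 0 <= l ^+ 2 by exact: sqr_ge0.
move: (l ^+ 2) (\int[P]_w _) => L I L0 hI.
have := ler_wpM2l L0 hI; lra.
Unshelve. all: by end_near. Qed.

Section finite_variance.
Hypothesis iY2 : P.-integrable [set: T] (EFin \o (fun w => Y w ^+ 2)).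

Let m2 := \int[P]_w (Y w ^+ 2).

Lemma m2_ge0 : 0 <= m2.
Proof. by apply: Rintegral_ge0 => w _; exact: sqr_ge0. Qed.

Lemma integrable_Y : P.-integrable [set: T] (EFin \o Y).
Proof.
have i1 : P.-integrable [set: T] (EFin \o (fun w => 1 + Y w ^+ 2)).
  by apply: integrableD_EFin => //; exact: integrable_one.
apply: (@integrable_scale_le R _ _ P [set: T] _ (fun w => 1 + Y w ^+ 2) 1) => //.
move=> w _; rewrite mul1r [`|1 + _|]ger0_norm ?addr_ge0 ?sqr_ge0//.
rewrite -(real_normK (num_real (Y w))); have := normr_ge0 (Y w).
by move: `|Y w| => y y0; have := sqr_ge0 (y - 1); rewrite sqrrB mulr1 expr1n; lra.
Qed.

Let mean := \int[P]_w Y w.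

Lemma sinY_mean l : `|\int[P]_w sin (l * Y w) - l * mean| <= 2 * l ^+ 2 * m2.
Proof.
have iY := integrable_Y.
rewrite /mean -RintegralZl// -RintegralB//; last 2 first.
- exact: integrable_sinY.
- exact: integrable_mull.
apply: (le_trans (Rintegral_le_scale (g := fun w => Y w ^+ 2) (c := 2 * l ^+ 2) _ _ iY2 _)) => //.
- by apply: measurable_funB; [exact: measurable_sinY|exact: measurable_funM].
- move=> w _; rewrite (ger0_norm (sqr_ge0 (Y w))).
  by rewrite (le_trans (norm_sin_sub_id_le_sqr _))// exprMn mulrA.
- by under eq_Rintegral do rewrite ger0_norm ?sqr_ge0//.
Qed.

Lemma Im_modulus_ge l : `|\int[P]_w sin (l * Y w)| <= modulus l.
Proof.
rewrite phiS normrN (le_trans (norm_Im_expN_le _ (a0 l)))//.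
rewrite -ler_sqr ?nnegrE ?sqrtr_ge0// sqr_sqrtr ?addr_ge0 ?sqr_ge0//.
by rewrite real_normK ?num_real// lerDr sqr_ge0.
Qed.

(** [|psi l|] is at least the modulus of the mean of [sin (l Y)], which differs
from [l] times the mean of [Y] by [O(l^2)]. *)
Lemma nonzero_mean_modulus : mean != 0 -> exists2 r : R, 0 < r &
  forall l, 0 < l -> l <= r -> `|mean| / 2 * l <= modulus l.
Proof.
move=> mu0; have amu : 0 < `|mean| by rewrite normr_gt0.
have m20 := m2_ge0.
exists (`|mean| / (4 * (1 + m2))); first by rewrite divr_gt0// mulr_gt0// ltr_pwDl.
move=> l l0 lr; apply: le_trans (Im_modulus_ge l).
have := sinY_mean l; rewrite distrC => h.
have : `|l * mean| - `|\int[P]_w sin (l * Y w)| <= 2 * l ^+ 2 * m2.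
  by apply: le_trans h; exact: lerB_dist.
rewrite normrM (gtr0_norm l0).
have : l * (4 * (1 + m2)) <= `|mean| by rewrite -ler_pdivlMr// mulr_gt0// ltr_pwDl.
move=> h1; have : l * (l * (4 * (1 + m2))) <= l * `|mean| by rewrite ler_pM2l.
have : 0 <= l ^+ 2 by exact: sqr_ge0.
nra.
Qed.

Lemma Re_exponent_le l : a l <= l ^+ 2 / 2 * m2 + a l ^+ 2.
Proof.
apply: (le_trans (Re_le_one_sub_Re_expN (b l) (a0 l))); rewrite lerD2r.
rewrite -Rintegral_one_sub_cosY; apply: (le_trans (ler_norm _)).
apply: (le_trans (Rintegral_le_scale (g := fun w => Y w ^+ 2) (c := l ^+ 2 / 2) _ _ iY2 _)) => //.
- by apply: measurable_funB => //; exact: measurable_cosY.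
- move=> w _; rewrite (ger0_norm (one_sub_cos_ge0 _)) (ger0_norm (sqr_ge0 (Y w))).
  by rewrite (le_trans (one_sub_cos_le _))// exprMn; lra.
- by under eq_Rintegral do rewrite ger0_norm ?sqr_ge0//.
Qed.

(** A smoothed form of the third moment truncated at [1 / l]; it may blow up as
[l -> 0], but by [cauchy_cubicE] its integral over [l >= 0] is a multiple of the
second moment. *)
Definition cubic_moment (l : R) : R := \int[P]_w (`|Y w| ^+ 3 / (1 + (l * Y w) ^+ 2)).

Lemma cauchy_cubicE (y : R) :
  (\int[mu]_(l in `[0%R, +oo[) (`|y| ^+ 3 / (1 + (l * y) ^+ 2))%:E =
   (y ^+ 2 * (pi / 2))%:E)%E.
Proof.
have [->|y0] := eqVneq y 0.
  rewrite expr0n/= mul0r -[RHS](@integral0 _ _ R mu D).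
  by apply: eq_integral => l _; rewrite normr0 expr0n/= mul0r.
have z0 : 0 < `|y| by rewrite normr_gt0.
have zi0 : 0 < `|y|^-1 by rewrite invr_gt0.
rewrite EFinM -(integral_cauchy_halfline zi0) -ge0_integralZl_EFin//.
- apply: eq_integral => l _; rewrite -EFinM; congr EFin.
  rewrite exprMn -(real_normK (num_real y)); move: `|y| z0 {zi0} => z z0.
  have N1 : 0 < 1 + (l * z) ^+ 2 by rewrite ltr_pwDl ?sqr_ge0.
  by field; rewrite (gt_eqF z0) (gt_eqF N1).
- by move=> l _; rewrite lee_fin divr_ge0 ?addr_ge0 ?sqr_ge0// ltW.
- exact: (measurable_int mu (integrable_cauchy zi0)).
- exact: sqr_ge0.
Qed.

Lemma measurable_cubic :
  measurable_fun [set: T * measurableTypeR R]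
    (fun w => `|Y w.1| ^+ 3 / (1 + (w.2 * Y w.1) ^+ 2)).
Proof.
have m1 : measurable_fun [set: T * measurableTypeR R] (fun w => Y w.1).
  exact: (measurableT_comp mY measurable_fst).
apply: measurable_funM.
  by apply: measurable_funX; exact: measurableT_comp.
apply: measurable_inv; last by move=> w; rewrite ltr_pwDl ?sqr_ge0.
apply: measurable_funD => //; apply: measurable_funX.
by apply: measurable_funM => //; exact: measurable_snd.
Qed.

Lemma cubic_ge0 l w : 0 <= `|Y w| ^+ 3 / (1 + (l * Y w) ^+ 2).
Proof. by rewrite divr_ge0 ?exprn_ge0 ?addr_ge0 ?sqr_ge0. Qed.

(** Integrating in [l] first leaves [pi / 2] times the second moment. *)
Lemma integrable_cubic_moment : mu.-integrable D (EFin \o cubic_moment).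
Proof.
pose F (l : R) := (\int[P]_w (`|Y w| ^+ 3 / (1 + (l * Y w) ^+ 2))%:E)%E.
have mF : measurable_fun [set: measurableTypeR R] F.
  apply: (measurable_fun_fubini_tonelli_G
    (fun w : T * measurableTypeR R => (`|Y w.1| ^+ 3 / (1 + (w.2 * Y w.1) ^+ 2))%:E)).
    by apply/measurable_EFinP; exact: measurable_cubic.
  by move=> w; rewrite lee_fin cubic_ge0.
have F0 l : (0 <= F l)%E by apply: integral_ge0 => w _; rewrite lee_fin cubic_ge0.
apply/integrableP; split.
  apply: measurable_funTS; apply/measurable_EFinP.
  by apply: (measurableT_comp (@fine_measurable R setT measurableT)).
apply: (@le_lt_trans _ _ (\int[mu]_(l in D) F l)%E).
  apply: ge0_le_integral => //.
  - apply: measurableT_comp => //; apply: measurable_funTS; apply/measurable_EFinP.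
    by apply: (measurableT_comp (@fine_measurable R setT measurableT)).
  - exact: measurable_funTS.
  - move=> l _; rewrite /= ger0_norm; last by apply: Rintegral_ge0 => w _; exact: cubic_ge0.
    rewrite /cubic_moment /Rintegral -/(F l); by case: (F l) (F0 l).
rewrite integral_mkcond.
have -> : (\int[mu]_x (F \_ D) x =
  \int[mu]_l \int[P]_w (`|Y w| ^+ 3 / (1 + (l * Y w) ^+ 2) * \1_D l)%:E)%E.
  apply: eq_integral => l _; rewrite patchE indicE; case: ifP => lD.
    by under [RHS]eq_integral do rewrite mulr1.
  by under [RHS]eq_integral do rewrite mulr0; rewrite integral0.
rewrite -(@fubini_tonelli _ _ T (measurableTypeR R) R P mu (fun w : T * measurableTypeR R =>
  (`|Y w.1| ^+ 3 / (1 + (w.2 * Y w.1) ^+ 2) * \1_D w.2)%:E))/=; first last.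
- by move=> w; rewrite lee_fin mulr_ge0 ?cubic_ge0// indicE.
- apply/measurable_EFinP; apply: measurable_funM; first exact: measurable_cubic.
  by apply: (measurableT_comp _ measurable_snd); apply: measurable_indic.
have -> : (\int[P]_x \int[mu]_y (`|Y x| ^+ 3 / (1 + (y * Y x) ^+ 2) * \1_D y)%:E =
  \int[P]_w (Y w ^+ 2 * (pi / 2))%:E)%E.
  apply: eq_integral => w _; rewrite -cauchy_cubicE [RHS]integral_mkcond.
  apply: eq_integral => l _; rewrite patchE indicE; case: ifP => lD.
    by rewrite mulr1.
  by rewrite mulr0.
apply: integrable_lty => //.
have := integrable_mull (pi / 2) measurableT iY2.
by apply: eq_integrable => // w _ /=; rewrite mulrC.
Qed.

(** When the mean is 0, the mean of [sin (l Y)] is that of [sin (l Y) - l Y],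
which is cubic in [l Y] as long as [l Y] is bounded. *)
Lemma Im_exponent_le l : mean = 0 -> 0 < l ->
  `|b l| <= 4 * l ^+ 3 * cubic_moment l + 3 * (a l ^+ 2 + b l ^+ 2).
Proof.
move=> mean0 l0; apply: (le_trans (norm_Im_sub_le (b l) (a0 l))); rewrite lerD2r.
have N1 w : 0 < 1 + (l * Y w) ^+ 2 by rewrite ltr_pwDl ?sqr_ge0.
have q0 w : 0 <= `|Y w| ^+ 3 / (1 + (l * Y w) ^+ 2) by rewrite divr_ge0 ?exprn_ge0// ltW.
have mq : measurable_fun [set: T] (fun w => `|Y w| ^+ 3 / (1 + (l * Y w) ^+ 2)).
  apply: measurable_funM; first by apply: measurable_funX; exact: measurableT_comp.
  apply: measurable_inv => //; apply: measurable_funD => //; apply: measurable_funX.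
  exact: measurable_funM.
have iq : P.-integrable [set: T] (EFin \o (fun w => `|Y w| ^+ 3 / (1 + (l * Y w) ^+ 2))).
  apply: (@integrable_scale_le R _ _ P [set: T] _ Y (l ^+ 2)^-1) => //; first exact: integrable_Y.
  move=> w _; rewrite (ger0_norm (q0 w)) ler_pdivrMr//.
  have -> : (l ^+ 2)^-1 * `|Y w| * (1 + (l * Y w) ^+ 2) =
    (l ^+ 2)^-1 * `|Y w| + `|Y w| * Y w ^+ 2 by field; rewrite gt_eqF.
  rewrite -[in leRHS](real_normK (num_real (Y w))) [leLHS]exprS lerDr mulr_ge0// invr_ge0 sqr_ge0//.
have -> : `|expR (- a l) * sin (b l)| = `|\int[P]_w (sin (l * Y w) - l * Y w)|.
  rewrite RintegralB//; [|exact: integrable_sinY|exact/integrable_mull/integrable_Y].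
  by rewrite RintegralZl//; [rewrite -/mean mean0 mulr0 subr0 phiS normrN|exact: integrable_Y].
apply: (le_trans (Rintegral_le_scale (c := 4 * l ^+ 3) _ _ iq _)) => //.
- by apply: measurable_funB; [exact: measurable_sinY|exact: measurable_funM].
- move=> w _; rewrite (ger0_norm (q0 w)) (le_trans (norm_sin_sub_id_le _))//.
  by rewrite normrM exprMn (gtr0_norm l0) !mulrA.
- by under eq_Rintegral do rewrite ger0_norm//.
Qed.

End finite_variance.
End moments.

(** * Convergence of the drift when the variance is finite *)

Section finite_variance_limit.
Context {R : realType} d (T : measurableType d) (P : probability T R).
Notation mu := (@lebesgue_measure R).
Notation D := (`[0%R, +oo[%classic : set R).
Variables (a b : R -> R) (rho : R -> R -> R).
Hypothesis H : resolvent_family a b rho.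
Variable c : R.
Hypothesis c0 : 0 < c.
Hypothesis reF1_ge : forall l, 0 <= l -> c * trunc_sqr l <= 1 - reF a b 1 l.
Variables (Y : T -> R).
Hypothesis mY : measurable_fun [set: T] Y.
Hypothesis phiC : forall l, \int[P]_w cos (l * Y w) = expR (- a l) * cos (b l).
Hypothesis phiS : forall l, \int[P]_w sin (l * Y w) = - (expR (- a l) * sin (b l)).
Hypothesis iY2 : P.-integrable [set: T] (EFin \o (fun w => Y w ^+ 2)).

Local Notation reF := (reF a b).
Local Notation imF := (imF a b).
Local Notation absF := (absF a b).
Local Notation sqmod := (sqmod a b).
Local Notation drift := (drift a b).
Local Notation drift_free := (drift_free a b).
Local Notation cubic := (cubic_moment P Y).

Let a0 l : 0 <= a l := rf_re_ge0 H l.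

Lemma sqmod0E l : sqmod 0 l = a l ^+ 2 + b l ^+ 2.
Proof. by rewrite /sqmod add0r. Qed.

Lemma cubic_moment_ge0 l : 0 <= cubic l.
Proof. by apply: Rintegral_ge0 => w _; rewrite divr_ge0 ?exprn_ge0 ?addr_ge0 ?sqr_ge0. Qed.

(** Near 0, [|sin l * imF q l| <= l |b| / |psi|^2]; the cubic part of the bound
on [b] is absorbed by [|psi|^2 >= c^2 l^4], and its quadratic part by [|psi|^2]
itself.  Beyond 1 the domination by [|F 1|] is used, and the Cauchy kernel of
width 1 stands for a constant on [0, 1]. *)
Lemma drift_integrand_le q l : \int[P]_w Y w = 0 -> 0 <= q -> 0 <= l ->
  `|sin l * imF q l| <= 4 * (c ^+ 2)^-1 * cubic l + c^-1 * absF 1 l +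
    6 * (1 / (1 ^+ 2 + l ^+ 2)).
Proof.
move=> mean0 q0.
have G0 := cubic_moment_ge0 l; have F0 := absF_ge0 a b 1 l.
have K0 : 0 <= 6 * (1 / (1 ^+ 2 + l ^+ 2)).
  by rewrite mulr_ge0// divr_ge0// addr_ge0// sqr_ge0.
have K1 : 0 <= 4 * (c ^+ 2)^-1 * cubic l by rewrite !mulr_ge0 ?invr_ge0 ?sqr_ge0.
have K2 : 0 <= c^-1 * absF 1 l by rewrite mulr_ge0// invr_ge0 ltW.
rewrite le_eqVlt => /predU1P[l0|l0].
  by rewrite -{1}l0 sin0 mul0r normr0 !addr_ge0.
have [l1|l1] := leP 1 l.
  have := absF_dominated H c0 reF1_ge q0 (ltW l0).
  rewrite /trunc_sqr min_l ?expr_ge1 ?(ltW l0)// => h.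
  apply: (@le_trans _ _ (c^-1 * absF 1 l)); last by lra.
  apply: le_trans h; rewrite mul1r; apply: le_trans (norm_imF_le_gt0 H c0 reF1_ge q0 l0).
  by rewrite (normrM (sin l)) ler_piMl// norm_sin_le1.
have n0 := sqmod0_gt0 H c0 reF1_ge l0.
have nq : 0 < sqmod q l by rewrite (lt_le_trans n0)// (sqmod_le H).
have hb := Im_exponent_le mY a0 phiS iY2 mean0 l0.
have hm : c * l ^+ 2 <= Num.sqrt (sqmod 0 l).
  have := trunc_sqr_le_modulus H c0 reF1_ge (ltW l0).
  by rewrite /trunc_sqr min_r// expr_le1 ?(ltW l0)// ltW.
have hm2 : c ^+ 2 * l ^+ 4 <= sqmod 0 l.
  have -> : c ^+ 2 * l ^+ 4 = (c * l ^+ 2) ^+ 2 by ring.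
  rewrite -(sqr_sqrtr (ltW n0)).
  by rewrite lerXn2r ?nnegrE ?sqrtr_ge0// mulr_ge0 ?sqr_ge0// ltW.
have h1 : `|sin l * imF q l| <= l * (`|b l| / sqmod 0 l).
  rewrite (normrM (sin l)); apply: ler_pM => //.
    by rewrite (le_trans (norm_sin_le l))// gtr0_norm.
  rewrite /imF normrM normrN normfV (gtr0_norm nq) ler_wpM2l//.
  by rewrite lef_pV2 ?posrE// (sqmod_le H).
apply: (le_trans h1).
have h2 : l * (`|b l| / sqmod 0 l) <= 4 * (c ^+ 2)^-1 * cubic l + 3.
  rewrite mulrA ler_pdivrMr//.
  have c2 : 0 < c ^+ 2 by rewrite exprn_gt0.
  have e1 : l * `|b l| <= 4 * l ^+ 4 * cubic l + 3 * l * sqmod 0 l.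
    rewrite sqmod0E; have := ler_wpM2l (ltW l0) hb.
    have -> : l * (4 * l ^+ 3 * cubic l + 3 * (a l ^+ 2 + b l ^+ 2)) =
      4 * l ^+ 4 * cubic l + 3 * l * (a l ^+ 2 + b l ^+ 2) by ring.
    by [].
  apply: (le_trans e1); rewrite [leRHS]mulrDl; apply: lerD.
    have : l ^+ 4 <= (c ^+ 2)^-1 * sqmod 0 l by rewrite mulrC ler_pdivlMr// mulrC.
    move/(ler_wpM2r G0) => e2.
    have -> : 4 * (c ^+ 2)^-1 * cubic l * sqmod 0 l = 4 * ((c ^+ 2)^-1 * sqmod 0 l * cubic l) by ring.
    by rewrite -mulrA ler_wpM2l.
  by rewrite ler_wpM2r ?(ltW n0)//; lra.
have h3 : 3 <= 6 * (1 / (1 ^+ 2 + l ^+ 2)).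
  rewrite mulrA mulr1 expr1n ler_pdivlMr; last by rewrite ltr_pwDl ?sqr_ge0.
  have : l ^+ 2 <= 1 by rewrite expr_le1 ?(ltW l0)// ltW.
  lra.
lra.
Qed.

(** Dominated convergence, with the bound of [drift_integrand_le]. *)
Lemma drift_cvg_finite_variance : \int[P]_w Y w = 0 ->
  mu.-integrable D (EFin \o (fun l => sin l * imF 0 l)) /\
  drift q @[q --> 0^'+] --> drift 0.
Proof.
move=> mean0.
have [h1 h2] : mu.-integrable D (EFin \o (fun l => sin l * imF 0 l)) /\
  \int[mu]_(l in D) (sin l * imF q l) @[q --> 0^'+] --> \int[mu]_(l in D) (sin l * imF 0 l).
  apply: (@Rintegral_dominated_cvg_at_right R _ _ mu D _ _
    (fun l => 4 * (c ^+ 2)^-1 * cubic l + c^-1 * absF 1 l + 6 * (1 / (1 ^+ 2 + l ^+ 2)))) => //.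
  - move=> q q0; apply: measurable_funM; first exact: measurable_sin1.
    by apply: measurable_funTS; exact: (measurable_imF H).
  - move=> l; rewrite /= in_itv/= andbT le_eqVlt => /predU1P[<-|l0].
      by under eq_fun do rewrite sin0 mul0r; rewrite sin0 mul0r; exact: cvg_cst.
    by apply: cvgM; [exact: cvg_cst|exact: (cvg_imF0 H c0 reF1_ge)].
  - apply: integrableD_EFin => //.
      apply: integrableD_EFin => //; apply: integrable_mull => //.
        exact: (integrable_cubic_moment mY iY2).
      exact: (rf_absF H).
    by apply: integrable_mull => //; exact: integrable_cauchy.
  - move=> q l q0; rewrite /= in_itv/= andbT => l0.
    by apply: drift_integrand_le => //; exact: ltW.
by split => //; apply: cvgM => //; exact: cvg_cst.
Qed.

(** When [sin l * imF 0 l] is integrable, the term [x * sin l] that was split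
off can be put back under the integral. *)
Lemma potential_kernel_drift0 x :
  mu.-integrable D (EFin \o (fun l => sin l * imF 0 l)) ->
  mu.-integrable D (EFin \o (fun l => (1 - cos (l * x)) * reF 0 l + sin (l * x) * imF 0 l)) /\
  potential_kernel a b (drift 0) x =
  pi^-1 * \int[mu]_(l in `[0%R, +oo[) ((1 - cos (l * x)) * reF 0 l + sin (l * x) * imF 0 l).
Proof.
move=> isin; have [idf _] := drift_free_cvg H c0 reF1_ge x.
have e l : (1 - cos (l * x)) * reF 0 l + sin (l * x) * imF 0 l =
  ((1 - cos (l * x)) * reF 0 l + (sin (l * x) - x * sin l) * imF 0 l) +
  x * (sin l * imF 0 l) by ring.
split.
  rewrite (funext e).
  by apply: integrableD_EFin => //; exact: (integrable_mull _ _ isin).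
under eq_Rintegral do rewrite e.
rewrite RintegralD//; last exact: (integrable_mull _ _ isin).
by rewrite RintegralZl// /potential_kernel /drift_free /drift; ring.
Qed.

(** [rho q 0] is [1 / pi] times the integral of [Re (F q) = (q + a) / |q + psi|^2].
Near 0, [|psi| >= c1 l] bounds [q / |q + psi|^2] by a Cauchy kernel, whose
integral does not depend on its width, and [a = O(l^2)] up to [|psi|^2] keeps
[a / |q + psi|^2] bounded.  Beyond [r] the domination by [|F 1|] is used. *)
Lemma rho0_bounded : \int[P]_w Y w != 0 ->
  exists K : R, forall q, 0 < q -> rho q 0 <= K.
Proof.
move=> mean0; have [r r0 hr] := nonzero_mean_modulus mY a0 phiS iY2 mean0.
set c1 := `|_| / 2 in hr.
have c10 : 0 < c1 by rewrite divr_gt0// normr_gt0.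
pose m2 := \int[P]_w (Y w ^+ 2).
have m20 : 0 <= m2 by apply: Rintegral_ge0 => w _; exact: sqr_ge0.
(* [K1] bounds [a / |psi|^2]: [a <= l^2 / 2 * m2 + a^2], where
   [l <= |psi| / c1] and [a <= |psi|]. *)
pose K1 := m2 / (2 * c1 ^+ 2) + 1.
have K10 : 0 <= K1 by rewrite addr_ge0// divr_ge0// mulr_ge0// sqr_ge0.
pose k := c1^-1.
have k0 : 0 < k by rewrite invr_gt0.
have point q l : 0 < q -> 0 < l -> reF q l <=
    2 * k * (q * k / ((q * k) ^+ 2 + l ^+ 2)) +
    K1 * (1 + r ^+ 2) * (1 / (1 ^+ 2 + l ^+ 2)) + (c * trunc_sqr r)^-1 * absF 1 l.
  move=> q0 l0; have qk : 0 < q * k by rewrite mulr_gt0.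
  have P1 : 0 <= 2 * k * (q * k / ((q * k) ^+ 2 + l ^+ 2)).
    by rewrite mulr_ge0 ?divr_ge0 ?addr_ge0 ?sqr_ge0 ?mulr_ge0// ltW.
  have P2 : 0 <= K1 * (1 + r ^+ 2) * (1 / (1 ^+ 2 + l ^+ 2)).
    apply: mulr_ge0; first by apply: mulr_ge0 => //; rewrite addr_ge0 ?sqr_ge0.
    by rewrite divr_ge0// addr_ge0 ?sqr_ge0.
  have P3 : 0 <= (c * trunc_sqr r)^-1 * absF 1 l.
    by rewrite mulr_ge0 ?absF_ge0// invr_ge0 mulr_ge0 ?trunc_sqr_ge0// ltW.
  have [lr|rl] := leP l r; last first.
    apply: (@le_trans _ _ ((c * trunc_sqr r)^-1 * absF 1 l)); last by rewrite lerDr addr_ge0.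
    apply: (le_trans (ler_norm _)); apply: (le_trans (norm_reF_le H l q0)).
    exact: (absF_le_far H c0 reF1_ge (ltW q0) r0 (ltW rl)).
  rewrite -[leLHS]addr0; apply: lerD => //.
  have n0 := sqmod0_gt0 H c0 reF1_ge l0.
  have nq := sqmod_gt0 H l q0.
  have nle := sqmod_le H l (ltW q0).
  have hn : c1 ^+ 2 * l ^+ 2 <= sqmod 0 l.
    rewrite -exprMn -(sqr_sqrtr (ltW n0)) lerXn2r ?nnegrE ?sqrtr_ge0//.
      by rewrite mulr_ge0// ltW.
    by rewrite sqmod0E; exact: hr.
  have l2 : 0 < l ^+ 2 by rewrite exprn_gt0.
  have c2 : 0 < c1 ^+ 2 by rewrite exprn_gt0.
  rewrite /reF mulrDl; apply: lerD.
    have -> : 2 * k * (q * k / ((q * k) ^+ 2 + l ^+ 2)) = 2 * q / (q ^+ 2 + c1 ^+ 2 * l ^+ 2).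
      have N1 : 0 < q ^+ 2 + c1 ^+ 2 * l ^+ 2 by rewrite ltr_pwDl ?exprn_gt0// mulr_ge0// ltW.
      have N2 : 0 < q ^+ 2 + (c1 * l) ^+ 2 by rewrite exprMn.
      by rewrite /k; field; rewrite (gt_eqF c10) (gt_eqF N2).
    rewrite ler_pdivrMr// mulrAC ler_pdivlMr; last first.
      by rewrite ltr_pwDl ?exprn_gt0// mulr_ge0// ltW.
    have := sqmod_ge H l q0.
    have : c1 ^+ 2 * l ^+ 2 <= sqmod q l by apply: le_trans nle.
    move: (c1 ^+ 2 * l ^+ 2) (sqmod q l) => u v; nra.
  apply: (@le_trans _ _ K1); last first.
    have -> : K1 * (1 + r ^+ 2) * (1 / (1 ^+ 2 + l ^+ 2)) = K1 * ((1 + r ^+ 2) / (1 + l ^+ 2)).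
      by rewrite expr1n mul1r mulrA.
    rewrite ler_peMr// ler_pdivlMr ?mul1r; last by rewrite ltr_pwDl ?sqr_ge0.
    by rewrite lerD2l lerXn2r ?nnegrE// ltW.
  rewrite ler_pdivrMr//; apply: (@le_trans _ _ (K1 * sqmod 0 l)); last by rewrite ler_wpM2l.
  apply: (le_trans (Re_exponent_le mY a0 phiC iY2 l)); rewrite -/m2 /K1 mulrDl mul1r.
  apply: lerD; last by rewrite sqmod0E lerDl sqr_ge0.
  have -> : l ^+ 2 / 2 * m2 = m2 / (2 * c1 ^+ 2) * (c1 ^+ 2 * l ^+ 2).
    by field; rewrite gt_eqF.
  by rewrite ler_wpM2l// divr_ge0// mulr_ge0// ltW.
exists (pi^-1 * (2 * k * (pi / 2) + K1 * (1 + r ^+ 2) * (pi / 2) +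
  (c * trunc_sqr r)^-1 * \int[mu]_(l in `[0%R, +oo[) absF 1 l)) => q q0.
have qk : 0 < q * k by rewrite mulr_gt0.
rewrite -[in leLHS]oppr0 (resolvent_density_fourier H)// /fourier.
rewrite ler_wpM2l ?invr_ge0 ?pi_ge0//.
pose g l := 2 * k * (q * k / ((q * k) ^+ 2 + l ^+ 2)) +
    K1 * (1 + r ^+ 2) * (1 / (1 ^+ 2 + l ^+ 2)) + (c * trunc_sqr r)^-1 * absF 1 l.
have i1 : mu.-integrable D (EFin \o (fun l => 2 * k * (q * k / ((q * k) ^+ 2 + l ^+ 2)))).
  by apply: integrable_mull => //; exact: integrable_cauchy.
have i2 : mu.-integrable D (EFin \o (fun l => K1 * (1 + r ^+ 2) * (1 / (1 ^+ 2 + l ^+ 2)))).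
  by apply: integrable_mull => //; exact: integrable_cauchy.
have i3 : mu.-integrable D (EFin \o (fun l => (c * trunc_sqr r)^-1 * absF 1 l)).
  by apply: integrable_mull => //; exact: (rf_absF H).
have i12 := @integrableD_EFin R _ _ mu D _ _ (measurable_itv _) i1 i2.
have ig : mu.-integrable D (EFin \o g) by exact: integrableD_EFin.
have -> : 2 * k * (pi / 2) + K1 * (1 + r ^+ 2) * (pi / 2) +
    (c * trunc_sqr r)^-1 * \int[mu]_(l in `[0%R, +oo[) absF 1 l = \int[mu]_(l in `[0%R, +oo[) g l.
  rewrite RintegralD// RintegralD//; congr (_ + _ + _); rewrite RintegralZl//.
  - by rewrite Rintegral_cauchy.
  - exact: integrable_cauchy.
  - by rewrite Rintegral_cauchy.
  - exact: integrable_cauchy.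
  - exact: (rf_absF H).
have ir := integrable_fourier_integrand (integrable_reF H q0) (integrable_imF H q0) 0.
(* The frequency 0 is left out, since the pointwise bound holds for [l > 0]. *)
have sub : `]0, +oo[ `<=` (D : set R) by apply: subset_itvr; rewrite bnd_simp.
rewrite -Rintegral_itv_obnd_cbnd; last exact: integrableS ir.
rewrite -[leRHS]Rintegral_itv_obnd_cbnd; last exact: integrableS ig.
apply: le_Rintegral => //.
- exact: integrableS ir.
- exact: integrableS ig.
- move=> l; rewrite /= in_itv/= andbT => l0.
  by rewrite mulr0 cos0 sin0 mulr1 mulr0 subr0; exact: point.
Qed.

End finite_variance_limit.

(** * The resolvent family of a Lévy process *)

Section joint_measurability.
Context {R : realType} d (T : measurableType d).
Variable X : R -> T -> R.
Hypothesis mX : forall t, 0 <= t -> measurable_fun [set: T] (X t).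
Hypothesis rcX : forall w t, 0 <= t -> X s w @[s --> t^'+] --> X t w.

(** The first point of the grid of step [1 / n.+1] strictly after [|t|]. *)
Definition grid_after (n : nat) (t : R) : R := (Num.truncn (n.+1%:R * `|t|)).+1%:R / n.+1%:R.

Lemma grid_after_gt n t : `|t| < grid_after n t.
Proof. by rewrite ltr_pdivlMr// mulrC truncnS_gt. Qed.

Lemma grid_after_le n t : grid_after n t <= `|t| + n.+1%:R^-1.
Proof.
rewrite ler_pdivrMr// mulrDl mulVf// -natr1 lerD2r [leRHS]mulrC.
by have /andP[] := truncn_itv (mulr_ge0 (ler0n R n.+1) (normr_ge0 t)).
Qed.

Lemma grid_after_cvg t : grid_after n t @[n --> \oo] --> `|t|.
Proof.
apply: (@squeeze_cvgr _ _ _ _ (cst `|t|) (fun n => `|t| + n.+1%:R^-1)).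
- by near=> n; rewrite grid_after_le ltW// grid_after_gt.
- exact: cvg_cst.
- rewrite -[X in _ --> X]addr0; apply: cvgD; [exact: cvg_cst|exact: cvg_harmonic].
Unshelve. all: by end_near. Qed.

Lemma measurable_sampled n :
  measurable_fun [set: T * measurableTypeR R] (fun w => X (grid_after n w.2) w.1).
Proof.
move=> _ B mB; rewrite setTI.
rewrite (_ : _ @^-1` _ = \bigcup_k ((X (k.+1%:R / n.+1%:R) @^-1` B) `*`
    [set t : measurableTypeR R | Num.truncn (n.+1%:R * `|t|) = k])).
  apply: bigcupT_measurable => k; apply: measurableX.
    by rewrite -[X in measurable X]setTI; apply: mX => //; rewrite divr_ge0.
  rewrite (_ : [set t | _] = (fun t : R => n.+1%:R * `|t|) @^-1` `[k%:R, k.+1%:R[).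
    rewrite -[X in measurable X]setTI.
    have : measurable_fun [set: R] (fun t : R => n.+1%:R * `|t|).
      by apply: measurable_funM => //; exact: measurableT_comp.
    by apply.
  apply/seteqP; split => t /=; rewrite in_itv/= => h.
    by rewrite -h truncn_itv// mulr_ge0.
  exact: truncn_def.
apply/seteqP; split => [[w t]/= h|[w t] [k _ [/= h hk]]]/=.
  by exists (Num.truncn (n.+1%:R * `|t|)).
by rewrite /grid_after hk.
Qed.

(** A right-continuous path at time [t] is the limit of its values at grid
points after [t], and a process sampled on a grid takes countably many times.
The absolute value extends the time set to the whole line. *)
Lemma measurable_right_continuous :
  measurable_fun [set: T * measurableTypeR R] (fun w => X `|w.2| w.1).
Proof.
apply: (measurable_fun_cvg measurable_sampled) => -[w t] _ /=.
have /cvg_at_rightP := @rcX w `|t| (normr_ge0 t); apply; split.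
  by move=> n; exact: grid_after_gt.
exact: grid_after_cvg.
Qed.

End joint_measurability.

Section complex_components.
Context {R : realType}.

Lemma expC_Complex (x y : R) :
  expC (x +i* y)%C = ((expR x * cos y) +i* (expR x * sin y))%C.
Proof. by rewrite /expC /=; simpc. Qed.

Lemma modC_inv (x y : R) : modC (1 / (x +i* y)%C) = (Num.sqrt (x ^+ 2 + y ^+ 2))^-1.
Proof. by rewrite /modC mul1r ComplexField.Normc.normcV. Qed.

End complex_components.

Section levy_resolvent.
Context {R : realType} d (T : measurableType d) (P : probability T R).
Notation mu := (@lebesgue_measure R).
Notation D := (`[0%R, +oo[%classic : set R).
Variables (X : R -> T -> R) (Psi : R -> R[i]) (r : R -> R -> R).
Hypothesis X_levy : levy_process P X.
Hypothesis X_Psi : characteristic_exponent P X Psi.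
Hypothesis Psi_integrable : forall q : R, 0 < q ->
      (\int[lebesgue_measure]_(l in `[0%R, +oo[)
         (modC (1 / (q%:C + Psi l)))%:E < +oo)%E.
Hypothesis r_bounded : forall q : R, 0 < q -> exists M : R, forall x, `|r q x| <= M.
Hypothesis r_continuous : forall q : R, 0 < q -> continuous (r q).
Hypothesis r_resolvent : forall q : R, 0 < q -> resolvent_density P X q (r q).

Definition rePsi l : R := complex.Re (Psi l).
Definition imPsi l : R := complex.Im (Psi l).
Local Notation a := rePsi.
Local Notation b := imPsi.

Lemma PsiE l : Psi l = (a l +i* b l)%C.
Proof. by rewrite /a /b; case: (Psi l). Qed.

Lemma cos_characteristic t l : 0 <= t ->
  \int[P]_w cos (l * X t w) = expR (- (t * a l)) * cos (t * b l).
Proof.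
move=> t0; have := X_Psi l t0; rewrite /expectationC PsiE.
have -> : - (t%:C * (a l +i* b l)) = ((- (t * a l)) +i* (- (t * b l)))%C by simpc.
rewrite expC_Complex cosN sinN => -[<- _]; apply: eq_Rintegral => w _.
by rewrite expR0 mul1r mul0r subr0.
Qed.

Lemma sin_characteristic t l : 0 <= t ->
  \int[P]_w sin (l * X t w) = - (expR (- (t * a l)) * sin (t * b l)).
Proof.
move=> t0; have := X_Psi l t0; rewrite /expectationC PsiE.
have -> : - (t%:C * (a l +i* b l)) = ((- (t * a l)) +i* (- (t * b l)))%C by simpc.
rewrite expC_Complex cosN sinN mulrN => -[_ <-]; apply: eq_Rintegral => w _.
by rewrite expR0 mul1r mul0r addr0.
Qed.

Let mX := levy_measurable X_levy.

(** [expR (- a l)] is the mean of a cosine, after rotation of the characteristic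
function by the phase [b l]. *)
Lemma rePsi_ge0 l : 0 <= a l.
Proof.
have h : expR (- a l) = \int[P]_w cos (l * X 1 w + b l).
  have iC := integrable_cosY P (mX ler01) l.
  have iS := integrable_sinY P (mX ler01) l.
  have -> : \int[P]_w cos (l * X 1 w + b l) =
    \int[P]_w (cos (b l) * cos (l * X 1 w) - sin (b l) * sin (l * X 1 w)).
    by apply: eq_Rintegral => w _; rewrite cosD; ring.
  rewrite RintegralB//; [|exact: integrable_mull..].
  rewrite !RintegralZl// cos_characteristic// sin_characteristic// !mul1r.
  have := cos2Dsin2 (b l); move: (expR _) => e h.
  have -> : cos (b l) * (e * cos (b l)) - sin (b l) * - (e * sin (b l)) =
    e * (cos (b l) ^+ 2 + sin (b l) ^+ 2) by ring.
  by rewrite h mulr1.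
rewrite -oppr_le0 -expR_le1 h -[leRHS](Rintegral_probability_cst P 1).
apply: le_Rintegral => //.
- apply: (@integrable_bounded _ _ _ P _ 1); last by move=> w; exact: norm_cos_le1.
  apply: measurableT_comp; first by apply: continuous_measurable_fun; exact: continuous_cos.
  by apply: measurable_funD => //; apply: measurable_funM => //; exact: (mX ler01).
- exact: integrable_one.
Qed.

Lemma measurable_occupation (q : R) (f : R -> R) : measurable_fun [set: R] f ->
  measurable_fun [set: T * measurableTypeR R]
    (fun w => (expR (- (q * w.2)) * f (X `|w.2| w.1) * \1_D w.2)%:E).
Proof.
move=> mf; apply/measurable_EFinP; apply: measurable_funM; first apply: measurable_funM.
- apply: (measurableT_comp (measurable_damp q)); exact: measurable_snd.
- apply: (measurableT_comp mf); apply: measurable_right_continuous => //.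
  exact: levy_right_continuous X_levy.
- by apply: (measurableT_comp _ measurable_snd); apply: measurable_indic.
Qed.

Section occupation.
Variables (q : R) (f g : R -> R).
Hypothesis mf : measurable_fun [set: R] f.
Hypothesis f0 : forall x, 0 <= f x.
Hypothesis fg : forall t, 0 <= t -> (\int[P]_w (f (X t w))%:E = (g t)%:E)%E.

Let F (w : T * measurableTypeR R) :=
  (expR (- (q * w.2)) * f (X `|w.2| w.1) * \1_D w.2)%:E.

Let F0 w : (0 <= F w)%E.
Proof. by rewrite lee_fin mulr_ge0 ?mulr_ge0 ?expR_ge0// indicE. Qed.

Let mF : measurable_fun [set: T * measurableTypeR R] F.
Proof. exact: measurable_occupation. Qed.

Let integral_F t : (\int[P]_w F (w, t))%E = (((fun t => expR (- (q * t)) * g t) \_ D) t)%:E.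
Proof.
rewrite patchE /F; case: ifPn => [tD|tD]; last first.
  under eq_integral do rewrite indicE (negbTE tD) mulr0.
  by rewrite integral0.
have t0 : 0 <= t by move: tD; rewrite inE/= in_itv/= andbT.
under eq_integral do rewrite /= indicE tD mulr1 (ger0_norm t0) EFinM.
rewrite ge0_integralZl_EFin ?expR_ge0// ?fg//.
- by move=> w _; rewrite lee_fin.
- by apply/measurable_EFinP; apply: (measurableT_comp mf); exact: mX.
Qed.

(** Stated with [f (X t)] having a finite mean [g t] at each time, so that the
inner integral can be named by a real function. *)
Lemma occupation_tonelli :
  (\int[P]_w \int[mu]_(t in `[0%R, +oo[) (expR (- (q * t)) * f (X t w))%:E =
   \int[mu]_(t in `[0%R, +oo[) (expR (- (q * t)) * g t)%:E)%E.
Proof.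
transitivity (\int[P]_w \int[mu]_t F (w, t))%E.
  apply: eq_integral => w _; rewrite [LHS]integral_mkcond; apply: eq_integral => t _.
  rewrite patchE /F/= indicE; case: ifPn => [tD|_]; last by rewrite mulr0.
  by rewrite mulr1 ger0_norm//; move: tD; rewrite inE/= in_itv/= andbT.
rewrite (@fubini_tonelli _ _ T (measurableTypeR R) R P mu F mF F0).
rewrite [RHS]integral_mkcond; apply: eq_integral => t _.
by rewrite integral_F restrict_EFin.
Qed.

Lemma measurable_occupation_density :
  measurable_fun D (fun t => expR (- (q * t)) * g t).
Proof.
apply/(measurable_restrictT _ _).2 => //; apply/measurable_EFinP.
have h : measurable_fun [set: measurableTypeR R] (fubini_G P F).
  exact: measurable_fun_fubini_tonelli_G.
by apply: eq_measurable_fun h => t _; rewrite /fubini_G integral_F.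
Qed.

End occupation.

Lemma resolvent_tonelli (q : R) (f g : R -> R) : 0 < q ->
  measurable_fun [set: R] f -> (forall x, 0 <= f x) ->
  (forall t, 0 <= t -> (\int[P]_w (f (X t w))%:E = (g t)%:E)%E) ->
  (\int[mu]_x (f x * r q x)%:E =
   \int[mu]_(t in `[0%R, +oo[) (expR (- (q * t)) * g t)%:E)%E.
Proof. by move=> q0 mf f0 fg; rewrite r_resolvent//; exact: occupation_tonelli. Qed.

End levy_resolvent.

Section levy_resolvent_family_section.
Context {R : realType} d (T : measurableType d) (P : probability T R).
Notation mu := (@lebesgue_measure R).
Notation D := (`[0%R, +oo[%classic : set R).
Variables (X : R -> T -> R) (Psi : R -> R[i]) (r : R -> R -> R).
Hypothesis X_levy : levy_process P X.
Hypothesis X_Psi : characteristic_exponent P X Psi.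
Hypothesis Psi_integrable : forall q : R, 0 < q ->
      (\int[lebesgue_measure]_(l in `[0%R, +oo[)
         (modC (1 / (q%:C + Psi l)))%:E < +oo)%E.
Hypothesis r_bounded : forall q : R, 0 < q -> exists M : R, forall x, `|r q x| <= M.
Hypothesis r_continuous : forall q : R, 0 < q -> continuous (r q).
Hypothesis r_resolvent : forall q : R, 0 < q -> resolvent_density P X q (r q).

Local Notation a := (rePsi Psi).
Local Notation b := (imPsi Psi).

Let mX := levy_measurable X_levy.

Lemma measurable_r q : 0 < q -> measurable_fun [set: R] (r q).
Proof. by move=> q0; apply: continuous_measurable_fun; exact: r_continuous. Qed.

(** If [r q] were negative at a point, then by continuity it would be so on an
interval, whose discounted occupation time would have a negative mean. *)
Lemma r_ge0 q z : 0 < q -> 0 <= r q z.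
Proof.
move=> q0; rewrite leNgt; apply/negP => rz.
have k0 : 0 < - r q z / 2 by rewrite divr_gt0// oppr_gt0.
have /cvgrPdist_le/(_ _ k0)/nbhs_ballP[e /= e0 he] := r_continuous q0 (x := z).
pose f : R -> R := \1_(`]z - e, z + e[).
have mf : measurable_fun [set: R] f by apply: measurable_indic.
have f0 x : 0 <= f x by rewrite /f indicE.
have iff : mu.-integrable [set: R] (EFin \o f) by exact: integrable_indic_itv.
have [M hM] := r_bounded q0.
have ifr : mu.-integrable [set: R] (EFin \o (fun x => f x * r q x)).
  apply: (@integrable_scale_le R _ _ mu [set: R] _ f M) => //.
    by apply: measurable_funM => //; exact: measurable_r.
  by move=> x _; rewrite normrM mulrC ler_wpM2r.
have := r_resolvent q0 mf f0; apply/eqP; rewrite lt_eqF//.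
apply: (@lt_le_trans _ _ 0%E); last first.
  apply: integral_ge0 => w _; apply: integral_ge0 => t _.
  by rewrite lee_fin mulr_ge0 ?expR_ge0.
apply: (@le_lt_trans _ _ (\int[mu]_x ((r q z / 2) * f x)%:E)%E).
  apply: le_integral => //; first exact: integrable_mull.
  move=> x _; rewrite lee_fin mulrC; rewrite /f indicE.
  case: (boolP (x \in _)) => [|_]; last by rewrite !mulr0.
  rewrite inE/= in_itv/= !mulr1 => /andP[x1 x2].
  have := he x; rewrite /ball/=.
  have -> : `|z - x| < e by rewrite ltr_norml; apply/andP; split; lra.
  by move=> /(_ isT); rewrite ler_norml => /andP[h1 h2]; lra.
under eq_integral do rewrite EFinM.
rewrite integralZl// integral_indic// setIT /= lebesgue_measure_itv/= lte_fin.
rewrite ifT; last by lra.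
by rewrite -EFinB -EFinM lte_fin nmulr_rlt0//; lra.
Qed.

Lemma integral_r q : 0 < q -> (\int[mu]_x (r q x)%:E = (q^-1)%:E)%E.
Proof.
move=> q0.
have := @resolvent_tonelli R d T P X r X_levy r_resolvent q (cst 1) (cst 1) q0
  (measurable_cst _) (fun=> ler01) _.
under eq_integral do rewrite mul1r.
move=> ->; last first.
  move=> t t0; rewrite (_ : (fun w => _) = cst 1%E)// integral_cst// mul1e.
  exact: probability_setT.
rewrite -(Rintegral_expRN q0) /Rintegral fineK; last first.
  by apply: integrable_fin_num => //; exact: integrable_expRN.
by apply: eq_integral => t _; rewrite mulr1.
Qed.

Lemma integrable_r q : 0 < q -> mu.-integrable [set: R] (EFin \o r q).
Proof.
move=> q0; apply/integrableP; split; first by apply/measurable_EFinP; exact: measurable_r.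
under eq_integral do rewrite /= ger0_norm ?r_ge0//.
by rewrite integral_r// ltry.
Qed.

Lemma integrable_r_trig q (k : R -> R) : 0 < q -> measurable_fun [set: R] k ->
  (forall z, `|k z| <= 1) -> mu.-integrable [set: R] (EFin \o (fun z => r q z * k z)).
Proof.
move=> q0 mk k1; apply: (@integrable_scale_le R _ _ mu [set: R] _ (r q) 1) => //.
- by apply: measurable_funM => //; exact: measurable_r.
- exact: integrable_r.
- by move=> z _; rewrite mul1r normrM ler_piMr.
Qed.

(** The resolvent identity is stated for nonnegative functions: it is applied to
[1 + k], and then the mass [1 / q] is subtracted. *)
Lemma r_trig q (k : R -> R) (o l : R) : 0 < q -> measurable_fun [set: R] k ->
  (forall z, `|k z| <= 1) ->
  (forall t, 0 <= t -> \int[P]_w k (X t w) = expR (- (a l * t)) * cos (b l * t + o)) ->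
  \int[mu]_z (r q z * k z) =
  ((q + a l) * cos o - b l * sin o) / ((q + a l) ^+ 2 + b l ^+ 2).
Proof.
move=> q0 mk k1 hk.
have a0 := rePsi_ge0 X_levy X_Psi l.
have ikX t : 0 <= t -> P.-integrable [set: T] (EFin \o (fun w => k (X t w))).
  move=> t0; apply: (@integrable_bounded _ _ _ P _ 1) => //.
  by apply: (measurableT_comp mk); exact: mX.
have h1 := @resolvent_tonelli R d T P X r X_levy r_resolvent q (fun z => 1 + k z)
  (fun t => 1 + expR (- (a l * t)) * cos (b l * t + o)) q0 _ _ _.
have e : (\int[mu]_z ((1 + k z) * r q z)%:E =
  (q^-1 + ((q + a l) * cos o - b l * sin o) / ((q + a l) ^+ 2 + b l ^+ 2))%:E)%E.
  rewrite h1 ?integral_expR_cos//.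
  - exact: measurable_funD.
  - by move=> z; have := k1 z; rewrite ler_norml => /andP[+ _]; lra.
  - move=> t t0; have i1 := integrable_one P.
    have hv : \int[P]_w (1 + k (X t w)) = 1 + expR (- (a l * t)) * cos (b l * t + o).
      by rewrite RintegralD//; [rewrite Rintegral_probability_cst hk|exact: ikX].
    rewrite -hv /Rintegral fineK//; apply: integrable_fin_num => //.
    by apply: integrableD_EFin => //; exact: ikX.
have -> : \int[mu]_z (r q z * k z) = \int[mu]_z ((1 + k z) * r q z) - \int[mu]_z r q z.
  rewrite -RintegralB//; last 2 first.
  - have := @integrableD_EFin R _ _ mu [set: R] _ _ measurableT (integrable_r q0) (integrable_r_trig q0 mk k1).
    by apply: eq_integrable => // z _ /=; congr EFin; ring.
  - exact: integrable_r.
  by apply: eq_Rintegral => z _; ring.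
by rewrite /Rintegral e integral_r//= addrC addKr.
Qed.

Lemma r_cos q l : 0 < q -> \int[mu]_z (r q z * cos (l * z)) = reF a b q l.
Proof.
move=> q0; rewrite (@r_trig q (fun z => cos (l * z)) 0 l)//.
- by rewrite cos0 sin0 mulr0 subr0 mulr1.
- by under eq_fun do rewrite mulrC; exact: measurable_fun_cosM.
- by move=> z; exact: norm_cos_le1.
- by move=> t t0; rewrite (cos_characteristic X_Psi)// addr0 !(mulrC t).
Qed.

Lemma r_sin q l : 0 < q -> \int[mu]_z (r q z * sin (l * z)) = imF a b q l.
Proof.
move=> q0; rewrite (@r_trig q (fun z => sin (l * z)) (pi / 2) l)//.
- by rewrite cos_pihalf sin_pihalf mulr0 sub0r mulr1.
- by under eq_fun do rewrite mulrC; exact: measurable_fun_sinM.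
- by move=> z; exact: norm_sin_le1.
- by move=> t t0; rewrite (sin_characteristic X_Psi)// cosDpihalf !(mulrC t) mulrN.
Qed.

(** The characteristic function of [r 1] is measurable as a parametric integral.
This is how the measurability of [Psi] is obtained, [1 + Psi] being the inverse
of that function. *)
Lemma measurable_r_trig (k : R -> R) :
  measurable_fun [set: R] k -> (forall z, `|k z| <= 1) ->
  measurable_fun [set: R] (fun l => \int[mu]_z (r 1 z * k (l * z))).
Proof.
move=> mk k1.
have mkl l : measurable_fun [set: R] (fun z => k (l * z)).
  by apply: (measurableT_comp mk); exact: measurable_funM.
have ik l := integrable_r_trig ltr01 (mkl l) (fun z => k1 (l * z)).
have mG : measurable_fun [set: measurableTypeR R]
    (fun l => (\int[mu]_z (r 1 z * (1 + k (l * z)))%:E)%E).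
  apply: (measurable_fun_fubini_tonelli_F
    (fun w : measurableTypeR R * measurableTypeR R => (r 1 w.2 * (1 + k (w.1 * w.2)))%:E)).
    apply/measurable_EFinP; apply: measurable_funM.
      exact: (measurableT_comp (measurable_r ltr01) measurable_snd).
    apply: measurable_funD => //; apply: (measurableT_comp mk).
    by apply: measurable_funM; [exact: measurable_fst|exact: measurable_snd].
  move=> w; rewrite lee_fin mulr_ge0 ?r_ge0//.
  by have := k1 (w.1 * w.2); rewrite ler_norml => /andP[+ _]; lra.
have mG' : measurable_fun [set: R] (fun l => \int[mu]_z (r 1 z * (1 + k (l * z)))).
  by apply: (measurableT_comp (@fine_measurable R setT measurableT)).
rewrite (_ : (fun l => _) = (fun l => \int[mu]_z (r 1 z * (1 + k (l * z))) - 1)).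
  exact: measurable_funB.
apply/funext => l.
have -> : \int[mu]_z (r 1 z * (1 + k (l * z))) = \int[mu]_z (r 1 z + r 1 z * k (l * z)).
  by apply: eq_Rintegral => z _; ring.
rewrite RintegralD//; last exact: integrable_r.
by rewrite {2}/Rintegral integral_r// invr1/=; ring.
Qed.

Lemma sqmod1_gt0 l : 0 < sqmod a b 1 l.
Proof.
have a0 := rePsi_ge0 X_levy X_Psi l.
by rewrite /sqmod ltr_pwDl ?sqr_ge0// exprn_gt0//; lra.
Qed.

Lemma inv_sqmod1 l : (sqmod a b 1 l)^-1 = reF a b 1 l ^+ 2 + imF a b 1 l ^+ 2.
Proof.
have := sqmod1_gt0 l; rewrite /reF /imF /sqmod => N0.
by field; rewrite gt_eqF.
Qed.

Lemma measurable_reF1 : measurable_fun [set: R] (reF a b 1).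
Proof.
have := measurable_r_trig (k := @cos R) _ norm_cos_le1.
under eq_fun do rewrite r_cos//.
by apply; apply: continuous_measurable_fun; exact: continuous_cos.
Qed.

Lemma measurable_imF1 : measurable_fun [set: R] (imF a b 1).
Proof.
have := measurable_r_trig (k := @sin R) _ norm_sin_le1.
under eq_fun do rewrite r_sin//.
by apply; apply: continuous_measurable_fun; exact: continuous_sin.
Qed.

Lemma measurable_sqmod1 : measurable_fun [set: R] (sqmod a b 1).
Proof.
rewrite (_ : sqmod a b 1 = (fun l => (reF a b 1 l ^+ 2 + imF a b 1 l ^+ 2)^-1)).
  apply: measurable_inv.
    by apply: measurable_funD; apply: measurable_funX; [exact: measurable_reF1|exact: measurable_imF1].
  by move=> l; rewrite -inv_sqmod1 invr_gt0 sqmod1_gt0.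
by apply/funext => l; rewrite -inv_sqmod1 invrK.
Qed.

Lemma measurable_rePsi : measurable_fun [set: R] a.
Proof.
rewrite (_ : rePsi Psi = (fun l => reF a b 1 l * sqmod a b 1 l - 1)).
  by apply: measurable_funB => //; apply: measurable_funM; [exact: measurable_reF1|exact: measurable_sqmod1].
by apply/funext => l; rewrite /reF mulfVK ?gt_eqF ?sqmod1_gt0//; ring.
Qed.

Lemma measurable_imPsi : measurable_fun [set: R] b.
Proof.
rewrite (_ : imPsi Psi = (fun l => - (imF a b 1 l * sqmod a b 1 l))).
  by apply: measurableT_comp => //; apply: measurable_funM; [exact: measurable_imF1|exact: measurable_sqmod1].
by apply/funext => l; rewrite /imF mulfVK ?gt_eqF ?sqmod1_gt0// opprK.
Qed.

Lemma modC_absF q l : modC (1 / (q%:C + Psi l)) = absF a b q l.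
Proof. by rewrite (PsiE Psi) /absF /sqmod -modC_inv; congr (modC (1 / _)); simpc. Qed.

Theorem levy_resolvent_family : resolvent_family a b r.
Proof.
split.
- exact: measurable_rePsi.
- exact: measurable_imPsi.
- exact: rePsi_ge0 X_levy X_Psi.
- exact: r_ge0.
- by move=> q /r_bounded[M hM]; exists M => z; rewrite (le_trans (ler_norm _)).
- exact: r_continuous.
- exact: integrable_r.
- by move=> q q0; rewrite /Rintegral integral_r.
- exact: r_cos.
- exact: r_sin.
- move=> q q0; apply/integrableP; split.
    apply/measurable_EFinP; apply: measurable_funTS.
    have N0 l : 0 < sqmod a b q l.
      rewrite /sqmod ltr_pwDl ?sqr_ge0// exprn_gt0// ltr_pwDl//.
      exact: (rePsi_ge0 X_levy X_Psi).
    apply: measurable_inv; last by move=> l; rewrite sqrtr_gt0.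
    apply: measurableT_comp; first by apply: continuous_measurable_fun; exact: sqrt_continuous.
    apply: measurable_funD; apply: measurable_funX; last exact: measurable_imPsi.
    by apply: measurable_funD => //; exact: measurable_rePsi.
  apply: le_lt_trans (Psi_integrable q0); rewrite le_eqVlt; apply/orP; left; apply/eqP.
  by apply: eq_integral => l _; rewrite modC_absF /= ger0_norm// absF_ge0.
Qed.

End levy_resolvent_family_section.

(** * Recurrence and conclusion *)

Section recurrence.
Context {R : realType} d (T : measurableType d) (P : probability T R).
Notation mu := (@lebesgue_measure R).
Notation D := (`[0%R, +oo[%classic : set R).
Variables (X : R -> T -> R) (Psi : R -> R[i]) (r : R -> R -> R).
Hypothesis X_levy : levy_process P X.
Hypothesis X_recurrent : recurrent P X.
Hypothesis r_continuous : forall q : R, 0 < q -> continuous (r q).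
Hypothesis r_resolvent : forall q : R, 0 < q -> resolvent_density P X q (r q).

(** If [r q <= K], then the mean discounted occupation time of [(-1, 1)] is at
most [2 K]; letting [q -> 0+] along [1 / n.+1], so is the mean occupation time,
by monotone convergence. *)
Lemma recurrent_unbounded (K : R) : (forall q z, 0 < q -> 0 <= r q z) ->
  ~ (forall q z, 0 < q -> r q z <= K).
Proof.
move=> r0 rK; have K0 : 0 <= K by rewrite (le_trans (r0 _ 0 ltr01))// rK.
pose f : R -> R := \1_(`]-1, 1[).
have mf : measurable_fun [set: R] f by apply: measurable_indic.
have f0 x : 0 <= f x by rewrite /f indicE.
pose g t := \int[P]_w f (X t w).
have ifX t : 0 <= t -> P.-integrable [set: T] (EFin \o (fun w => f (X t w))).
  move=> t0; apply: (@integrable_bounded _ _ _ P _ 1).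
    by apply: (measurableT_comp mf); exact: levy_measurable X_levy t t0.
  by move=> w; rewrite /f indicE; case: (_ \in _); rewrite ?normr1 ?normr0.
have fg t : 0 <= t -> (\int[P]_w (f (X t w))%:E = (g t)%:E)%E.
  by move=> t0; rewrite /g /Rintegral fineK//; apply: integrable_fin_num => //; exact: ifX.
have g0 t : 0 <= g t by apply: Rintegral_ge0 => w _; exact: f0.
have infinite : (\int[mu]_(t in D) (g t)%:E = +oo)%E.
  have := occupation_tonelli X_levy 0 mf f0 fg.
  under [X in _ = X -> _]eq_integral do rewrite mul0r oppr0 expR0 mul1r.
  move=> <-; rewrite -(X_recurrent 0 ltr01); apply: eq_integral => w _.
  apply: eq_integral => t _; rewrite mul0r oppr0 expR0 mul1r /f !indicE.
  congr ((nat_of_bool _)%:R%:E); apply/idP/idP => /set_mem/= h; apply/mem_set => /=.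
    by move: h; rewrite addr0 in_itv/= ltr_norml.
  by move: h; rewrite addr0 in_itv/= ltr_norml.
have bound q : 0 < q -> (\int[mu]_(t in D) (expR (- (q * t)) * g t)%:E <= (2 * K)%:E)%E.
  move=> q0; rewrite -(resolvent_tonelli X_levy r_resolvent q0 mf f0 fg).
  apply: (@le_trans _ _ (\int[mu]_x (K%:E * (f x)%:E))%E).
    apply: ge0_le_integral => //.
    - by move=> x _; rewrite lee_fin mulr_ge0// r0.
    - apply/measurable_EFinP; apply: measurable_funM => //.
      by apply: continuous_measurable_fun; exact: r_continuous.
    - by apply: measurable_funeM; apply/measurable_EFinP.
    - by move=> x _; rewrite -EFinM lee_fin mulrC ler_wpM2r// rK.
  rewrite ge0_integralZl_EFin//; last 2 first.
  - by move=> x _; rewrite lee_fin.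
  - exact/measurable_EFinP.
  rewrite integral_indic// setIT /= lebesgue_measure_itv/= lte_fin ifT; last by lra.
  by rewrite -EFinB -EFinM lee_fin; lra.
pose G (n : nat) (t : R) := (expR (- (n.+1%:R^-1 * t)) * g t)%:E.
have h : (\int[mu]_(t in D) G n t)%E @[n --> \oo] --> (\int[mu]_(t in D) (g t)%:E)%E.
  rewrite (_ : (\int[mu]_(t in D) (g t)%:E) = \int[mu]_(t in D) limn (G^~ t))%E; last first.
    apply: eq_integral => t _; apply/esym/cvg_lim => //.
    apply: cvg_EFin; first exact: nearW.
    rewrite -[X in _ --> X]mul1r; apply: cvgM; last exact: cvg_cst.
    rewrite -[X in _ --> X](expR0 R); apply: (cvg_comp (fun n : nat => - (n.+1%:R^-1 * t)) (@expR R)); last exact: continuous_expR.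
    have -> : (0 : R) = - (0 * t) by rewrite mul0r oppr0.
    by apply: cvgN; apply: cvgM; [exact: cvg_harmonic|exact: cvg_cst].
  apply: cvg_monotone_convergence => //.
  - move=> n; apply/measurable_EFinP.
    exact: (measurable_occupation_density X_levy n.+1%:R^-1 mf f0 fg).
  - by move=> n t _; rewrite lee_fin mulr_ge0 ?expR_ge0.
  - move=> t; rewrite /= in_itv/= andbT => t0 n m nm; rewrite lee_fin ler_wpM2r//.
    by rewrite ler_expR lerN2 ler_wpM2r// lef_pV2 ?posrE// ler_nat.
have : (\int[mu]_(t in D) (g t)%:E <= (2 * K)%:E)%E.
  apply: (cvge_to_le h); near=> n; apply: bound; rewrite invr_gt0//.
by rewrite infinite.
Unshelve. all: by end_near. Qed.

End recurrence.

(* In the formula for h the right-hand side is an extended real; since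
   (+oo) + (-oo) = -oo, its being finite contains the absolute convergence of
   the integral. *)
Theorem theorem1p1 (R : realType) (d : measure_display) (T : measurableType d)
    (P : probability T R) (X : R -> T -> R) (Psi : R -> R[i])
    (r : R -> R -> R)
    (X_levy : levy_process P X)
    (X_Psi : characteristic_exponent P X Psi)
    (X_recurrent : recurrent P X)
    (Psi_integrable : forall q : R, 0 < q ->
      (\int[lebesgue_measure]_(l in `[0%R, +oo[)
         (modC (1 / (q%:C + Psi l)))%:E < +oo)%E)
    (r_bounded : forall q : R, 0 < q -> exists M : R, forall x, `|r q x| <= M)
    (r_continuous : forall q : R, 0 < q -> continuous (r q))
    (r_resolvent : forall q : R, 0 < q -> resolvent_density P X q (r q)) :
  exists h : R -> R,
    [/\ forall x : R, h_ r q x @[q --> 0^'+] --> h x,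
        ('E_P[(fun w => X 1 w ^+ 2)%R] < +oo)%E ->
          forall x : R,
            (h x)%:E = ((pi^-1)%:E * \int[lebesgue_measure]_(l in `[0%R, +oo[)
              (complex.Re ((1 - expC (0 +i* (l * x))) / Psi l))%:E)%E,
        {family compact, h_ r q @[q --> 0^'+] --> h},
        continuous h &
        forall x y : R, h (x + y) <= h x + h y].
Proof.
have H := levy_resolvent_family X_levy X_Psi Psi_integrable r_bounded r_continuous r_resolvent.
have [c c0 hc] := one_sub_reF1_ge H.
pose a := rePsi Psi; pose b := imPsi Psi.
have mY : measurable_fun [set: T] (X 1) by exact: levy_measurable X_levy 1 ler01.
have phiC l : \int[P]_w cos (l * X 1 w) = expR (- a l) * cos (b l).
  by rewrite (cos_characteristic X_Psi)// !mul1r.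
have phiS l : \int[P]_w sin (l * X 1 w) = - (expR (- a l) * sin (b l)).
  by rewrite (sin_characteristic X_Psi)// !mul1r.
have rle q z : 0 < q -> r q z <= r q 0 by exact: rho_max_at0 H _ _.
suff [B [dB hB]] : exists B : R, (drift a b q @[q --> 0^'+] --> B) /\
    (('E_P[(fun w => X 1 w ^+ 2)%R] < +oo)%E -> forall x : R,
      (potential_kernel a b B x)%:E = ((pi^-1)%:E * \int[lebesgue_measure]_(l in `[0%R, +oo[)
              (complex.Re ((1 - expC (0 +i* (l * x))) / Psi l))%:E)%E).
  exists (potential_kernel a b B); split => //.
  - move=> x; exact: (hq_cvg H c0 hc dB).
  - exact: (hq_cvg_compact H c0 hc dB).
  - exact: (continuous_potential_kernel H c0 hc dB).
  - exact: (potential_kernel_subadditive H c0 hc dB (rho_subadditive H)).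
have mY2 : measurable_fun [set: T] (fun w => X 1 w ^+ 2) by exact: measurable_funX.
rewrite unlock.
have [fin|inf] := ltP (\int[P]_w (X 1 w ^+ 2)%:E)%E +oo%E; last first.
  have VY : (\int[P]_w (X 1 w ^+ 2)%:E = +oo)%E by apply/eqP; rewrite -leye_eq.
  have hV := infinite_variance_modulus mY (rf_re_ge0 H) phiC VY.
  have [|B dB] := drift_cvg_infinite_variance H c0 hc rle.
    move=> A A0; have [e e0 he] := hV A A0; exists e => // l l0 le.
    by rewrite sqmod0E; exact: he.
  by exists B; split => //; rewrite VY.
have iY2 : P.-integrable [set: T] (EFin \o (fun w => X 1 w ^+ 2)).
  apply/integrableP; split; first exact/measurable_EFinP.
  by under eq_integral do rewrite /= ger0_norm ?sqr_ge0//.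
have mean0 : \int[P]_w X 1 w = 0.
  apply/eqP/negPn/negP => mean.
  have [K hK] := rho0_bounded H c0 hc mY phiC phiS iY2 mean.
  apply: (@recurrent_unbounded R d T P X r X_levy X_recurrent r_continuous r_resolvent K).
    by move=> q z q0; exact: (rf_ge0 H).
  by move=> q z q0; rewrite (le_trans (rle q z q0))// hK.
have [isin dB] := drift_cvg_finite_variance H c0 hc mY phiS iY2 mean0.
exists (drift a b 0); split => // _ x.
have [ih ->] := potential_kernel_drift0 H c0 hc x isin.
rewrite EFinM /Rintegral fineK; last exact: integrable_fin_num.
congr (_ * _)%E; apply: eq_integral => l _; congr EFin.
rewrite expC_Complex (PsiE Psi) expR0 !mul1r /reF /imF /sqmod add0r.
rewrite -/(a l) -/(b l); simpc => /=.
by ring.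
Qed.
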